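(* Let $H\in(1/2,1)$, let $B=(B_t)_{t\in[0,T]}$ be a fractional Brownian motion with Hurst index $H$, let $x_0\in\mathbb{R}$, $\sigma\in C_b^2$, $b\in C_b^1$, and let $X=(X_t)_{t\in[0,T]}$ be the solution of $$X_t = x_0+\int_0^t\sigma(X_s)\,dB_s+\int_0^t b(X_s)\,ds,\qquad t\in[0,T].$$ Assume moreover that $\sigma$ and $b$ are proportional, i.e. $b=r\sigma$ for some $r\in\mathbb{R}$. Let $t\in(0,T)$. Then $X$ admits a forward and a backward stochastic derivative with respect to the present $t$, given by $$D_+^{\mathcal{T}}X_t=D_-^{\mathcal{T}}X_t=H t^{-1}\sigma(X_t)B_t+b(X_t).$$ In particular, the present $\mathcal{T}_t^X$ is nondegenerate at $t$ if and only if $\sigma(x_0)\neq 0$, and the collection of $\sigma$-fields $\mathcal{T}^X=\{\mathcal{T}_t^X,\ t\in(0,T)\}$ is discriminating for $X$.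
   Context: Let $T>0$ and let $(\Omega,\mathcal{F},\mathbb{P})$ be a complete probability space. A fractional Brownian motion with Hurst index $H$ is a centered continuous Gaussian process $B=(B_t)_{t\in[0,T]}$ with $\mathrm{E}(B_sB_t)=R_H(s,t)=\frac12(t^{2H}+s^{2H}-|t-s|^{2H})$. $C_b^k$ is the set of $C^k$ functions $\mathbb{R}\to\mathbb{R}$ whose derivatives of order $1$ to $k$ are bounded. The integral with respect to $B$ in the equation is the forward (Russo–Vallois) integral $\int_0^{\cdot} Z_s\,dB_s=\lim_{\varepsilon\to0}\varepsilon^{-1}\int_0^{\cdot} Z_s(B_{s+\varepsilon}-B_s)\,ds$ (uniform convergence in probability), which coincides with the pathwise Young integral for $Z$ with a.s. $\alpha$-Hölder paths, $\alpha>1-H$; the equation has a unique solution among processes whose paths are Hölder continuous of some order $\alpha>1-H$, and $X$ denotes that solution. For a process $Z$ with $Z_t\in L^2(\Omega)$ for all $t$, put $\Delta_hZ_t=(Z_{t+h}-Z_t)/h$ for $h\ne 0$. For $t\in(0,T)$, a sub-$\sigma$-field $\mathcal{A}$ of $\mathcal{F}$ is a forward (resp. backward) differentiating $\sigma$-field for $Z$ at $t$ if $\mathrm{E}[\Delta_hZ_t\mid\mathcal{A}]$ (resp. $\mathrm{E}[\Delta_{-h}Z_t\mid\mathcal{A}]$) converges in probability as $h\downarrow0$; the limit is denoted $D_+^{\mathcal{A}}Z_t$ (resp. $D_-^{\mathcal{A}}Z_t$). Such an $\mathcal{A}$ is called nondegenerate if for every $c\in\mathbb{R}$, $\mathbb{P}(D_+^{\mathcal{A}}Z_t=c)<1$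 (resp. $\mathbb{P}(D_-^{\mathcal{A}}Z_t=c)<1$). A collection $(\mathcal{A}^t)_{t\in(0,T)}$ is differentiating for $Z$ if for each $t\in(0,T)$, $\mathcal{A}^t$ is both a forward and a backward differentiating $\sigma$-field for $Z$ at $t$; it is discriminating for $Z$ if it is differentiating and if [$D_+^{\mathcal{A}^t}Z_t=D_-^{\mathcal{A}^t}Z_t=0$ for all $t\in(0,T)$] implies that $Z$ is a.s. a constant process on $[0,T]$. $\mathcal{T}_t^Z$ (''the present'') is the $\sigma$-field generated by $Z_t$. $Z$ admits a forward (resp. backward) stochastic derivative with respect to the present $t$ if $\mathcal{T}_t^Z$ is a forward (resp. backward) differentiating $\sigma$-field for $Z$ at $t$; one then writes $D_{\pm}^{\mathcal{T}}Z_t:=D_{\pm}^{\mathcal{T}_t^Z}Z_t$. *)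

(* Defs.v *)
From HB Require Import structures.
From mathcomp Require Import all_boot all_order all_algebra.
From mathcomp Require Import all_classical all_reals all_analysis.

Set Implicit Arguments.
Unset Strict Implicit.
Unset Printing Implicit Defensive.

Import Order.TTheory GRing.Theory Num.Theory.
Import numFieldNormedType.Exports.

Local Open Scope classical_set_scope.
Local Open Scope ring_scope.

(* A process on [0,T] is a family indexed by all of R; its values at times
   outside [0,T] are never used. *)

(* $C_b^k$: the function itself need not be bounded. *)
Definition Cb (R : realType) (k : nat) (f : R -> R) : Prop :=
  [/\ forall (j : nat) (x : R), (j < k)%N -> derivable (derive1n j f) x 1,
      continuous (derive1n k f : R -> R) &
      forall j, (1 <= j <= k)%N ->
        exists M, forall x, `|derive1n j f x| <= M].

Section processes.
Context {d : measure_display} {Omega : measurableType d} {R : realType}.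
Variable P : probability Omega R.

(* One-dimensional Gaussian law, possibly degenerate: the library's
   [normal_prob m s] is a normal law only for [s != 0]. *)
Definition gaussian_law (Y : Omega -> R) : Prop :=
  exists m s : R, 0 <= s /\
    forall E : set R, measurable E ->
      P (Y @^-1` E) = if s == 0 then \d_m E else normal_prob m s E.

Definition gaussian_process (T : R) (B : R -> Omega -> R) : Prop :=
  forall (n : nat) (t : 'I_n -> R) (a : 'I_n -> R),
    (forall i, t i \in `[0, T]) ->
    gaussian_law (fun w => \sum_(i < n) a i * B (t i) w).

Definition fbm_cov (H s t : R) : R :=
  2^-1 * (t `^ (2 * H) + s `^ (2 * H) - `|t - s| `^ (2 * H)).

Definition fractional_brownian_motion (T H : R) (B : R -> {RV P >-> R}) : Prop :=
  [/\ gaussian_process T B,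
      forall t : R, t \in `[0, T] -> ('E_P[B t] = 0)%E,
      forall s t : R, s \in `[0, T] -> t \in `[0, T] ->
        ('E_P[(fun w => (B s w * B t w)%R)] = (fbm_cov H s t)%:E)%E &
      {ae P, forall w, {within `[0, T], continuous (fun t : R => B t w)}}].

Definition hoelder_paths (T alpha : R) (Z : R -> Omega -> R) : Prop :=
  {ae P, forall w, exists C, forall s t : R, s \in `[0, T] -> t \in `[0, T] ->
    `|Z s w - Z t w| <= C * `|s - t| `^ alpha}.

(* [Z^eps -> Z] uniformly on [0,T], in probability, as [eps] decreases to 0.
   The outer measure [P^*] agrees with [P] on measurable sets; with it the
   definition does not presuppose that the supremum over t is measurable. *)
Definition ucp_cvg (T : R) (Ze : R -> R -> Omega -> R) (Z : R -> Omega -> R) :=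
  forall delta : R, 0 < delta ->
    mu_ext P [set w | exists2 t : R, t \in `[0, T] & delta <= `|Ze eps t w - Z t w|]
      @[eps --> 0^'+] --> 0%E.

(* The process B is extended past T by its value B_T, so that B_{s+eps} makes
   sense for s close to T. *)
Definition forward_approx (T : R) (Z B : R -> Omega -> R) (eps t : R) (w : Omega)
    : R :=
  eps^-1 * \int[lebesgue_measure]_(s in `[0, t])
    (Z s w * (B (Num.min (s + eps) T) w - B s w)).

Definition is_forward_integral (T : R) (Z B I : R -> Omega -> R) : Prop :=
  (forall t : R, t \in `[0, T] -> measurable_fun setT (I t)) /\
  ucp_cvg T (forward_approx T Z B) I.

Definition sde_solution (T H x0 : R) (sigma b : R -> R) (B X : R -> {RV P >-> R})
    : Prop :=
  (exists2 alpha : R, 1 - H < alpha & hoelder_paths T alpha X) /\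
  exists2 I, is_forward_integral T (fun s w => sigma (X s w)) B I &
    {ae P, forall w, forall t : R, t \in `[0, T] ->
      X t w = x0 + I t w + \int[lebesgue_measure]_(s in `[0, t]) b (X s w)}.

Definition sub_sigma_field (A : set (set Omega)) : Prop :=
  sigma_algebra setT A /\ A `<=` measurable.

(* [V] is a version of $E[Y \mid A]$. *)
Definition is_cond_exp (A : set (set Omega)) (Y V : Omega -> R) : Prop :=
  [/\ P.-integrable setT (EFin \o Y), P.-integrable setT (EFin \o V),
      forall E : set R, measurable E -> A (V @^-1` E) &
      forall E, A E ->
        (\int[P]_(w in E) (V w)%:E = \int[P]_(w in E) (Y w)%:E)%E].

Definition diff_quot (h : R) (Z : R -> Omega -> R) (t : R) (w : Omega) : R :=
  (Z (t + h) w - Z t w) / h.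

Definition cvg_in_prob (V : R -> Omega -> R) (D : Omega -> R) : Prop :=
  forall delta : R, 0 < delta ->
    P [set w | delta <= `|V h w - D w|] @[h --> 0^'+] --> 0%E.

Definition L2_process (T : R) (Z : R -> Omega -> R) : Prop :=
  forall t : R, t \in `[0, T] -> Z t \in Lfun P 2%:E.

(* A derivative is an almost sure class of random variables; this says that
   [D] is one of its representatives. *)
Definition is_fwd_deriv (T : R) (Z : R -> Omega -> R) (t : R)
    (A : set (set Omega)) (D : Omega -> R) : Prop :=
  [/\ L2_process T Z, sub_sigma_field A, measurable_fun setT D &
      exists2 V : R -> Omega -> R,
        \forall h \near 0^'+, is_cond_exp A (diff_quot h Z t) (V h) &
        cvg_in_prob V D].

Definition is_bwd_deriv (T : R) (Z : R -> Omega -> R) (t : R)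
    (A : set (set Omega)) (D : Omega -> R) : Prop :=
  [/\ L2_process T Z, sub_sigma_field A, measurable_fun setT D &
      exists2 V : R -> Omega -> R,
        \forall h \near 0^'+, is_cond_exp A (diff_quot (- h) Z t) (V h) &
        cvg_in_prob V D].

Definition fwd_differentiating_at T Z t A := exists D, is_fwd_deriv T Z t A D.

Definition bwd_differentiating_at T Z t A := exists D, is_bwd_deriv T Z t A D.

Definition fwd_nondegenerate T Z t A : Prop :=
  exists2 D, is_fwd_deriv T Z t A D &
    forall c : R, (P [set w | D w = c] < 1)%E.

Definition bwd_nondegenerate T Z t A : Prop :=
  exists2 D, is_bwd_deriv T Z t A D &
    forall c : R, (P [set w | D w = c] < 1)%E.

Definition differentiating (T : R) (Z : R -> Omega -> R)
    (A : R -> set (set Omega)) : Prop :=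
  forall t : R, t \in `]0, T[ ->
    fwd_differentiating_at T Z t (A t) /\ bwd_differentiating_at T Z t (A t).

Definition as_constant (T : R) (Z : R -> Omega -> R) : Prop :=
  {ae P, forall w, forall s t : R, s \in `[0, T] -> t \in `[0, T] -> Z s w = Z t w}.

Definition discriminating (T : R) (Z : R -> Omega -> R)
    (A : R -> set (set Omega)) : Prop :=
  differentiating T Z A /\
  ((forall t : R, t \in `]0, T[ ->
      is_fwd_deriv T Z t (A t) (cst 0) /\ is_bwd_deriv T Z t (A t) (cst 0)) ->
   as_constant T Z).

(* The present: the sigma-field generated by [Z t], without the null sets. *)
Definition present (Z : R -> Omega -> R) (t : R) : set (set Omega) :=
  preimage_set_system setT (Z t) measurable.

End processes.

(* Main.v *)
(* Put [G z = \int_x0^z dy / sigma y].  If [sigma x0 <> 0], the pathwise chain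
   rule for the forward integral, proved by comparing Riemann-type sums through a
   sewing estimate, gives [G (X s) = B s + r s] as long as [sigma] does not vanish
   between [x0] and [X s]; as [sigma] is Lipschitz, [G] is infinite at its zeros,
   so this persists on [0, T].  If [sigma x0 = 0], the same comparison forces
   [X = x0].  In the first case [X t] and [B t] generate the same information,
   and a Taylor expansion along [G] yields
     X (t + k) - X t = sigma (X t) (B (t + k) - B t + r k) + Q k
   with [E |Q k| = O(k^2H + k^2) = o(k)], as [2H > 1].  The Gaussian variable
   [B (t + k)] is [rho_k B t] plus a part orthogonal to every function of [B t],
   where [(rho_k - 1) / k] tends to [H / t]; dividing by [k] gives the derivative.
   It equals [sigma (X t) (H / t * B t + r)], and is not almost surely constant since
   [sigma (X t) <> 0] and [B t] charges every interval. *)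
Require Import Defs.
From HB Require Import structures.
From mathcomp Require Import all_boot all_order all_algebra.
From mathcomp Require Import all_classical all_reals all_analysis.
From mathcomp Require Import measurable_realfun.
From mathcomp Require Import ring lra.
Import Order.TTheory GRing.Theory Num.Theory.
Import numFieldNormedType.Exports.
Set Implicit Arguments.
Unset Strict Implicit.
Unset Printing Implicit Defensive.
Local Open Scope classical_set_scope.
Local Open Scope ring_scope.

(** * Integrals and a sewing estimate *)

Definition signed_integral (R : realType) (f : R -> R) (a x : R) : R :=
  if a <= x then \int[lebesgue_measure]_(s in `[a, x]) f s
  else - \int[lebesgue_measure]_(s in `[x, a]) f s.

Lemma signed_integral_chasles (R : realType) (f : R -> R) (c d a x : R) :
  lebesgue_measure.-integrable `[c, d] (EFin \o f) ->
  c <= a <= d -> c <= x <= d ->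
  signed_integral f a x = \int[lebesgue_measure]_(s in `[c, x]) f s -
                          \int[lebesgue_measure]_(s in `[c, a]) f s.
Proof.
move=> fi /andP[ca ad] /andP[cx xd].
have key u v : c <= u -> u <= v -> v <= d ->
    \int[lebesgue_measure]_(s in `[c, v]) f s -
    \int[lebesgue_measure]_(s in `[c, u]) f s =
    \int[lebesgue_measure]_(s in `[u, v]) f s.
  move=> cu uv vd.
  have fi' : lebesgue_measure.-integrable `[c, v] (EFin \o f).
    apply: integrableS fi => //.
    by apply: subset_itvl; rewrite bnd_simp.
  rewrite Rintegral_itvB// ?bnd_simp// Rintegral_itv_obnd_cbnd//.
  apply: integrableS fi' => //.
  by apply: subset_itvr; rewrite bnd_simp.
rewrite /signed_integral; case: leP => [ax|/ltW xa].
  by rewrite key.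
by rewrite -key// opprB.
Qed.

Lemma is_derive_signed_integral (R : realType) (f : R -> R) (lo hi a x : R) :
  {in `]lo, hi[, continuous f} -> a \in `]lo, hi[ -> x \in `]lo, hi[ ->
  is_derive x 1 (signed_integral f a) (f x).
Proof.
move=> fc /[!in_itv]/= /andP[loa ahi] /andP[lox xhi].
pose c := (lo + Num.min a x) / 2; pose d := (hi + Num.max a x) / 2.
have [loc [ca cx]] : lo < c /\ c < a /\ c < x.
  by rewrite /c; case: (leP a x) => h; split; lra.
have [dhi [ad xd]] : d < hi /\ a < d /\ x < d.
  by rewrite /d; case: (leP a x) => h; split; lra.
have fcd : {within `[c, d], continuous f}.
  apply: continuous_in_subspaceT => y; rewrite inE/= in_itv/= => /andP[cy yd].
  by apply: fc; rewrite in_itv/=; apply/andP; split; lra.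
have fi : lebesgue_measure.-integrable `[c, d] (EFin \o f).
  by apply: continuous_compact_integrable => //; exact: segment_compact.
have fx : {for x, continuous f}.
  by apply: fc; rewrite in_itv/= lox xhi.
have [dF F'] := @continuous_FTC1_closed R f c x d xd fi cx fx.
have nearE : \forall y \near x,
    (fun y => \int[lebesgue_measure]_(s in `[c, y]) f s -
              \int[lebesgue_measure]_(s in `[c, a]) f s) y =
    signed_integral f a y.
  near=> y; apply/esym; apply: signed_integral_chasles fi _ _.
    by apply/andP; split; lra.
  apply/andP; split; apply: ltW.
    by near: y; exact: lt_nbhsr.
  by near: y; exact: lt_nbhsl.
apply: (near_eq_is_derive nearE).
rewrite -[f x]subr0; apply: is_deriveB.
rewrite -F' derive1E; exact/derivableP.
Unshelve. all: by end_near. Qed.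

Lemma signed_integral_itv (R : realType) (f : R -> R) (s t : R) :
  continuous f -> 0 <= s <= t ->
  signed_integral f 0 t - signed_integral f 0 s =
  \int[lebesgue_measure]_(u in `[s, t]) f u.
Proof.
move=> fc /andP[s0 st].
have fi : lebesgue_measure.-integrable `[0, t] (EFin \o f).
  by apply: continuous_compact_integrable; [exact: segment_compact|
    exact: continuous_subspaceT].
rewrite !(signed_integral_chasles fi) ?lexx ?s0 ?st ?(le_trans s0 st)//.
rewrite opprB addrA subrK.
have := signed_integral_chasles (a := s) (x := t) fi.
rewrite s0 st (le_trans s0 st) lexx => /(_ isT isT) <-.
by rewrite /signed_integral st.
Qed.

Lemma le_cvg0 (R : realType) (u : R ^nat) (x a b : R) :
  u n @[n --> \oo] --> 0 -> (forall n, x <= a + b * u n) -> x <= a.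
Proof.
move=> u0 xab; rewrite -[a]addr0 -(mulr0 b).
have ab : (a + b * u n) @[n --> \oo] --> a + b * 0.
  by apply: cvgD; [exact: cvg_cst|apply: cvgM => //; exact: cvg_cst].
by apply: cvgr_to_ge ab _; exact: nearW.
Qed.

Lemma le_powRl (R : realType) (r x y : R) :
  0 <= r -> 0 <= x -> x <= y -> x `^ r <= y `^ r.
Proof.
move=> r0 x0 xy; apply: ge0_ler_powR; rewrite ?nnegrE//.
exact: le_trans xy.
Qed.

Lemma exprn_powR (R : realType) (x p : R) (n : nat) : 0 <= x -> (x ^+ n) `^ p = (x `^ p) ^+ n.
Proof.
move=> x0; rewrite -[x ^+ n]powR_mulrn// -powRrM [_ * p]mulrC powRrM powR_mulrn//.
exact: powR_ge0.
Qed.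

Lemma halfpow_lt1 (R : realType) (x : R) : 0 < x -> 0 < (2^-1 : R) `^ x < 1.
Proof.
move=> x0; rewrite powR_gt0 ?invr_gt0//=.
have : (2^-1 : R) `^ x < 1 `^ x.
  by apply: gt0_ltr_powR => //; rewrite ?nnegrE; lra.
by rewrite powR1.
Qed.

(* Additivity up to an error of order [gamma > 1] upgrades a bound of any
   superlinear order to one that only involves the error constant: halve the
   interval repeatedly. *)
Lemma sewing_bound (R : realType) (Q : R -> R -> R) (a b gamma alpha C K : R) :
  1 < gamma -> 0 < alpha -> 0 <= C ->
  (forall s t, a <= s -> s <= t -> t <= b ->
    `|Q s t| <= K * (t - s) `^ (1 + alpha)) ->
  (forall s m t, a <= s -> s <= m -> m <= t -> t <= b ->
    `|Q s t - Q s m - Q m t| <= C * (t - s) `^ gamma) ->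
  forall s t, a <= s -> s <= t -> t <= b ->
    `|Q s t| <= C / (1 - 2^-1 `^ (gamma - 1)) * (t - s) `^ gamma.
Proof.
move=> g1 a0 C0 QK QC.
have /andP[q0 q1] : 0 < (2^-1 : R) `^ (gamma - 1) < 1.
  by apply: halfpow_lt1; lra.
set q := _ `^ _ in q0 q1 *; pose c := C / (1 - q).
have cE : c = C + q * c by rewrite /c; field; lra.
have /andP[p0 p1] := halfpow_lt1 a0.
set p := _ `^ _ in p0 p1.
have claim n : forall s t, a <= s -> s <= t -> t <= b ->
    `|Q s t| <= c * (t - s) `^ gamma + K * (t - s) `^ (1 + alpha) * p ^+ n.
  elim: n => [|n IH] s t sa st tb.
    rewrite expr0 mulr1; apply: le_trans (QK _ _ sa st tb) _.
    rewrite lerDr mulr_ge0 ?powR_ge0// /c divr_ge0//; lra.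
  pose m := (s + t) / 2.
  have sm : s <= m by rewrite /m; lra.
  have mt : m <= t by rewrite /m; lra.
  have mb : m <= b by lra.
  have am : a <= m by lra.
  have ts0 : 0 <= t - s by lra.
  have H1 := IH s m sa sm mb.
  have H2 := IH m t am mt tb.
  have H3 := QC s m t sa sm mt tb.
  have E1 : m - s = 2^-1 * (t - s) by rewrite /m; lra.
  have E2 : t - m = 2^-1 * (t - s) by rewrite /m; lra.
  have i2 : 0 <= 2^-1 :> R by rewrite invr_ge0.
  have Eg : (2^-1 * (t - s)) `^ gamma = 2^-1 * q * (t - s) `^ gamma.
    by rewrite powRM// -[in 2^-1 `^ gamma](subrK 1 gamma) addrC powRD
      ?powRr1 ?pnatr_eq0// ?implybT//; apply/implyP => _; rewrite invr_eq0 pnatr_eq0.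
  have Ea : (2^-1 * (t - s)) `^ (1 + alpha) = 2^-1 * p * (t - s) `^ (1 + alpha).
    by rewrite powRM// [in 2^-1 `^ _]powRD ?powRr1//;
      apply/implyP => _; rewrite invr_eq0 pnatr_eq0.
  rewrite E1 Eg Ea in H1; rewrite E2 Eg Ea in H2.
  have -> : Q s t = (Q s t - Q s m - Q m t) + Q s m + Q m t by lra.
  apply: le_trans (ler_normD _ _) _.
  apply: le_trans (lerD (ler_normD _ _) (lexx _)) _.
  apply: le_trans (lerD (lerD H3 H1) H2) _.
  rewrite exprS [in leRHS]cE.
  clear -R; clearbody q p c; set x := _ `^ gamma; set y := _ `^ (1 + alpha).
  set z := p ^+ n; rewrite le_eqVlt; apply/orP; left; apply/eqP; lra.
move=> s t sa st tb.
apply: (@le_cvg0 _ (fun n => p ^+ n) _ _ (K * (t - s) `^ (1 + alpha))).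
  by apply: cvg_expr; rewrite ger0_norm// ltW.
by move=> n; exact: claim.
Qed.

Lemma is_derive_continuous (R : realType) (f : R -> R) (x df : R) :
  is_derive x 1 f df -> {for x, continuous f}.
Proof. by move=> [fx _]; apply: differentiable_continuous; exact/derivable1_diffP. Qed.

Lemma is_derive_MVT (R : realType) (f df : R -> R) (a b : R) :
  (forall x, a <= x <= b -> is_derive x 1 f (df x)) -> a <= b ->
  exists2 c, a <= c <= b & f b - f a = df c * (b - a).
Proof.
move=> fd ab; have [| |c] := @MVT_segment R f df a b ab.
- by move=> x /[!in_itv]/= /andP[ax xb]; apply: fd; rewrite !ltW.
- apply: continuous_in_subspaceT => x; rewrite inE/= in_itv/= => xab.
  exact: is_derive_continuous (fd _ xab).
- by rewrite in_itv/= => cab E; exists c.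
Qed.

Lemma hoelder_continuous (R : realType) (f : R -> R) (C alpha : R) : 0 < alpha ->
  (forall u v, `|f u - f v| <= C * `|u - v| `^ alpha) -> continuous f.
Proof.
move=> a0 fC x; apply/cvgrPdist_le => e e0.
have K0 : 0 < e / (`|C| + 1) by rewrite divr_gt0// ltr_wpDl.
near=> y; apply: le_trans (fC _ _) _.
have h : `|x - y| `^ alpha <= e / (`|C| + 1).
  have -> : e / (`|C| + 1) = (e / (`|C| + 1)) `^ alpha^-1 `^ alpha.
    by rewrite -powRrM mulVf ?gt_eqF// powRr1// ltW.
  apply: ge0_ler_powR; rewrite ?nnegrE ?powR_ge0//; first exact: ltW.
  near: y; apply/nbhs_ballP; exists ((e / (`|C| + 1)) `^ alpha^-1) => /=.
    exact: powR_gt0.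
  by move=> w /ltW.
apply: le_trans (ler_wpM2r (powR_ge0 _ _) (ler_norm C)) _.
apply: le_trans (ler_wpM2l (normr_ge0 C) h) _.
rewrite mulrCA ger_pMr// ler_pdivrMr ?mul1r ?lerDl//.
Unshelve. all: by end_near. Qed.

Lemma is_derive_shift (R : realType) (f : R -> R) (e x df : R) :
  is_derive (x + e) 1 f df -> is_derive x 1 (fun u => f (u + e)) df.
Proof.
move=> fd; have h : is_derive x 1 (fun u : R => u + e) 1.
  by rewrite -[X in is_derive _ _ _ X]addr0; apply: is_deriveD.
by have := @is_derive1_comp R f (fun u => u + e) x df 1 fd h; rewrite mulr1.
Qed.

Lemma forward_average_estimate (R : realType) (z y : R -> R)
    (alpha beta Cz Cy eps s t : R) :
  0 < eps -> 0 < alpha -> 0 < beta -> 1 < alpha + beta -> 0 <= Cz -> 0 <= Cy ->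
  (forall u v, `|z u - z v| <= Cz * `|u - v| `^ alpha) ->
  (forall u v, `|y u - y v| <= Cy * `|u - v| `^ beta) ->
  0 <= s -> s <= t ->
  `|eps^-1 * \int[lebesgue_measure]_(u in `[s, t]) (z u * (y (u + eps) - y u))
      - z s * (y t - y s)| <=
    Cz * Cy / (1 - 2^-1 `^ (alpha + beta - 1)) * (t - s) `^ (alpha + beta)
    + `|z s| * (2 * Cy * eps `^ beta).
Proof.
move=> e0 a0 b0 ab1 Cz0 Cy0 hz hy s0 st.
have yc := hoelder_continuous b0 hy; have zc := hoelder_continuous a0 hz.
have ysc : continuous (fun u => y (u + eps)).
  move=> x; apply: (continuous_comp (f := fun u => u + eps) (g := y)); last exact: yc.
  by apply: cvgD; [exact: cvg_id|exact: cvg_cst].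
pose f u := z u * (y (u + eps) - y u).
have fc : continuous f.
  by move=> x; apply: cvgM; [exact: zc|apply: cvgB; [exact: ysc|exact: yc]].
pose F := signed_integral f 0; pose Phi := signed_integral y 0.
have prim (g : R -> R) : continuous g -> forall x : R, is_derive x 1 (signed_integral g 0) (g x).
  move=> gc x; apply: (@is_derive_signed_integral R g (Num.min 0 x - 1) (Num.max 0 x + 1)).
  - by move=> ? _; exact: gc.
  - by rewrite in_itv/=; case: (leP 0 x) => h; apply/andP; split; lra.
  - by rewrite in_itv/=; case: (leP 0 x) => h; apply/andP; split; lra.
pose W u := Phi (u + eps) - Phi u.
have WE (m v : R) : m <= v -> exists2 c, 0 <= c <= eps & W v - W m = (y (v + c) - y (m + c)) * eps.
  move=> mv.
  have [||c c01 E] := @is_derive_MVT R (fun c => Phi (c + v) - Phi (c + m))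
     (fun c => y (c + v) - y (c + m)) 0 eps.
  - by move=> x _; apply: is_deriveB; apply: is_derive_shift; exact: prim.
  - exact: ltW.
  exists c => //; rewrite subr0 in E; rewrite ![_ + c]addrC -E /W !add0r.
  by rewrite ![eps + _]addrC !opprB [X in _ + X = _]addrC addrACA [X in _ + X = _]addrC.
have Wle (m v : R) : m <= v -> `|W v - W m| <= eps * (Cy * (v - m) `^ beta).
  move=> mv; have [c _ ->] := WE m v mv.
  rewrite normrM mulrC (gtr0_norm e0) ler_pM2l//.
  apply: le_trans (hy _ _) _.
  by rewrite opprD addrACA subrr addr0 ger0_norm// subr_ge0.
pose Q u v := eps^-1 * ((F v - F u) - z u * (W v - W u)).
have Qd (u x : R) : is_derive x 1 (fun v => F v - z u * W v) ((z x - z u) * (y (x + eps) - y x)).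
  rewrite mulrBl; apply: is_deriveB; first exact: prim.
  apply: is_deriveZ; apply: is_deriveB; last exact: prim.
  by apply: is_derive_shift; exact: prim.
have QK (u v : R) : s <= u -> u <= v -> v <= t ->
    `|Q u v| <= eps^-1 * (Cz * (Cy * eps `^ beta)) * (v - u) `^ (1 + alpha).
  move=> su uv vt; have [c /andP[uc cv] E] := is_derive_MVT (fun x _ => Qd u x) uv.
  have -> : Q u v = eps^-1 * ((z c - z u) * (y (c + eps) - y c) * (v - u)).
    by rewrite -E /Q; congr (_ * _); ring.
  rewrite !normrM gtr0_norm ?invr_gt0// -!mulrA ler_pM2l ?invr_gt0//.
  have vu : 0 <= v - u by lra.
  rewrite (ger0_norm vu).
  have h1 : `|z c - z u| <= Cz * (v - u) `^ alpha.
    apply: le_trans (hz _ _) _; apply: ler_wpM2l => //.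
    by apply: le_powRl; rewrite ?(ltW a0)// ger0_norm ?subr_ge0// lerD2r.
  have h2 : `|y (c + eps) - y c| <= Cy * eps `^ beta.
    by apply: le_trans (hy _ _) _; rewrite [c + _]addrC addrK (gtr0_norm e0).
  have -> : (v - u) `^ (1 + alpha) = (v - u) * (v - u) `^ alpha.
    have [->|vu0] := eqVneq (v - u) 0; first by rewrite mul0r powR0//; lra.
    by rewrite powRD ?vu0 ?implybT// powRr1.
  rewrite mulrA; apply: le_trans (ler_wpM2r vu (ler_pM _ _ h1 h2)) _ => //.
  rewrite le_eqVlt; apply/orP; left; apply/eqP; lra.
have QC (u m v : R) : s <= u -> u <= m -> m <= v -> v <= t ->
    `|Q u v - Q u m - Q m v| <= Cz * Cy * (v - u) `^ (alpha + beta).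
  move=> su um mv vt.
  have -> : Q u v - Q u m - Q m v = eps^-1 * ((z m - z u) * (W v - W m)).
    rewrite /Q -!mulrBr; congr (_ * _).
    by move: (F u) (F m) (F v) (W u) (W m) (W v) => *; ring.
  rewrite !normrM gtr0_norm ?invr_gt0// ler_pdivrMl// mulrC.
  have h1 : `|z m - z u| <= Cz * (v - u) `^ alpha.
    apply: le_trans (hz _ _) _; apply: ler_wpM2l => //.
    by apply: le_powRl; rewrite ?(ltW a0)// ger0_norm ?subr_ge0// lerD2r.
  have h2 : `|W v - W m| <= eps * (Cy * (v - u) `^ beta).
    apply: le_trans (Wle _ _ mv) _; rewrite ler_pM2l//; apply: ler_wpM2l => //.
    by apply: le_powRl; rewrite ?(ltW b0) ?subr_ge0// lerD2l lerN2.
  apply: le_trans (ler_pM _ _ h2 h1) _ => //.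
  have -> : (v - u) `^ (alpha + beta) = (v - u) `^ alpha * (v - u) `^ beta.
    have [->|vu0] := eqVneq (v - u) 0; first by rewrite !powR0//; lra.
    by rewrite powRD ?vu0 ?implybT.
  rewrite le_eqVlt; apply/orP; left; apply/eqP; lra.
have := sewing_bound ab1 a0 (mulr_ge0 Cz0 Cy0) QK QC (lexx s) st (lexx t).
have -> : \int[lebesgue_measure]_(u in `[s, t]) (z u * (y (u + eps) - y u)) = F t - F s.
  by rewrite -signed_integral_itv// s0.
move=> H; have [c /andP[c0 ce] Wc] := WE _ _ st.
have -> : eps^-1 * (F t - F s) - z s * (y t - y s) =
    Q s t + z s * ((y (t + c) - y t) - (y (s + c) - y s)).
  rewrite /Q Wc; field; lra.
apply: le_trans (ler_normD _ _) _; apply: lerD => //.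
rewrite normrM; apply: ler_wpM2l => //.
have hc (w : R) : `|y (w + c) - y w| <= Cy * eps `^ beta.
  apply: le_trans (hy _ _) _; rewrite [w + _]addrC addrK (ger0_norm c0).
  by apply: ler_wpM2l => //; apply: le_powRl => //; exact: ltW.
apply: le_trans (ler_normB _ _) _.
by apply: le_trans (lerD (hc t) (hc s)) _; lra.
Qed.

(** * The scale function *)

Definition between (R : realType) (a b : R) : set R :=
  [set c | Num.min a b <= c <= Num.max a b].

Lemma betweenC (R : realType) (a b : R) : between a b = between b a.
Proof. by rewrite /between minC maxC. Qed.

Lemma between_itv (R : realType) (a b : R) : a <= b -> between a b = [set c | a <= c <= b].
Proof. by move=> ab; rewrite /between min_l// max_r. Qed.

Lemma between_l (R : realType) (a b : R) : between a b a.
Proof. by rewrite /between/=; case: (leP a b) => h; apply/andP; split => //; exact: ltW. Qed.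

Lemma between_r (R : realType) (a b : R) : between a b b.
Proof. by rewrite betweenC; exact: between_l. Qed.

Lemma between_sub (R : realType) (a b c : R) : between a b c -> between a c `<=` between a b.
Proof.
rewrite /between/= => /andP[]; case: (leP a b) => ab h1 h2 z/=;
  case: (leP a c) => ac /andP[h3 h4]; apply/andP; split; lra.
Qed.

Lemma between_dist (R : realType) (a b c : R) : between a b c -> `|c - a| <= `|b - a|.
Proof.
rewrite /between/=; case: (leP a b) => ab /andP[h1 h2].
  by rewrite !ger0_norm; lra.
by rewrite !ler0_norm; lra.
Qed.

Lemma between_norm (R : realType) (a b c : R) : between a b c -> `|c| <= `|a| + `|b|.
Proof.
rewrite /between/=; case: (leP a b) => ab /andP[h1 h2]; rewrite ler_norml;
  have := lerNnormlW (lexx `|a|); have := ler_norm a; have := lerNnormlW (lexx `|b|);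
  have := ler_norm b; have := normr_ge0 a; have := normr_ge0 b;
  move=> *; apply/andP; split; lra.
Qed.

Lemma MVT_between (R : realType) (f df : R -> R) (a b : R) :
  (forall x, between a b x -> is_derive x 1 f (df x)) ->
  exists2 c, between a b c & f b - f a = df c * (b - a).
Proof.
wlog ab : a b / a <= b => [wl|] fd.
  have [ab|/ltW ba] := leP a b; first exact: wl.
  have [|c cba E] := wl b a ba; first by rewrite betweenC.
  exists c; first by rewrite betweenC.
  by rewrite -opprB E -mulrN opprB.
move: fd; rewrite between_itv// => fd.
exact: is_derive_MVT.
Qed.

Lemma IVT_between (R : realType) (f : R -> R) (s t z : R) : s <= t ->
  continuous f -> between (f s) (f t) z -> exists2 v, s <= v <= t & f v = z.
Proof.
move=> st fc zst; have [||v] := @IVT R f s t z st.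
- exact: continuous_subspaceT.
- exact: zst.
- by rewrite in_itv/= => h e; exists v.
Qed.

Section scale_function.
Variables (R : realType) (sigma G : R -> R) (x0 K : R).
Hypothesis sigma_lip : forall x y, `|sigma x - sigma y| <= K * `|x - y|.

(* Cauchy's mean value theorem in the coordinate [G] with [G' = 1 / sigma]. *)
Lemma cauchy_scale (L dL : R -> R) (p q : R) :
  (forall z, between p q z -> sigma z != 0) ->
  (forall z, between p q z -> is_derive z 1 G (sigma z)^-1) ->
  (forall z, between p q z -> is_derive z 1 L (dL z)) ->
  exists2 c, between p q c & L q - L p = sigma c * dL c * (G q - G p).
Proof.
move=> s0 Gd Ld; have [->|pq] := eqVneq p q.
  by exists q; [exact: between_l|rewrite !subrr mulr0].
have [|c cpq] := @MVT_between R (fun z => (G q - G p) * L z - (L q - L p) * G z)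
    (fun z => (G q - G p) * dL z - (L q - L p) * (sigma z)^-1) p q.
  by move=> z zpq; apply: is_deriveB; apply: is_deriveZ; [exact: Ld|exact: Gd].
move=> E; exists c => //.
have : ((G q - G p) * dL c - (L q - L p) / sigma c) * (q - p) = 0.
  by rewrite -E; lra.
move/eqP; rewrite mulf_eq0 subr_eq0 [q - p == 0]subr_eq0 [q == p]eq_sym (negbTE pq).
rewrite orbF => /eqP E'.
by rewrite -mulrA [dL c * _]mulrC E' mulrCA divff ?mulr1// s0.
Qed.

Lemma cauchy_scale_le (L dL : R -> R) (p q M : R) :
  (forall z, between p q z -> sigma z != 0) ->
  (forall z, between p q z -> is_derive z 1 G (sigma z)^-1) ->
  (forall z, between p q z -> is_derive z 1 L (dL z)) ->
  (forall z, between p q z -> `|sigma z * dL z| <= M) ->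
  `|L q - L p| <= M * `|G q - G p|.
Proof.
move=> s0 Gd Ld LM; have [c cpq ->] := cauchy_scale s0 Gd Ld.
by rewrite normrM; apply: ler_wpM2r => //; exact: LM.
Qed.

Lemma scale_taylor (p q : R) :
  (forall z, between p q z -> sigma z != 0) ->
  (forall z, between p q z -> is_derive z 1 G (sigma z)^-1) ->
  `|q - p - sigma p * (G q - G p)| <=
    K * (`|sigma 0| + K * (`|p| + `|q|)) * (G q - G p) ^+ 2.
Proof.
move=> s0 Gd.
have K0 : 0 <= K.
  by have := sigma_lip 0 1; rewrite sub0r normrN1 mulr1; exact: le_trans.
have [c cpq Ec] := @cauchy_scale idfun (cst 1) p q s0 Gd (fun z _ => is_derive_id z 1).
have [|c' c'pq Ec'] := @cauchy_scale (fun z => z - sigma p * G z)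
    (fun z => 1 - sigma p * (sigma z)^-1) p q s0 Gd.
  by move=> z zpq; apply: is_deriveB; apply: is_deriveZ; exact: Gd.
have -> : q - p - sigma p * (G q - G p) = (sigma c' - sigma p) * (G q - G p).
  have -> : q - p - sigma p * (G q - G p) = q - sigma p * G q - (p - sigma p * G p) by lra.
  by rewrite Ec'; congr (_ * _); rewrite mulrBr mulr1 mulrCA divff ?mulr1// s0.
rewrite /= mulr1 in Ec.
have h1 : `|sigma c' - sigma p| <= K * `|q - p|.
  by apply: le_trans (sigma_lip _ _) _; apply: ler_wpM2l => //; exact: between_dist.
have h2 : `|sigma c| <= `|sigma 0| + K * (`|p| + `|q|).
  rewrite -[sigma c](subrK (sigma 0)) addrC; apply: le_trans (ler_normD _ _) _.
  rewrite lerD2l; apply: le_trans (sigma_lip _ _) _; rewrite subr0.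
  by apply: ler_wpM2l => //; exact: between_norm.
rewrite normrM -(real_normK (num_real (G q - G p))) expr2 mulrA; apply: ler_wpM2r => //.
apply: le_trans h1 _; rewrite -mulrA Ec normrM; apply: ler_wpM2l => //.
exact: ler_wpM2r.
Qed.

Lemma scale_growth (q : R) :
  (forall z, between x0 q z -> sigma z != 0) ->
  (forall z, between x0 q z -> is_derive z 1 G (sigma z)^-1) ->
  (q - x0) ^+ 2 <= expR ((`|sigma x0| + 2 * K) * `|G q - G x0|).
Proof.
move=> s0 Gd.
have K0 : 0 <= K.
  by have := sigma_lip 0 1; rewrite sub0r normrN1 mulr1; exact: le_trans.
have pos (z : R) : 0 < 1 + (z - x0) ^+ 2 by rewrite ltr_pwDl// sqr_ge0.
have Ld (z : R) : is_derive z 1 (fun z => ln (1 + (z - x0) ^+ 2))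
    ((1 + (z - x0) ^+ 2)^-1 * (2 * (z - x0))).
  apply: (@is_derive1_comp R (@ln R) (fun z => 1 + (z - x0) ^+ 2)).
    exact: is_derive1_ln.
  by apply: is_derive_eq; rewrite /GRing.scale/=; lra.
have LM z : between x0 q z ->
    `|sigma z * ((1 + (z - x0) ^+ 2)^-1 * (2 * (z - x0)))| <= `|sigma x0| + 2 * K.
  move=> _; rewrite mulrCA normrM gtr0_norm ?invr_gt0// ler_pdivrMl//.
  have h : `|sigma z| <= `|sigma x0| + K * `|z - x0|.
    rewrite -[sigma z](subrK (sigma x0)) addrC; apply: le_trans (ler_normD _ _) _.
    by rewrite lerD2l.
  rewrite !normrM (ger0_norm (ler0n _ 2)) -(real_normK (num_real (z - x0))).
  apply: le_trans (ler_wpM2r _ h) _; first by rewrite mulr_ge0.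
  have := normr_ge0 (sigma x0); have := normr_ge0 (z - x0).
  set w := `|z - x0|; set A := `|sigma x0| => w0 A0.
  by have := mulr_ge0 A0 (sqr_ge0 (w - 1)); rewrite !expr2; nra.
have := cauchy_scale_le s0 Gd (fun z _ => Ld z) LM.
rewrite subrr expr0n/= addr0 ln1 subr0 => H.
apply: (@le_trans _ _ (1 + (q - x0) ^+ 2)); first by rewrite lerDr.
by rewrite -[leLHS]lnK ?posrE// ler_expR; exact: le_trans (ler_norm _) H.
Qed.

Lemma scale_zero (z0 q : R) :
  (forall z, between x0 q z -> sigma z != 0) ->
  (forall z, between x0 q z -> is_derive z 1 G (sigma z)^-1) ->
  sigma z0 = 0 ->
  (x0 - z0) ^+ 2 * expR (- (2 * K * `|G q - G x0|)) <= (q - z0) ^+ 2.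
Proof.
move=> s0 Gd sz0.
have nz z : between x0 q z -> 0 < (z - z0) ^+ 2.
  move=> zq; rewrite exprn_even_gt0//= subr_eq0.
  by apply: contraNneq (s0 _ zq) => ->; rewrite sz0.
have Ld z : between x0 q z -> is_derive z 1 (fun z => ln ((z - z0) ^+ 2))
    (((z - z0) ^+ 2)^-1 * (2 * (z - z0))).
  move=> zq; apply: (@is_derive1_comp R (@ln R) (fun z => (z - z0) ^+ 2)).
    by apply: is_derive1_ln; exact: nz.
  by apply: is_derive_eq; rewrite /GRing.scale/=; lra.
have LM z : between x0 q z ->
    `|sigma z * (((z - z0) ^+ 2)^-1 * (2 * (z - z0)))| <= 2 * K.
  move=> zq; rewrite mulrCA normrM gtr0_norm ?invr_gt0 ?nz// ler_pdivrMl ?nz//.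
  have h : `|sigma z| <= K * `|z - z0| by have := sigma_lip z z0; rewrite sz0 subr0.
  rewrite !normrM (ger0_norm (ler0n _ 2)) -(real_normK (num_real (z - z0))).
  apply: le_trans (ler_wpM2r _ h) _; first by rewrite mulr_ge0.
  by rewrite expr2; lra.
have := cauchy_scale_le s0 Gd Ld LM.
rewrite ler_norml => /andP[H _].
rewrite -[X in X * _]lnK ?posrE ?nz//; last exact: between_l.
rewrite -[leRHS]lnK ?posrE ?nz//; last exact: between_r.
by rewrite -expRD ler_expR; lra.
Qed.

End scale_function.

Lemma superlinear_constant (R : realType) (f : R -> R) (a g C : R) : 1 < g ->
  (forall s t, 0 <= s -> s <= t -> t <= a -> `|f t - f s| <= C * (t - s) `^ g) ->
  forall t, 0 <= t <= a -> f t = f 0.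
Proof.
move=> g1 fC t /andP[t0 ta].
have g10 : 0 < g - 1 by rewrite subr_gt0.
have H := @sewing_bound R (fun s t => f t - f s) 0 a g (g - 1) 0 C g1 g10 (lexx 0).
have : `|f t - f 0| <= 0.
  apply: le_trans (H _ _ _ _ _ _ _) _ => //.
  - by move=> s v s0 sv va; rewrite [1 + _]addrC subrK; exact: fC.
  - move=> s m v _ _ _ _; rewrite mul0r.
    have -> : f v - f s - (f m - f s) - (f v - f m) = 0 by lra.
    by rewrite normr0.
by rewrite normr_le0 subr_eq0 => /eqP.
Qed.

Lemma lipschitz_continuous (R : realType) (f : R -> R) (K : R) :
  (forall x y, `|f x - f y| <= K * `|x - y|) -> continuous f.
Proof.
move=> fK; apply: (@hoelder_continuous R f K 1) => // u v.
by rewrite powRr1.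
Qed.

Section flow.
Variables (R : realType) (sigma : R -> R) (K : R).
Hypothesis sigma_lip : forall x y, `|sigma x - sigma y| <= K * `|x - y|.

Definition is_scale (G : R -> R) (x0 : R) :=
  forall z, (forall w, between x0 z w -> sigma w != 0) ->
    is_derive z 1 G (sigma z)^-1.

Lemma is_scale_between (G : R -> R) (x0 z : R) : is_scale G x0 ->
  (forall w, between x0 z w -> sigma w != 0) ->
  forall w, between x0 z w -> is_derive w 1 G (sigma w)^-1.
Proof.
move=> GS nz w zw; apply: GS => v wv; apply: nz.
exact: between_sub wv.
Qed.

Variables (x u G : R -> R) (g C : R).
Hypotheses (g1 : 1 < g) (xc : continuous x) (uc : continuous u).
Hypothesis G_scale : is_scale G (x 0).
Hypothesis x_exp : forall s t,
  `|x t - x s - sigma (x s) * (u t - u s)| <= C * `|t - s| `^ g.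
Hypothesis x_sqr : forall s t, (x t - x s) ^+ 2 <= C * `|t - s| `^ g.

Let sigma_cont : continuous sigma.
Proof. exact: lipschitz_continuous sigma_lip. Qed.

Let sx_cont : continuous (fun v => sigma (x v)).
Proof. by move=> v; apply: continuous_comp; [exact: xc|exact: sigma_cont]. Qed.

Let K0 : 0 <= K.
Proof. by have := sigma_lip 0 1; rewrite sub0r normrN1 mulr1; exact: le_trans. Qed.

Lemma flow_between (t : R) :
  (forall v, 0 <= v <= t -> sigma (x v) != 0) ->
  forall v, 0 <= v <= t -> forall w, between (x 0) (x v) w -> sigma w != 0.
Proof.
move=> nz v /andP[v0 vt] w wv; have [c /andP[c0 cv] <-] := IVT_between v0 xc wv.
by apply: nz; rewrite c0 (le_trans cv).
Qed.

Lemma flow_chart (t : R) : 0 <= t ->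
  (forall v, 0 <= v <= t -> sigma (x v) != 0) -> G (x t) - G (x 0) = u t - u 0.
Proof.
move=> t0 nz.
have [c c0 sc] : exists2 c, 0 < c & forall v, 0 <= v <= t -> c <= `|sigma (x v)|.
  have [|c ct cmin] := @EVT_min R (fun v => `|sigma (x v)|) 0 t t0.
    apply: continuous_subspaceT => v.
    by apply: continuous_comp; [exact: sx_cont|exact: norm_continuous].
  exists `|sigma (x c)|; first by rewrite normr_gt0 nz// -(in_itv true)//.
  by move=> v v0t; apply: cmin; rewrite in_itv.
have nzb := flow_between nz.
suff H : forall s v, 0 <= s -> s <= v -> v <= t ->
    `|(G (x v) - u v) - (G (x s) - u s)| <= (c^-1 * C + K * c ^- 2 * C) * (v - s) `^ g.
  have := superlinear_constant g1 H (t := t).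
  by rewrite t0 lexx => /(_ isT) E; lra.
move=> s v s0 sv vt.
have vs0 : 0 <= v - s by lra.
have sI : 0 <= s <= t by lra.
have IV z : between (x s) (x v) z -> exists2 w, 0 <= w <= t & x w = z.
  move=> zsv; have [w /andP[sw wv] E] := IVT_between sv xc zsv.
  by exists w => //; lra.
have Gd z : between (x s) (x v) z -> is_derive z 1 G (sigma z)^-1.
  by move=> /IV[w wt <-]; apply: G_scale; exact: nzb.
have sz z : between (x s) (x v) z -> c <= `|sigma z|.
  by move=> /IV[w wt <-]; exact: sc.
have [z zsv E] := MVT_between Gd.
have sne w : c <= `|sigma w| -> sigma w != 0.
  by move=> h; rewrite -normr_gt0 (lt_le_trans c0).
have ns : sigma (x s) != 0 by apply: sne; apply: sz; exact: between_l.
have nzz : sigma z != 0 by apply: sne; exact: sz.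
have -> : (G (x v) - u v) - (G (x s) - u s) =
   (sigma (x s))^-1 * (x v - x s - sigma (x s) * (u v - u s)) +
   (sigma z)^-1 * (sigma (x s))^-1 * ((sigma (x s) - sigma z) * (x v - x s)).
  have -> : (G (x v) - u v) - (G (x s) - u s) = G (x v) - G (x s) - (u v - u s) by lra.
  by rewrite E; field; rewrite ns nzz.
have ic w : c <= `|sigma w| -> `|(sigma w)^-1| <= c^-1.
  move=> h; rewrite normfV lef_pV2 ?posrE//; exact: lt_le_trans h.
have i0 : 0 <= c^-1 by rewrite invr_ge0 ltW.
apply: le_trans (ler_normD _ _) _; rewrite [leRHS]mulrDl; apply: lerD.
  rewrite normrM -mulrA; apply: ler_pM => //.
    by apply: ic; apply: sz; exact: between_l.
  by rewrite -[v - s]ger0_norm.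
rewrite !normrM.
have h1 : `|sigma (x s) - sigma z| * `|x v - x s| <= K * (C * (v - s) `^ g).
  apply: (@le_trans _ _ (K * `|x v - x s| * `|x v - x s|)).
    apply: ler_wpM2r => //; apply: le_trans (sigma_lip _ _) _.
    by apply: ler_wpM2l => //; rewrite distrC; exact: between_dist.
  rewrite -mulrA; apply: ler_wpM2l => //.
  by rewrite -expr2 real_normK ?num_real// -[v - s]ger0_norm.
apply: (@le_trans _ _ (c^-1 * c^-1 * (K * (C * (v - s) `^ g)))).
  apply: ler_pM => //; rewrite ?mulr_ge0//.
  apply: ler_pM => //; apply: ic; apply: sz => //; exact: between_l.
by rewrite expr2 invfM le_eqVlt; apply/orP; left; apply/eqP; lra.
Qed.

Lemma flow_nonzero (a : R) : sigma (x 0) != 0 ->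
  forall t, 0 <= t <= a -> sigma (x t) != 0.
Proof.
move=> s0 t /andP[t0 ta]; apply/negP => /eqP st0.
pose S := [set v | 0 <= v /\ sigma (x v) = 0].
have Sinf : has_inf S.
  by split; [exists t|exists 0 => v []].
pose t1 := inf S.
have t1ge : 0 <= t1 by apply: lb_le_inf => [|v []]; [exact: Sinf.1|].
have st1 : sigma (x t1) = 0.
  apply/eqP; apply/negP => /negP nz.
  have e0 : 0 < `|sigma (x t1)| by rewrite normr_gt0.
  have :=  @sx_cont t1; move=> /cvgrPdist_lt /(_ _ e0) /nbhs_ballP[d/= d0 hd].
  have [v [v0 sv] vt1] := inf_adherent d0 Sinf.
  have t1v : t1 <= v by apply: ge_inf => //; exact: Sinf.2.
  have := hd v; rewrite /ball/= sv subr0 ltxx distrC ger0_norm ?subr_ge0// => h.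
  by have /h : v - t1 < d by rewrite -/t1 in vt1; lra.
have nz v : 0 <= v -> v < t1 -> sigma (x v) != 0.
  move=> v0 vt1; apply/negP => /eqP sv.
  have : t1 <= v by apply: ge_inf => //; exact: Sinf.2.
  by rewrite leNgt vt1.
have t1gt : 0 < t1.
  by rewrite lt_neqAle t1ge andbT; apply: contraNneq s0 => E; apply/eqP; move: st1; rewrite -E.
have [M uM] : exists M, forall v, 0 <= v <= t1 -> `|u v - u 0| <= M.
  have [|c _ cmax] := @EVT_max R (fun v => `|u v - u 0|) 0 t1 t1ge.
    apply: continuous_subspaceT => v.
    apply: (continuous_comp (f := fun v => u v - u 0)); last exact: norm_continuous.
    by apply: cvgB; [exact: uc|exact: cvg_cst].
  by exists `|u c - u 0| => v vt; apply: cmax; rewrite in_itv.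
have x0ne : 0 < (x 0 - x t1) ^+ 2.
  rewrite exprn_even_gt0//= subr_eq0; apply: contraNneq s0 => ->.
  by rewrite st1.
pose m := (x 0 - x t1) ^+ 2 * expR (- (2 * K * M)).
have m0 : 0 < m by rewrite mulr_gt0// expR_gt0.
have low v : 0 <= v -> v < t1 -> m <= (x v - x t1) ^+ 2.
  move=> v0 vt1.
  have nzv w : 0 <= w <= v -> sigma (x w) != 0.
    by move=> /andP[w0 wv]; apply: nz => //; exact: le_lt_trans vt1.
  have v0v : 0 <= v <= v by rewrite v0 lexx.
  have nzb := flow_between nzv v0v.
  apply: le_trans (scale_zero sigma_lip nzb (is_scale_between G_scale nzb) st1).
  rewrite ler_pM2l// ler_expR lerN2 (flow_chart v0 nzv).
  by apply: ler_wpM2l; [rewrite mulr_ge0|apply: uM; rewrite v0 ltW].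
have : (x v - x t1) ^+ 2 @[v --> t1] --> (x t1 - x t1) ^+ 2.
  have h : (x v - x t1) @[v --> t1] --> (x t1 - x t1).
    by apply: cvgB; [exact: xc|exact: cvg_cst].
  by rewrite expr2; under eq_fun do rewrite expr2; apply: cvgM.
rewrite subrr expr0n/= => /cvgrPdist_lt /(_ _ m0) /nbhs_ballP[d/= d0 hd].
pose v := Num.max 0 (t1 - d / 2).
have [v0 vt1 dv] : [/\ 0 <= v, v < t1 & t1 - v < d].
  by rewrite /v; case: (leP 0 (t1 - d / 2)) => h; split; lra.
have := hd v; rewrite /ball/= gtr0_norm ?subr_gt0// => /(_ dv).
rewrite sub0r normrN ger0_norm ?sqr_ge0// ltNge low//.
Qed.

End flow.

(** * Pathwise analysis of the equation *)

Lemma is_scale_signed_integral (R : realType) (sigma : R -> R) (x0 : R) :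
  continuous sigma -> is_scale sigma (signed_integral (fun z => (sigma z)^-1) x0) x0.
Proof.
move=> sc z nz.
have ball_ne w : sigma w != 0 ->
    exists2 d : R, 0 < d & forall v, `|v - w| < d -> sigma v != 0.
  move=> sw; have e0 : 0 < `|sigma w| by rewrite normr_gt0.
  have := @sc w; move=> /cvgrPdist_lt /(_ _ e0) /nbhs_ballP[d/= d0 hd].
  exists d => // v vw; have := hd v; rewrite /ball/= distrC => /(_ vw).
  by apply: contraTneq => ->; rewrite subr0 ltxx.
have [d0 d00 h0] := ball_ne _ (nz _ (between_l x0 z)).
have [d1 d10 h1] := ball_ne _ (nz _ (between_r x0 z)).
pose d := Num.min d0 d1.
have [d_gt0 [dd0 dd1]] : 0 < d /\ d <= d0 /\ d <= d1.
  by rewrite /d; case: (leP d0 d1) => h; split; lra.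
apply: (@is_derive_signed_integral R _ (Num.min x0 z - d) (Num.max x0 z + d)).
- move=> w; rewrite in_itv/= => /andP[lw wh].
  have sw : sigma w != 0.
    have [bw|bw] := pselect (between x0 z w); first exact: nz.
    move: bw; rewrite /between/=; move: lw wh; case: (leP x0 z) => xz lw wh /negP.
      rewrite negb_and -!ltNge => /orP[wx|zw].
        by apply: h0; rewrite ltr0_norm; lra.
      by apply: h1; rewrite gtr0_norm; lra.
    rewrite negb_and -!ltNge => /orP[wx|zw].
      by apply: h1; rewrite ltr0_norm; lra.
    by apply: h0; rewrite gtr0_norm; lra.
  by apply: cvgV => //; exact: sc.
- by rewrite in_itv/=; case: (leP x0 z) => h; apply/andP; split; lra.
- by rewrite in_itv/=; case: (leP x0 z) => h; apply/andP; split; lra.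
Qed.

Ltac nonneg := repeat first [assumption | exact: powR_ge0 | exact: normr_ge0 |
  exact: sqr_ge0 | exact: expR_ge0 | apply: mulr_ge0 | apply: addr_ge0 | exact: ltW].

Definition clamp (R : realType) (T u : R) : R := Num.max 0 (Num.min u T).

Lemma clamp_itv (R : realType) (T u : R) : 0 <= T -> 0 <= clamp T u <= T.
Proof. by rewrite /clamp => T0; case: (leP u T) => ?;
  [case: (leP 0 u) => ?|case: (leP 0 T) => ?]; apply/andP; split; lra. Qed.

Lemma clamp_id (R : realType) (T u : R) : 0 <= u <= T -> clamp T u = u.
Proof. by move=> /andP[u0 uT]; rewrite /clamp min_l// max_r. Qed.

Lemma clamp_dist (R : realType) (T u v : R) : 0 <= T -> `|clamp T u - clamp T v| <= `|u - v|.
Proof.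
move=> T0; wlog uv : u v / v <= u => [wl|].
  by have [?|/ltW ?] := leP v u; [exact: wl|rewrite distrC [leRHS]distrC; exact: wl].
rewrite [leRHS]ger0_norm ?subr_ge0// /clamp.
case: (leP u T) => ?; case: (leP v T) => ?; case: (leP 0 u) => ?;
  case: (leP 0 v) => ?; case: (leP 0 T) => ?; rewrite ler_norml; apply/andP; split; lra.
Qed.

Lemma powR_weaken (R : realType) (T d p g : R) : 0 < g -> g <= p -> 0 <= d <= T ->
  d `^ p <= T `^ (p - g) * d `^ g.
Proof.
move=> g0 gp /andP[d0 dT]; have [->|dn] := eqVneq d 0.
  by rewrite powR0 ?mulr_ge0 ?powR_ge0//; lra.
have -> : d `^ p = d `^ (p - g) * d `^ g by rewrite -powRD ?subrK// dn implybT.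
apply: ler_wpM2r; rewrite ?powR_ge0//.
by apply: le_powRl => //; rewrite subr_ge0.
Qed.

Section sde_path.
Variables (R : realType) (sigma : R -> R) (K T r x0 alpha beta Cx Cy : R).
Variables (x y I : R -> R).
Hypothesis sigma_lip : forall u v, `|sigma u - sigma v| <= K * `|u - v|.
Hypotheses (T0 : 0 < T) (alpha0 : 0 < alpha) (alpha_beta : 1 < alpha + beta).
Hypotheses (beta12 : 2^-1 < beta) (beta1 : beta < 1).
Hypothesis x_hoelder : forall s t : R, 0 <= s <= T -> 0 <= t <= T ->
  `|x s - x t| <= Cx * `|s - t| `^ alpha.
Hypothesis y_hoelder : forall s t : R, 0 <= s <= T -> 0 <= t <= T ->
  `|y s - y t| <= Cy * `|s - t| `^ beta.
Hypothesis I_lim : forall delta e : R, 0 < delta -> 0 < e ->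
  exists2 eps, 0 < eps < e & forall t, 0 <= t <= T ->
    `|eps^-1 * \int[lebesgue_measure]_(s in `[0, t])
        (sigma (x s) * (y (Num.min (s + eps) T) - y s)) - I t| < delta.
Hypothesis x_sol : forall t, 0 <= t <= T ->
  x t = x0 + I t + \int[lebesgue_measure]_(s in `[0, t]) (r * sigma (x s)).

Let X v := x (clamp T v).
Let Y v := y (clamp T v).
Let U v := Y v + r * clamp T v.
Let K0 : 0 <= K.
Proof. by have := sigma_lip 0 1; rewrite sub0r normrN1 mulr1; exact: le_trans. Qed.
Let b0 : 0 < beta. Proof. by move: beta12 => *; lra. Qed.
Let T0' : 0 <= T. Proof. exact: ltW. Qed.

Let hoelder_ext (f : R -> R) (C a : R) : 0 < a ->
  (forall s t, 0 <= s <= T -> 0 <= t <= T -> `|f s - f t| <= C * `|s - t| `^ a) ->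
  0 <= C /\ forall s t, `|f (clamp T s) - f (clamp T t)| <= C * `|s - t| `^ a.
Proof.
move=> a0 fC; have C0 : 0 <= C.
  have := fC 0 T; rewrite !lexx T0' => /(_ isT isT) h.
  have : 0 <= C * `|0 - T| `^ a by apply: le_trans h.
  by rewrite pmulr_lge0// powR_gt0// sub0r normrN gtr0_norm.
split=> // s t; apply: le_trans (fC _ _ (clamp_itv _ T0') (clamp_itv _ T0')) _.
by apply: ler_wpM2l => //; apply: le_powRl => //; [exact: ltW|exact: clamp_dist].
Qed.

Let Cx0 : 0 <= Cx. Proof. exact: (hoelder_ext alpha0 x_hoelder).1. Qed.
Let Cy0 : 0 <= Cy. Proof. exact: (hoelder_ext b0 y_hoelder).1. Qed.
Let XH s t : `|X s - X t| <= Cx * `|s - t| `^ alpha.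
Proof. exact: (hoelder_ext alpha0 x_hoelder).2. Qed.
Let YH s t : `|Y s - Y t| <= Cy * `|s - t| `^ beta.
Proof. exact: (hoelder_ext b0 y_hoelder).2. Qed.
Let ZH s t : `|sigma (X s) - sigma (X t)| <= K * Cx * `|s - t| `^ alpha.
Proof. by apply: le_trans (sigma_lip _ _) _; rewrite -mulrA; apply: ler_wpM2l. Qed.
Let Xc : continuous X. Proof. exact: hoelder_continuous XH. Qed.
Let Yc : continuous Y. Proof. exact: hoelder_continuous YH. Qed.
Let Zc : continuous (fun v => sigma (X v)). Proof. exact: hoelder_continuous ZH. Qed.
Let Uc : continuous U.
Proof.
move=> v; apply: cvgD; first exact: Yc.
apply: cvgM; first exact: cvg_cst.
have : continuous (clamp T); last exact.
by apply: (@lipschitz_continuous R _ 1) => s t; rewrite mul1r; exact: clamp_dist.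
Qed.

Let I_lim' delta e : 0 < delta -> 0 < e ->
  exists2 eps, 0 < eps < e & forall t, 0 <= t <= T ->
    `|eps^-1 * \int[lebesgue_measure]_(s in `[0, t])
        (sigma (X s) * (Y (s + eps) - Y s)) - I t| < delta.
Proof.
move=> d0 e0; have [eps epse h] := I_lim d0 e0; exists eps => // t tT.
move: (h t tT); congr (`|_ * _ - _| < _); apply: eq_Rintegral => s.
rewrite inE/= in_itv/= => /andP[s0 st]; move/andP: tT => [t0 tT].
have sT : 0 <= s <= T by lra.
rewrite /X /Y clamp_id//; congr (_ * (y _ - _)).
by rewrite /clamp [RHS]max_r//; case: (leP (s + eps) T) => ?; lra.
Qed.

Let fc eps : continuous (fun s => sigma (X s) * (Y (s + eps) - Y s)).
Proof.
move=> v; apply: cvgM; first exact: Zc.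
apply: cvgB; last exact: Yc.
apply: (continuous_comp (f := fun u => u + eps) (g := Y)); last exact: Yc.
by apply: cvgD; [exact: cvg_id|exact: cvg_cst].
Qed.

Let gamma := alpha + beta.
Let C1 := K * Cx * Cy / (1 - 2^-1 `^ (gamma - 1)).

Let I_incr s t : 0 <= s -> s <= t -> t <= T ->
  `|I t - I s - sigma (X s) * (Y t - Y s)| <= C1 * (t - s) `^ gamma.
Proof.
move=> s0 st tT; apply/ler_addgt0Pr => e e0.
have A0 : 0 < `|sigma (X s)| * (2 * Cy) + 1 by rewrite ltr_wpDl// !mulr_ge0.
have eta0 : 0 < (e / 2 / (`|sigma (X s)| * (2 * Cy) + 1)) `^ beta^-1.
  by rewrite powR_gt0// !divr_gt0.
have [eps /andP[eps0 epse] h] := I_lim' (divr_gt0 e0 (ltr0n R 4)) eta0.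
have ht := h t; have hs := h s.
have {}ht := ht ltac:(lra); have {}hs := hs ltac:(lra).
have := @forward_average_estimate R (fun v => sigma (X v)) Y alpha beta (K * Cx) Cy eps s t
  eps0 alpha0 b0 alpha_beta (mulr_ge0 K0 Cx0) Cy0 ZH YH s0 st.
have st' : 0 <= s <= t by rewrite s0.
rewrite -(signed_integral_itv (@fc eps) st').
have E v : 0 <= v -> signed_integral (fun s => sigma (X s) * (Y (s + eps) - Y s)) 0 v =
    \int[lebesgue_measure]_(s in `[0, v]) (sigma (X s) * (Y (s + eps) - Y s)).
  by move=> v0; rewrite /signed_integral v0.
rewrite !E//; last by rewrite (le_trans s0).
rewrite -/gamma -/C1.
have : `|sigma (X s)| * (2 * Cy * eps `^ beta) <= e / 2.
  have hb : eps `^ beta <= e / 2 / (`|sigma (X s)| * (2 * Cy) + 1).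
    have -> : e / 2 / (`|sigma (X s)| * (2 * Cy) + 1) =
       (e / 2 / (`|sigma (X s)| * (2 * Cy) + 1)) `^ beta^-1 `^ beta.
      by rewrite -powRrM mulVf ?gt_eqF// powRr1// !divr_ge0// ltW.
    by apply: le_powRl; exact: ltW.
  rewrite mulrA; apply: le_trans (ler_wpM2l _ hb) _; first by nonneg.
  rewrite mulrCA ger_pMr ?divr_gt0// ler_pdivrMr// mul1r lerDl//.
move: ht hs; set a := \int[_]_(_ in _) _; set b := \int[_]_(_ in _) _ => ht hs h1 h2.
have -> : I t - I s - sigma (X s) * (Y t - Y s) =
   (eps^-1 * (a - b) - sigma (X s) * (Y t - Y s)) - (eps^-1 * a - I t) + (eps^-1 * b - I s).
  by lra.
apply: le_trans (ler_normD _ _) _.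
apply: le_trans (lerD (ler_normB _ _) (lexx _)) _.
by lra.
Qed.

Let x_start : X 0 = x0.
Proof.
have h0 : (0 : R) <= 0 <= T by rewrite lexx.
have I0 : I 0 = 0.
  apply/eqP; rewrite -normr_le0; apply/ler_addgt0Pr => e e0.
  have [eps _ /(_ 0 h0)] := I_lim e0 e0.
  by rewrite set_itv1 Rintegral_set1 mulr0 sub0r normrN add0r => /ltW.
by rewrite /X clamp_id// (x_sol h0) I0 set_itv1 Rintegral_set1 !addr0.
Qed.

Let D_incr s t : 0 <= s -> s <= t -> t <= T ->
  `|\int[lebesgue_measure]_(v in `[0, t]) (r * sigma (x v)) -
    \int[lebesgue_measure]_(v in `[0, s]) (r * sigma (x v)) -
    r * sigma (X s) * (t - s)| <= `|r| * (K * Cx) * (t - s) `^ (1 + alpha).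
Proof.
move=> s0 st tT.
have rc : continuous (fun v => r * sigma (X v)).
  by move=> v; apply: cvgM; [exact: cvg_cst|exact: Zc].
have E v : 0 <= v <= T -> \int[lebesgue_measure]_(v in `[0, v]) (r * sigma (x v)) =
    signed_integral (fun v => r * sigma (X v)) 0 v.
  move=> /andP[v0 vT]; rewrite /signed_integral v0; apply: eq_Rintegral => w.
  rewrite inE/= in_itv/= => /andP[w0 wv]; rewrite /X clamp_id//; lra.
rewrite !E; [|lra|lra].
have [|c /andP[sc ct] ->] := @is_derive_MVT R (signed_integral (fun v => r * sigma (X v)) 0)
    (fun v => r * sigma (X v)) s t _ st.
  move=> v /andP[sv vt].
  apply: (@is_derive_signed_integral R _ (-1) (T + 1)).
  - by move=> ? _; exact: rc.
  - by rewrite in_itv/=; apply/andP; split; lra.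
  - by rewrite in_itv/=; apply/andP; split; lra.
rewrite -mulrBl -mulrBr 2!normrM (ger0_norm (x := t - s)) ?subr_ge0//.
have ts : 0 <= t - s by lra.
have -> : (t - s) `^ (1 + alpha) = (t - s) `^ alpha * (t - s).
  have [->|vu0] := eqVneq (t - s) 0; first by rewrite mulr0 powR0// gt_eqF// addr_gt0.
  by rewrite powRD ?vu0 ?implybT// powRr1// mulrC.
rewrite mulrA; apply: ler_wpM2r => //; rewrite -!mulrA; apply: ler_wpM2l => //.
apply: le_trans (ZH _ _) _; rewrite -!mulrA; do 2 apply: ler_wpM2l => //.
by apply: le_powRl; [exact: ltW|exact: normr_ge0|rewrite ger0_norm; lra].
Qed.

Let g := Num.min gamma (2 * beta).

Let flow_exp : exists C, forall s t,
  `|X t - X s - sigma (X s) * (U t - U s)| <= C * `|t - s| `^ g /\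
  (X t - X s) ^+ 2 <= C * `|t - s| `^ g.
Proof.
have ag : 1 < gamma by rewrite /gamma.
have [gb [gg [g1 bg]]] : g <= 2 * beta /\ g <= gamma /\ 1 < g /\ beta <= g.
  rewrite /g; move: beta12 beta1 alpha_beta alpha0; rewrite -/gamma => *.
  by case: (leP gamma (2 * beta)) => h; split; try split; try split; lra.
have g0 : 0 < g by lra.
have C10 : 0 <= C1.
  have := @halfpow_lt1 R (gamma - 1) ltac:(lra) => /andP[_ h].
  by rewrite /C1 divr_ge0// ?mulr_ge0// subr_ge0 ltW.
pose A1 := C1 * T `^ (gamma - g) + `|r| * (K * Cx) * T `^ (1 + alpha - g).
have A10 : 0 <= A1 by rewrite /A1; nonneg.
pose Cu := Cy + `|r| * T `^ (1 - beta).
have Cu0 : 0 <= Cu by rewrite /Cu; nonneg.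
pose M := `|sigma (X 0)| + K * Cx * T `^ alpha.
have M0 : 0 <= M by rewrite /M; nonneg.
pose A2 := A1 * T `^ (g - beta) + M * Cu.
have A20 : 0 <= A2 by rewrite /A2; nonneg.
pose B := T `^ (2 * beta - g).
have B0 : 0 <= B by exact: powR_ge0.
have F1 s t : 0 <= s -> s <= t -> t <= T ->
    `|X t - X s - sigma (X s) * (U t - U s)| <= A1 * (t - s) `^ g.
  move=> s0 st tT; have := I_incr s0 st tT; have := D_incr s0 st tT.
  have sI : 0 <= s <= T by lra.
  have tI : 0 <= t <= T by lra.
  have -> : X t - X s = x t - x s by rewrite /X !clamp_id.
  rewrite /U (clamp_id tI) (clamp_id sI) (x_sol tI) (x_sol sI).
  set a := \int[_]_(_ in _) _; set b := \int[_]_(_ in _) _ => h1 h2.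
  have dT : 0 <= t - s <= T by lra.
  have -> : x0 + I t + a - (x0 + I s + b) - sigma (X s) * (Y t + r * t - (Y s + r * s)) =
    (I t - I s - sigma (X s) * (Y t - Y s)) + (a - b - r * sigma (X s) * (t - s)) by lra.
  apply: le_trans (ler_normD _ _) _; rewrite /A1 [leRHS]mulrDl; apply: lerD.
    apply: le_trans h2 _; rewrite -mulrA; apply: ler_wpM2l => //.
    exact: powR_weaken.
  apply: le_trans h1 _; rewrite -[leRHS]mulrA; apply: ler_wpM2l; first by nonneg.
  apply: powR_weaken => //; move: gg beta1; rewrite /gamma => *; lra.
have FU s t : 0 <= s -> s <= t -> t <= T -> `|U t - U s| <= Cu * (t - s) `^ beta.
  move=> s0 st tT; have sI : 0 <= s <= T by lra.
  have tI : 0 <= t <= T by lra.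
  have dT : 0 <= t - s <= T by lra.
  have -> : U t - U s = (Y t - Y s) + r * (t - s) by rewrite /U !clamp_id//; lra.
  apply: le_trans (ler_normD _ _) _; rewrite /Cu [leRHS]mulrDl; apply: lerD.
    by apply: le_trans (YH _ _) _; rewrite ger0_norm//; lra.
  rewrite normrM -mulrA; apply: ler_wpM2l => //; rewrite ger0_norm; last lra.
  have := powR_weaken b0 (ltW beta1) dT; rewrite powRr1//; lra.
have F2 s t : 0 <= s -> s <= t -> t <= T -> `|X t - X s| <= A2 * (t - s) `^ beta.
  move=> s0 st tT; have dT : 0 <= t - s <= T by lra.
  have -> : X t - X s = (X t - X s - sigma (X s) * (U t - U s)) + sigma (X s) * (U t - U s) by lra.
  apply: le_trans (ler_normD _ _) _; rewrite /A2 [leRHS]mulrDl; apply: lerD.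
    apply: le_trans (F1 _ _ s0 st tT) _; rewrite -[leRHS]mulrA; apply: ler_wpM2l => //.
    exact: powR_weaken.
  rewrite normrM -mulrA; apply: ler_pM => //; last exact: FU.
  rewrite -[sigma (X s)](subrK (sigma (X 0))) addrC; apply: le_trans (ler_normD _ _) _.
  rewrite lerD2l; apply: le_trans (ZH _ _) _; apply: ler_wpM2l; first by nonneg.
  by apply: le_powRl; [exact: ltW|exact: normr_ge0|rewrite ger0_norm; lra].
have sqb s t : 0 <= s -> s <= t -> t <= T ->
    (t - s) `^ beta * (t - s) `^ beta <= B * (t - s) `^ g.
  move=> s0 st tT; have dT : 0 <= t - s <= T by lra.
  have -> : (t - s) `^ beta * (t - s) `^ beta = (t - s) `^ (2 * beta).
    have [->|vu0] := eqVneq (t - s) 0; first by rewrite !powR0 ?mulr0//; lra.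
    by rewrite mulrDl mul1r powRD// vu0 implybT.
  exact: powR_weaken.
pose C := A1 + K * A2 * Cu * B + A2 * A2 * B.
have Cn : 0 <= K * A2 * Cu * B /\ 0 <= A2 * A2 * B by split; nonneg.
have main s t : 0 <= s -> s <= t -> t <= T ->
  [/\ `|X t - X s - sigma (X s) * (U t - U s)| <= C * (t - s) `^ g,
      `|X s - X t - sigma (X t) * (U s - U t)| <= C * (t - s) `^ g &
      (X t - X s) ^+ 2 <= C * (t - s) `^ g].
  move=> s0 st tT; have P0 := powR_ge0 (t - s) g.
  have h1 := F1 _ _ s0 st tT; have h2 := F2 _ _ s0 st tT.
  have hu := FU _ _ s0 st tT; have hs := sqb _ _ s0 st tT.
  have pb := powR_ge0 (t - s) beta.
  split.
  - by apply: le_trans h1 _; apply: ler_wpM2r => //; rewrite /C; lra.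
  - have -> : X s - X t - sigma (X t) * (U s - U t) =
      - (X t - X s - sigma (X s) * (U t - U s)) + (sigma (X t) - sigma (X s)) * (U t - U s) by lra.
    apply: le_trans (ler_normD _ _) _; rewrite normrN.
    apply: (@le_trans _ _ ((A1 + K * A2 * Cu * B) * (t - s) `^ g)).
      rewrite [leRHS]mulrDl; apply: lerD => //; rewrite normrM.
      have h3 : `|sigma (X t) - sigma (X s)| <= K * (A2 * (t - s) `^ beta).
        by apply: le_trans (sigma_lip _ _) _; apply: ler_wpM2l.
      apply: le_trans (ler_pM _ _ h3 hu) _ => //.
      have -> : K * (A2 * (t - s) `^ beta) * (Cu * (t - s) `^ beta) =
         K * A2 * Cu * ((t - s) `^ beta * (t - s) `^ beta) by lra.
      by rewrite -[leRHS]mulrA; apply: ler_wpM2l => //; nonneg.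
    by apply: ler_wpM2r => //; rewrite /C; lra.
  - apply: (@le_trans _ _ (A2 * A2 * B * (t - s) `^ g)); last first.
      by apply: ler_wpM2r => //; rewrite /C; have [] := Cn; lra.
    rewrite -(real_normK (num_real (X t - X s))) expr2.
    apply: le_trans (ler_pM _ _ h2 h2) _ => //.
    have -> : A2 * (t - s) `^ beta * (A2 * (t - s) `^ beta) =
       A2 * A2 * ((t - s) `^ beta * (t - s) `^ beta) by lra.
    by rewrite -[leRHS]mulrA; apply: ler_wpM2l => //; nonneg.
have C0 : 0 <= C by rewrite /C; have [] := Cn; lra.
have clampX v : X (clamp T v) = X v by rewrite /X clamp_id// clamp_itv.
have clampU v : U (clamp T v) = U v.
  by rewrite /U /Y [clamp T (clamp T v)]clamp_id// clamp_itv.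
exists C => s t; have /andP[s0 sT] := clamp_itv s T0'.
have /andP[t0 tT] := clamp_itv t T0'.
have cd : `|clamp T t - clamp T s| `^ g <= `|t - s| `^ g.
  by apply: le_powRl; [exact: ltW|exact: normr_ge0|exact: clamp_dist].
have [st|/ltW ts] := leP (clamp T s) (clamp T t).
  have [h1 _ h3] := main _ _ s0 st tT; rewrite !clampX !clampU in h1 h3.
  rewrite ger0_norm ?subr_ge0// in cd.
  by split; [apply: le_trans h1 _|apply: le_trans h3 _]; exact: ler_wpM2l.
have [_ h2 h3] := main _ _ t0 ts sT; rewrite !clampX !clampU in h2 h3.
rewrite distrC ger0_norm ?subr_ge0// in cd.
split; first by apply: le_trans h2 _; exact: ler_wpM2l.
by rewrite -sqrrN opprB; apply: le_trans h3 _; exact: ler_wpM2l.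
Qed.

Let g1 : 1 < g.
Proof. by rewrite /g; move: beta12 alpha_beta; rewrite -/gamma => *; case: (leP gamma _) => h; lra. Qed.

Let sigma_cont : continuous sigma.
Proof. exact: lipschitz_continuous sigma_lip. Qed.

Lemma sde_path_scale (G : R -> R) : y 0 = 0 -> sigma x0 != 0 -> is_scale sigma G x0 ->
  forall t, 0 <= t <= T ->
    (forall w, between x0 (x t) w -> sigma w != 0) /\ G (x t) - G x0 = y t + r * t.
Proof.
move=> y0 sx0 GS t tT; have [C hC] := flow_exp.
have XE : X t = x t by rewrite /X clamp_id.
have GS' : is_scale sigma G (X 0) by rewrite x_start.
have s0 : sigma (X 0) != 0 by rewrite x_start.
have nz := flow_nonzero sigma_lip g1 Xc Uc GS' (fun s t => (hC s t).1)
  (fun s t => (hC s t).2) (a := T) s0.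
have nz' v : 0 <= v <= t -> sigma (X v) != 0.
  by move=> vt; apply: nz; lra.
have t0 : 0 <= t by lra.
have := flow_chart sigma_lip g1 Xc GS' (fun s t => (hC s t).1)
  (fun s t => (hC s t).2) t0 nz'.
have h0 : (0 : R) <= 0 <= T by rewrite lexx.
rewrite x_start XE /U /Y !clamp_id// y0 mulr0 addr0 subr0 => ->; split => //.
have := flow_between Xc nz' (v := t); rewrite x_start XE; apply.
by rewrite t0 lexx.
Qed.

Lemma sde_path_constant : sigma x0 = 0 -> forall t, 0 <= t <= T -> x t = x0.
Proof.
move=> sx0; have [C hC] := flow_exp.
have sX t : 0 <= t <= T -> sigma (X t) = 0.
  move=> /andP[t0 tT]; apply/eqP/negP => /negP nz.
  have rc (f : R -> R) : continuous f -> continuous (fun v => f (t - v)).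
    move=> fcont v; apply: (continuous_comp (f := fun v => t - v)); last exact: fcont.
    by apply: cvgB; [exact: cvg_cst|exact: cvg_id].
  have dE s v : (t - v) - (t - s) = - (v - s) by lra.
  have := @flow_nonzero R sigma K sigma_lip (fun v => X (t - v)) (fun v => U (t - v))
     (signed_integral (fun z => (sigma z)^-1) (X t)) g C g1 (rc _ Xc) (rc _ Uc).
  rewrite subr0 => /(_ (@is_scale_signed_integral R sigma (X t) sigma_cont)) h.
  have h1 : forall s v, `|X (t - v) - X (t - s) - sigma (X (t - s)) * (U (t - v) - U (t - s))|
      <= C * `|v - s| `^ g.
    by move=> s v; have := (hC (t - s) (t - v)).1; rewrite dE normrN.
  have h2 : forall s v, (X (t - v) - X (t - s)) ^+ 2 <= C * `|v - s| `^ g.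
    by move=> s v; have := (hC (t - s) (t - v)).2; rewrite dE normrN.
  have := h h1 h2 t nz t; rewrite t0 lexx subrr x_start sx0 eqxx.
  by move=> /(_ isT).
move=> t tT; have XE : X t = x t by rewrite /X clamp_id.
rewrite -XE -x_start; apply: (superlinear_constant (a := T) (C := C) g1) => // s v s0 sv vT.
have := (hC s v).1; rewrite sX ?mul0r ?subr0; last lra.
by rewrite [`|v - s|]ger0_norm// subr_ge0.
Qed.

End sde_path.

(** * Chaining and Hoelder paths *)

Definition dyadic (R : realType) (T : R) (n i : nat) : R := i%:R * (2^-1 ^+ n * T).

Section dyadic_chaining.
Variables (R : realType) (T b : R) (n0 : nat) (f : R -> R).
Hypotheses (T0 : 0 < T) (b01 : 0 < b < 1).
Hypothesis f_cont : {within `[0, T], continuous f}.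
Hypothesis f_incr : forall n i, (n0 <= n)%N -> (i < 2 ^ n)%N ->
  `|f (dyadic T n i.+1) - f (dyadic T n i)| <= b ^+ n.

Let mesh (n : nat) : R := 2^-1 ^+ n * T.
Let idx n t := Num.truncn (t / mesh n).
Let q n t := dyadic T n (idx n t).

Let b_ge0 : 0 <= b. Proof. by case/andP : b01 => /ltW. Qed.
Let b_lt1 : b < 1. Proof. by case/andP : b01. Qed.

Let mesh0 n : 0 < mesh n.
Proof. by rewrite /mesh mulr_gt0// exprn_gt0// invr_gt0. Qed.

Let meshS n : mesh n = 2 * mesh n.+1.
Proof. by rewrite /mesh exprS; field. Qed.

Let idxP n t : 0 <= t -> (idx n t)%:R <= t / mesh n < (idx n t).+1%:R.
Proof. by move=> t0; apply: truncn_itv; rewrite divr_ge0// ltW. Qed.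

Let idx_le n t : 0 <= t <= T -> (idx n t <= 2 ^ n)%N.
Proof.
move=> /andP[t0 tT]; have /andP[h _] := idxP n t0.
rewrite -(ler_nat R); apply: le_trans h _.
rewrite ler_pdivrMr// /mesh natrX mulrA exprVn divff ?mul1r//.
Qed.

Let q_le n t : 0 <= t <= T -> 0 <= t - q n t < mesh n.
Proof.
move=> /andP[t0 tT]; have := idxP n t0; have m0 := mesh0 n.
rewrite ler_pdivlMr// ltr_pdivrMr// -natr1 mulrDl mul1r => /andP[h1 h2].
by rewrite /q /dyadic -/(mesh n); lra.
Qed.

Let q_itv n t : 0 <= t <= T -> 0 <= q n t <= T.
Proof.
move=> tT; have := q_le n tT; have : 0 <= q n t.
  by rewrite /q /dyadic mulr_ge0// -/(mesh n) ltW.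
move=> *; lra.
Qed.

Let idxS n t : 0 <= t <= T -> idx n.+1 t = (idx n t).*2 \/ idx n.+1 t = (idx n t).*2.+1.
Proof.
move=> /andP[t0 tT]; have /andP[h1 h2] := idxP n t0; have /andP[h3 h4] := idxP n.+1 t0.
have E : t / mesh n.+1 = 2 * (t / mesh n) by rewrite (meshS n); field; rewrite gt_eqF.
rewrite E in h3 h4.
have a1 : (idx n.+1 t < (idx n t).+1.*2)%N.
  rewrite -(ltr_nat R) -muln2 natrM; lra.
have a2 : ((idx n t).*2 < (idx n.+1 t).+1)%N.
  rewrite -(ltr_nat R) -muln2 natrM; lra.
rewrite doubleS ltnS in a1; rewrite ltnS in a2.
by move: a1; rewrite leq_eqVlt ltnS => /orP[/eqP ->|a1]; [right|left; apply/eqP; rewrite eqn_leq a1].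
Qed.

Let q_step n t : (n0 <= n)%N -> 0 <= t <= T -> `|f (q n.+1 t) - f (q n t)| <= b ^+ n.+1.
Proof.
move=> n0n tT; have b0 := b_ge0.
have E : q n t = dyadic T n.+1 (idx n t).*2.
  by rewrite /q /dyadic -!/(mesh _) (meshS n) -muln2 natrM mulrA.
have := idx_le n.+1 tT; rewrite E /q; case: (idxS n tT) => -> h.
  by rewrite subrr normr0 exprn_ge0.
by apply: f_incr => //; exact: leqW.
Qed.

Let c := b / (1 - b).

Let q_tail n k t : (n0 <= n)%N -> 0 <= t <= T ->
  `|f (q (n + k) t) - f (q n t)| <= c * (b ^+ n - b ^+ (n + k)).
Proof.
move=> n0n tT; elim: k => [|k IH]; first by rewrite addn0 !subrr normr0 mulr0.
have := @q_step (n + k) t (leq_trans n0n (leq_addr _ _)) tT; rewrite addnS => h.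
have -> : f (q (n + k).+1 t) - f (q n t) =
  (f (q (n + k).+1 t) - f (q (n + k) t)) + (f (q (n + k) t) - f (q n t)) by lra.
apply: le_trans (ler_normD _ _) _; apply: le_trans (lerD h IH) _.
rewrite le_eqVlt; apply/orP; left; apply/eqP.
have := b_lt1 => b1; rewrite /c !exprS; field; lra.
Qed.

Let q_cvg t : 0 <= t <= T -> f (q n t) @[n --> \oo] --> f t.
Proof.
move=> tT; have qt : q n t @[n --> \oo] --> t.
  apply/cvgrPdist_lt => e e0.
  have : mesh n @[n --> \oo] --> 0.
    rewrite -[X in _ --> X](mul0r T); apply: cvgM; last exact: cvg_cst.
    by apply: cvg_expr; rewrite ger0_norm; lra.
  move=> /cvgrPdist_lt /(_ _ e0); apply: filterS => n.
  rewrite sub0r normrN gtr0_norm// => h; have /andP[h1 h2] := q_le n tT.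
  by rewrite ger0_norm//; exact: lt_trans h.
have /cvgrPdist_le fct : f x @[x --> within [set` `[0, T]] (nbhs t)] --> f t.
  move/subspace_continuousP : f_cont; apply.
  by rewrite /= in_itv.
apply/cvgrPdist_le => e e0; have := fct e e0 => {}fct.
have : \forall n \near \oo, ([set` `[0, T]] (q n t) -> `|f t - f (q n t)| <= e).
  exact: qt fct.
apply: filterS => n; apply; rewrite /= in_itv/=; exact: q_itv.
Qed.

Let f_tail n t : (n0 <= n)%N -> 0 <= t <= T -> `|f t - f (q n t)| <= c * b ^+ n.
Proof.
move=> n0n tT; have c0 : 0 <= c by rewrite /c divr_ge0// subr_ge0 ltW.
have h : `|f (q (k + n) t) - f (q n t)| @[k --> \oo] --> `|f t - f (q n t)|.
  apply: cvg_norm; apply: cvgB; last exact: cvg_cst.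
  by have := q_cvg tT; rewrite -(cvg_shiftn n).
apply: cvgr_to_le h _; apply: nearW => k.
rewrite addnC; apply: le_trans (@q_tail n k t n0n tT) _; apply: ler_wpM2l => //.
by rewrite gerBl exprn_ge0.
Qed.

Let f_close n s t : (n0 <= n)%N -> 0 <= s -> s <= t -> t <= T -> t - s <= mesh n ->
  `|f t - f s| <= (2 * c + 1) * b ^+ n.
Proof.
move=> n0n s0 st tT stn.
have sI : 0 <= s <= T by lra.
have tI : 0 <= t <= T by lra.
have b0 := b_ge0.
have h1 := f_tail n0n sI; have h2 := f_tail n0n tI.
have h3 : `|f (q n t) - f (q n s)| <= b ^+ n.
  have m0 := mesh0 n.
  have le1 : (idx n s <= idx n t)%N.
    by apply: le_truncn; rewrite ler_pM2r ?invr_gt0.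
  have le2 : (idx n t < (idx n s).+2)%N.
    have /andP[h3 _] := idxP n (le_trans s0 st); have /andP[_ h4] := idxP n s0.
    rewrite -(ltr_nat R) -natr1; apply: le_lt_trans h3 _.
    have -> : t / mesh n = s / mesh n + (t - s) / mesh n by rewrite -mulrDl addrC subrK.
    by rewrite ltr_leD// ler_pdivrMr// mul1r.
  rewrite ltnS in le2; have := idx_le n tI.
  move: le1 le2; rewrite /q leq_eqVlt => /orP[/eqP <- _ _|lt1 le2].
    by rewrite subrr normr0 exprn_ge0.
  have -> : idx n t = (idx n s).+1 by apply/eqP; rewrite eqn_leq le2.
  by move=> h; exact: f_incr.
have -> : f t - f s = (f t - f (q n t)) + (f (q n t) - f (q n s)) - (f s - f (q n s)) by lra.
apply: le_trans (ler_normB _ _) _.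
apply: le_trans (lerD (ler_normD _ _) (lexx _)) _; lra.
Qed.

Lemma dyadic_chaining (beta : R) : 0 < beta -> b = 2^-1 `^ beta ->
  exists C, forall s t, 0 <= s <= T -> 0 <= t <= T -> `|f s - f t| <= C * `|s - t| `^ beta.
Proof.
move=> beta0 bE.
have [M fM] : exists M, forall t, 0 <= t <= T -> `|f t| <= M.
  have [|x _ xmax] := @EVT_max R (fun t => `|f t|) 0 T (ltW T0).
    by move=> t; apply: cvg_norm; exact: f_cont.
  by exists `|f x| => t tT; apply: xmax; rewrite in_itv.
have M0 : 0 <= M by apply: le_trans (normr_ge0 (f 0)) (fM 0 _); rewrite lexx ltW.
have c0 : 0 <= c by rewrite /c divr_ge0// subr_ge0 ltW.
pose C1 := (2 * c + 1) * (2 / T) `^ beta.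
pose C2 := 2 * M / mesh n0 `^ beta.
have C10 : 0 <= C1 by rewrite /C1; nonneg; lra.
have C20 : 0 <= C2 by rewrite /C2 divr_ge0 ?powR_ge0// mulr_ge0.
exists (C1 + C2) => s t.
wlog st : s t / s <= t => [wl sI tI|sI tI].
  have [st|/ltW ts] := leP s t; first exact: wl.
  by rewrite distrC [`|s - t|]distrC; exact: wl.
have [->|st0] := eqVneq s t.
  by rewrite !subrr normr0 mulr_ge0 ?powR_ge0// addr_ge0.
have d0 : 0 < t - s.
  by rewrite subr_gt0 lt_neqAle st st0.
rewrite distrC [`|s - t|]distrC [`|t - s|]gtr0_norm//.
have [small|large] := leP (t - s) (mesh n0); last first.
  apply: (@le_trans _ _ (C2 * (t - s) `^ beta)); last first.
    by apply: ler_wpM2r; rewrite ?powR_ge0// lerDr.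
  apply: (@le_trans _ _ (2 * M)).
    by apply: le_trans (ler_normB _ _) _; have := fM _ sI; have := fM _ tI; lra.
  rewrite /C2 -mulrA; apply: ler_peMr; first by nonneg.
  rewrite ler_pdivlMl ?powR_gt0// mulr1; apply: le_powRl; exact: ltW.
apply: (@le_trans _ _ (C1 * (t - s) `^ beta)); last first.
  by apply: ler_wpM2r; rewrite ?powR_ge0// lerDl.
have ex : exists n, mesh n < t - s.
  have : mesh n @[n --> \oo] --> 0.
    rewrite -[X in _ --> X](mul0r T); apply: cvgM; last exact: cvg_cst.
    by apply: cvg_expr; rewrite ger0_norm; lra.
  move=> /cvgrPdist_lt /(_ _ d0)[n _ /(_ n (leqnn _))].
  by rewrite sub0r normrN gtr0_norm// => h; exists n.
case: (ex_minnP ex) => m mlt mmin.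
have m0 : (n0 < m)%N.
  rewrite ltnNge; apply/negP => mn0; move: mlt; rewrite ltNge => /negP; apply.
  apply: le_trans small _; rewrite ler_pM2r//.
  by apply: ler_wiXn2l => //; lra.
case: m => [//|n] in mlt mmin m0 *.
have stn : t - s <= mesh n.
  by rewrite leNgt; apply/negP => /mmin; rewrite ltnn.
have s0 : 0 <= s by lra.
have tT : t <= T by lra.
apply: le_trans (f_close m0 s0 st tT stn) _.
rewrite /C1 -mulrA; apply: ler_wpM2l; first by nonneg; lra.
have -> : b ^+ n = (2^-1 ^+ n) `^ beta.
  by rewrite bE exprn_powR// invr_ge0 ler0n.
have h2T : 0 <= 2 / T by rewrite divr_ge0// ltW.
rewrite -(powRM beta h2T (ltW d0)); apply: le_powRl; first exact: ltW.
  by rewrite exprn_ge0// invr_ge0.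
have i2 : 0 < 2^-1 :> R by lra.
have := mlt; rewrite meshS in stn; rewrite /mesh exprS => h.
rewrite mulrAC ler_pdivlMr//; lra.
Qed.

End dyadic_chaining.

Lemma sqr_le_cosh (R : realType) (z : R) : 2 + z ^+ 2 <= expR z + expR (- z).
Proof.
have Dd (x : R) : is_derive x 1 (fun z => expR z + expR (- z) - z ^+ 2)
    (expR x - expR (- x) - 2 * x).
  by apply: is_derive_eq; rewrite /GRing.scale/=; lra.
have Sd (x : R) : is_derive x 1 (fun z => expR z - expR (- z) - 2 * z)
    (expR x + expR (- x) - 2).
  by apply: is_derive_eq; rewrite /GRing.scale/=; lra.
have S0 (w : R) : 0 <= expR w + expR (- w) - 2.
  have := expR_ge1Dx w; have := expR_ge1Dx (- w); lra.
have sgn (w : R) : 0 <= (expR w - expR (- w) - 2 * w) * w.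
  have [c _] := @MVT_between R (fun z => expR z - expR (- z) - 2 * z) _ 0 w (fun x _ => Sd x).
  rewrite oppr0 expR0 mulr0 !subr0 subrr subr0 => ->.
  by rewrite addr0 -mulrA; apply: mulr_ge0; [exact: S0|rewrite -expr2 sqr_ge0].
have [c cz] := @MVT_between R (fun z => expR z + expR (- z) - z ^+ 2) _ 0 z (fun x _ => Dd x).
rewrite oppr0 expR0 expr0n/= ?subr0 ?addr0 => E.
suff : 0 <= (expR c - expR (- c) - 2 * c) * z by rewrite -E; lra.
have [c0|c0] := eqVneq c 0; first by rewrite c0 oppr0 expR0 mulr0 !subr0 subrr mul0r.
have cz0 : 0 <= z / c.
  move: cz; rewrite /between/=; case: (leP 0 z) => z0 /andP[h1 h2].
    by rewrite divr_ge0.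
  by rewrite -mulrNN -invrN divr_ge0; lra.
have -> : z = c * (z / c) by rewrite mulrCA divff ?mulr1.
by rewrite mulrA mulr_ge0.
Qed.

Lemma cosh_le_sqr (R : realType) (z : R) :
  5 * (expR z + expR (- z)) <= z ^+ 2 + (expR (2 * z) + expR (- (2 * z))) + 8.
Proof.
pose y := z / 2; pose S := expR y - expR (- y); pose Ch := expR y + expR (- y).
have hd (x : R) : is_derive x 1
    (fun y => y * (expR y + expR (- y)) - (expR y - expR (- y)))
    (x * (expR x - expR (- x))).
  by apply: is_derive_eq; rewrite /GRing.scale/=; lra.
have [c cy] := MVT_between (a := 0) (b := y) (fun x _ => hd x).
rewrite oppr0 mul0r subrr ?subr0 ?addr0 -/S -/Ch => E.
have csinh (w : R) : 0 <= w * (expR w - expR (- w)).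
  have [w0|/ltW w0] := leP 0 w; first by rewrite mulr_ge0// subr_ge0 ler_expR; lra.
  by rewrite mulr_le0// subr_le0 ler_expR; lra.
have h1 : y * S <= y * (y * Ch).
  rewrite -subr_ge0 -mulrBr E mulrCA; apply: mulr_ge0; first exact: csinh.
  by rewrite -expr2 sqr_ge0.
have h0 : 0 <= y * S by exact: csinh.
have SC : Ch ^+ 2 = S ^+ 2 + 4.
  have : expR y * expR (- y) = 1 by rewrite -expRD subrr expR0.
  rewrite /Ch /S !expr2 => e; lra.
have S2 : S ^+ 2 = expR z + expR (- z) - 2.
  have : expR y * expR (- y) = 1 by rewrite -expRD subrr expR0.
  have : expR y * expR y = expR z by rewrite -expRD; congr expR; rewrite /y; lra.
  have : expR (- y) * expR (- y) = expR (- z) by rewrite -expRD; congr expR; rewrite /y; lra.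
  rewrite /S expr2 => *; lra.
have S4 : S ^+ 2 * S ^+ 2 = expR (2 * z) + expR (- (2 * z)) + 6 - 4 * (expR z + expR (- z)).
  have : expR z * expR (- z) = 1 by rewrite -expRD subrr expR0.
  have : expR z * expR z = expR (2 * z) by rewrite -expRD; congr expR; lra.
  have : expR (- z) * expR (- z) = expR (- (2 * z)) by rewrite -expRD; congr expR; lra.
  rewrite S2 => *; lra.
have S20 : 0 <= S ^+ 2 by exact: sqr_ge0.
suff : S ^+ 2 <= z ^+ 2 + S ^+ 2 * S ^+ 2 by rewrite S4 {1}S2; lra.
have zy : z ^+ 2 = 4 * y ^+ 2 by rewrite /y !expr2; lra.
rewrite zy.
have key : S ^+ 2 <= y ^+ 2 * (S ^+ 2 + 4).
  have [y0|y0] := eqVneq y 0.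
    by rewrite /S y0 oppr0 subrr expr0n/= mul0r.
  have y20 : 0 < y ^+ 2 by rewrite exprn_even_gt0.
  rewrite -SC -(ler_pM2l y20).
  have -> : y ^+ 2 * S ^+ 2 = (y * S) ^+ 2 by rewrite [RHS]exprMn.
  have -> : y ^+ 2 * (y ^+ 2 * Ch ^+ 2) = (y * (y * Ch)) ^+ 2.
    by rewrite [RHS]exprMn; congr (_ * _); rewrite [RHS]exprMn.
  by rewrite ler_sqr ?nnegrE//; exact: le_trans h1.
have := sqr_ge0 y; move: key S20; set a := S ^+ 2; set b := y ^+ 2 => *; nra.
Qed.

Lemma expR_le_quad (R : realType) (x : R) : 0 <= x <= 2^-1 -> expR x <= 1 + x + 2 * x ^+ 2.
Proof.
move=> /andP[x0 x1]; have h := expR_ge1Dx (- x).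
have : expR x * expR (- x) = 1 by rewrite -expRD subrr expR0.
have := expR_gt0 x; set a := expR x; set b := expR (- x) => a0 ab.
have : a * (1 - x) <= 1 by rewrite -[leRHS]ab ler_pM2l.
rewrite expr2 => ?; nra.
Qed.

(** * Gaussian laws and fractional Brownian motion *)

Section gaussian.
Context {d : measure_display} {Omega : measurableType d} {R : realType}.
Variable P : probability Omega R.
Variables (Y : Omega -> R) (m s : R).
Hypothesis mY : measurable_fun setT Y.
Hypothesis lawY : forall E : set R, measurable E ->
  P (Y @^-1` E) = if s == 0 then \d_m E else normal_prob m s E.

Let mY_mixin := @isMeasurableFun.Build _ _ Omega (measurableTypeR R) Y mY.
Let Y_pack : {RV P >-> measurableTypeR R} := HB.pack Y mY_mixin.

Lemma ge0_integral_gaussian (f : R -> \bar R) :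
  measurable_fun [set: R] f -> (forall x, 0 <= f x)%E ->
  (\int[P]_w f (Y w) =
   if s == 0%R then f m else \int[lebesgue_measure]_x (f x * (normal_pdf m s x)%:E))%E.
Proof.
move=> mf f0.
have mf' : measurable_fun [set: measurableTypeR R] f by exact: mf.
rewrite -[LHS](ge0_integral_distribution Y_pack mf' f0).
case: ifPn => [s0|s0].
  transitivity (\int[@dirac _ (measurableTypeR R) m R]_y f y)%E.
    by apply: eq_measure_integral => A mA _; have := lawY mA; rewrite s0; exact.
  by rewrite integral_dirac// diracT mul1e.
transitivity (\int[normal_prob m s]_y f y)%E.
  apply: eq_measure_integral => A mA _.
  by have := lawY mA; rewrite (negbTE s0); exact.
have dom := normal_prob_dominates m s.
rewrite -(Radon_Nikodym_SigmaFinite.change_of_variables dom f0 measurableT mf).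
apply: ae_eq_integral => //.
- apply: emeasurable_funM => //.
  exact: measurable_int (Radon_Nikodym_SigmaFinite.f_integrable dom).
- apply: emeasurable_funM => //; apply/measurable_EFinP; exact: measurable_normal_pdf.
- apply: ae_eqe_mul2l; apply: integral_ae_eq => //.
  + exact: Radon_Nikodym_SigmaFinite.f_integrable.
  + by apply/measurable_EFinP; exact: measurable_normal_pdf.
  + by move=> E _ mE; rewrite -Radon_Nikodym_SigmaFinite.f_integral.
Qed.

Lemma gaussian_mgf (a : R) :
  (\int[P]_w (expR (a * Y w))%:E = (expR (a * m + a ^+ 2 * s ^+ 2 / 2))%:E)%E.
Proof.
rewrite (@ge0_integral_gaussian (fun x => (expR (a * x))%:E)); last 2 first.
- by apply/measurable_EFinP; apply: measurableT_comp => //; exact: measurable_funM.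
- by move=> x; rewrite lee_fin expR_ge0.
case: eqVneq => [->|s0]; first by rewrite expr0n/= mulr0 mul0r addr0.
have E x : ((expR (a * x))%:E * (normal_pdf m s x)%:E =
    (expR (a * m + a ^+ 2 * s ^+ 2 / 2))%:E * (normal_pdf (m + a * s ^+ 2) s x)%:E)%E.
  rewrite !normal_pdfE// /normal_fun -!EFinM; congr (_%:E).
  rewrite mulrCA [RHS]mulrCA -!expRD; congr (_ * expR _).
  by rewrite -[s ^+ 2 *+ 2]mulr_natr !expr2; field.
under eq_integral do rewrite E.
rewrite ge0_integralZl//.
- by rewrite integral_normal_pdf mule1.
- by apply/measurable_EFinP; exact: measurable_normal_pdf.
- by move=> x _; rewrite lee_fin normal_pdf_ge0.
Qed.

End gaussian.

Section centered_gaussian.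
Context {d : measure_display} {Omega : measurableType d} {R : realType}.
Variable P : probability Omega R.

Lemma measurable_fun_expRM (Y : Omega -> R) (a : R) :
  measurable_fun setT Y -> measurable_fun setT (fun w => (expR (a * Y w))%:E).
Proof.
by move=> mY; apply/measurable_EFinP; apply: measurableT_comp => //; exact: measurable_funM.
Qed.

Lemma integral_probability_cst (c : R) : (\int[P]_w c%:E = c%:E)%E.
Proof. by rewrite integral_cst//= probability_setT mule1. Qed.

Lemma integrable_sqr (Y : Omega -> R) : measurable_fun setT Y ->
  (\int[P]_w (Y w ^+ 2)%:E < +oo)%E -> P.-integrable setT (EFin \o Y).
Proof.
move=> mY Y2; apply: (@le_integrable _ _ _ P _ measurableT _ (fun w => (1 + Y w ^+ 2)%:E)).
- exact/measurable_EFinP.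
- move=> w _; rewrite /= lee_fin [X in _ <= X]ger0_norm ?addr_ge0 ?sqr_ge0//.
  rewrite -(real_normK (num_real (Y w))); have := normr_ge0 (Y w).
  by set y := `|Y w| => y0; have := sqr_ge0 (y - 1); rewrite !expr2; nra.
- apply/integrableP; split.
    by apply/measurable_EFinP; apply: measurable_funD => //; exact: measurable_funX.
  under eq_integral.
    move=> w _; rewrite gee0_abs; last by rewrite lee_fin addr_ge0 ?sqr_ge0.
    rewrite EFinD; over.
  rewrite ge0_integralD//=.
  + rewrite integral_probability_cst.
    by rewrite lte_add_pinfty// ltry.
  + by move=> w _; rewrite lee_fin sqr_ge0.
  + by apply/measurable_EFinP; exact: measurable_funX.
Qed.

Lemma centered_gaussian_law (Y : Omega -> R) (v : R) : measurable_fun setT Y ->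
  gaussian_law P Y -> (\int[P]_w (Y w)%:E = 0)%E -> (\int[P]_w (Y w ^+ 2)%:E = v%:E)%E ->
  0 <= v /\ forall E : set R, measurable E ->
    P (Y @^-1` E) = if Num.sqrt v == 0 then \d_(0 : R) E else normal_prob 0 (Num.sqrt v) E.
Proof.
move=> mY [m [s [s0 law]]] Y1 Y2.
have mgf := gaussian_mgf mY law.
have iY : P.-integrable setT (EFin \o Y) by apply: integrable_sqr; rewrite ?Y2 ?ltry.
have m0 : m = 0.
  have key a : 1 <= expR (a * m + a ^+ 2 * s ^+ 2 / 2).
    rewrite -lee_fin -mgf.
    have -> : (1%:E = \int[P]_w ((1 + a * Y w)%:E))%E.
      under eq_integral do rewrite EFinD EFinM.
      rewrite integralD//=; last 2 first.
      - exact: finite_measure_integrable_cst.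
      - exact: integrableZl.
      by rewrite integral_probability_cst integralZl// Y1 mule0 adde0.
    apply: le_integral => //.
    - under eq_fun do rewrite EFinD EFinM.
      apply: integrableD => //; first exact: finite_measure_integrable_cst.
      exact: integrableZl.
    - apply/integrableP; split; first exact: measurable_fun_expRM.
      under eq_integral do rewrite gee0_abs ?lee_fin ?expR_ge0//.
      by rewrite mgf ltry.
    - by move=> w _; rewrite lee_fin expR_ge1Dx.
  have key2 a : 0 <= a * m + a ^+ 2 * s ^+ 2 / 2.
    by rewrite -ler_expR expR0.
  apply/eqP; rewrite -sqrf_eq0; apply/eqP.
  have [sz|sz] := eqVneq s 0.
    have := key2 (- m); have := sqr_ge0 m; rewrite sz !expr2 => *; nra.
  have s20 : 0 < s ^+ 2 by rewrite exprn_even_gt0.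
  have := key2 (- m / s ^+ 2); rewrite expr_div_n sqrrN.
  have -> : - m / s ^+ 2 * m + m ^+ 2 / (s ^+ 2) ^+ 2 * s ^+ 2 / 2 = - (m ^+ 2 / s ^+ 2 / 2).
    by field.
  rewrite oppr_ge0 pmulr_lle0// pmulr_lle0 ?invr_gt0// => h.
  by apply/eqP; rewrite eq_le h sqr_ge0.
rewrite m0 in law mgf.
have mgf' a : (\int[P]_w (expR (a * Y w))%:E = (expR (a ^+ 2 * s ^+ 2 / 2))%:E)%E.
  by rewrite mgf mulr0 add0r.
have v0 : 0 <= v by rewrite -lee_fin -Y2 integral_ge0// => w _; rewrite lee_fin sqr_ge0.
have mY2 a : measurable_fun setT (fun w => (a * Y w ^+ 2)%:E).
  by apply/measurable_EFinP; apply: measurable_funM => //; exact: measurable_funX.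
have Y2a a : 0 <= a -> (\int[P]_w (a * Y w ^+ 2)%:E = (a * v)%:E)%E.
  move=> a0; under eq_integral do rewrite EFinM.
  rewrite ge0_integralZl//= ?Y2//.
  - by apply/measurable_EFinP; exact: measurable_funX.
  - by move=> w _; rewrite lee_fin sqr_ge0.
have cosh a : (\int[P]_w (expR (a * Y w) + expR (- a * Y w))%:E =
    (2 * expR (a ^+ 2 * s ^+ 2 / 2))%:E)%E.
  under eq_integral do rewrite EFinD.
  rewrite ge0_integralD//=; last 2 first.
  - exact: measurable_fun_expRM.
  - exact: measurable_fun_expRM.
  by rewrite !mgf' sqrrN -EFinD; congr (_%:E); lra.
have mcosh a : measurable_fun setT (fun w => (expR (a * Y w) + expR (- a * Y w))%:E).
  by under eq_fun do rewrite EFinD; apply: emeasurable_funD; exact: measurable_fun_expRM.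
have ccst := integral_probability_cst.
have up a : 2 + a ^+ 2 * v <= 2 * expR (a ^+ 2 * s ^+ 2 / 2).
  rewrite -lee_fin -cosh EFinD -(ccst 2) -Y2a ?sqr_ge0//.
  rewrite -ge0_integralD//=; last first.
    by move=> w _; rewrite lee_fin mulr_ge0 ?sqr_ge0.
  apply: ge0_le_integral => //.
  - by move=> w _; rewrite -EFinD lee_fin addr_ge0// mulr_ge0 ?sqr_ge0.
  - exact: emeasurable_funD.
  - by move=> w _; rewrite -EFinD lee_fin -exprMn mulNr; exact: sqr_le_cosh.
have lo a : 10 * expR (a ^+ 2 * s ^+ 2 / 2) <=
    a ^+ 2 * v + 2 * expR (4 * (a ^+ 2 * s ^+ 2) / 2) + 8.
  have -> : 4 * (a ^+ 2 * s ^+ 2) = (2 * a) ^+ 2 * s ^+ 2 by rewrite !expr2; lra.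
  have -> : 10 * expR (a ^+ 2 * s ^+ 2 / 2) = 5 * (2 * expR (a ^+ 2 * s ^+ 2 / 2)) by lra.
  rewrite -lee_fin 2!EFinD EFinM -cosh -cosh -Y2a ?sqr_ge0// -(ccst 8).
  rewrite -ge0_integralZl//.
  have pos1 w : (0 <= (a ^+ 2 * Y w ^+ 2)%:E)%E by rewrite lee_fin mulr_ge0 ?sqr_ge0.
  have pos2 w : (0 <= (expR (2 * a * Y w) + expR (- (2 * a) * Y w))%:E)%E.
    by rewrite lee_fin addr_ge0 ?expR_ge0.
  rewrite -ge0_integralD// -ge0_integralD//=; last 2 first.
  - by move=> w _; rewrite adde_ge0.
  - exact: emeasurable_funD.
  apply: ge0_le_integral => //.
  - exact: emeasurable_funM.
  - by apply: emeasurable_funD => //; exact: emeasurable_funD.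
  - move=> w _; rewrite -EFinM -!EFinD lee_fin -exprMn !mulNr -mulrA; exact: cosh_le_sqr.
have vs : v = s ^+ 2.
  have s20 := sqr_ge0 s.
  have main e : 0 < e -> e <= 1 -> v <= s ^+ 2 + e /\ s ^+ 2 <= v + e.
    move=> e0 e1.
    pose t := e / (16 * (1 + s ^+ 2) ^+ 2).
    have D1 : 1 <= (1 + s ^+ 2) ^+ 2 by rewrite [(1 + _) ^+ 2]expr2; nra.
    have t0 : 0 < t by rewrite divr_gt0// mulr_gt0// (lt_le_trans ltr01).
    have tE : t * (16 * (1 + s ^+ 2) ^+ 2) = e by rewrite divfK// gt_eqF// mulr_gt0// (lt_le_trans ltr01).
    have ta : (Num.sqrt t) ^+ 2 = t by rewrite sqr_sqrtr// ltW.
    have := up (Num.sqrt t); have := lo (Num.sqrt t); rewrite ta => h1 h2.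
    have ts0 : 0 <= t * s ^+ 2 by rewrite mulr_ge0// ltW.
    have hD : s ^+ 2 <= (1 + s ^+ 2) ^+ 2 /\ (s ^+ 2) ^+ 2 <= (1 + s ^+ 2) ^+ 2.
      by rewrite ![_ ^+ 2 ^+ 2]expr2 ![(1 + _) ^+ 2]expr2; split; nra.
    have ts1 : 16 * (t * s ^+ 2) <= 1.
      apply: le_trans e1; rewrite -tE; have [+ _] := hD.
      by move=> h; rewrite mulrCA ler_pM2l// ler_pM2l.
    have ts2 : 16 * t * (s ^+ 2) ^+ 2 <= e.
      rewrite -tE; have [_ h] := hD.
      by rewrite [16 * t]mulrC -mulrA ler_pM2l// ler_pM2l.
    have e2 := @expR_le_quad R (t * s ^+ 2 / 2) ltac:(lra).
    have e4 := @expR_le_quad R (4 * (t * s ^+ 2) / 2) ltac:(lra).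
    have g2 := expR_ge1Dx (t * s ^+ 2 / 2).
    have q2 : (t * s ^+ 2) ^+ 2 = t * (t * (s ^+ 2) ^+ 2) by rewrite !expr2; lra.
    have q3 : t * (16 * (t * (s ^+ 2) ^+ 2)) <= t * e.
      by rewrite ler_pM2l// mulrA.
    have f1 : (t * s ^+ 2 / 2) ^+ 2 = (t * s ^+ 2) ^+ 2 / 4 by rewrite !expr2; lra.
    have f4 : (4 * (t * s ^+ 2) / 2) ^+ 2 = 4 * (t * s ^+ 2) ^+ 2 by rewrite !expr2; lra.
    rewrite f1 q2 in e2; rewrite f4 q2 in e4.
    have te : 0 < t * e by rewrite mulr_gt0.
    by split; rewrite -(ler_pM2l t0) mulrDr; lra.
  have main' e : 0 < e -> v <= s ^+ 2 + e /\ s ^+ 2 <= v + e.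
    move=> e0; have e'0 : 0 < Num.min e 1 by rewrite lt_min e0 ltr01.
    have e'1 : Num.min e 1 <= 1 by rewrite ge_min lexx orbT.
    have e'e : Num.min e 1 <= e by rewrite ge_min lexx.
    by have [h1 h2] := main _ e'0 e'1; split; lra.
  apply/eqP; rewrite eq_le; apply/andP; split; apply/ler_addgt0Pr => e e0.
    by have [] := main' e e0.
  by have [] := main' e e0.
rewrite vs; split=> [|E mE]; first exact: sqr_ge0.
by rewrite sqrtr_sqr (ger0_norm s0); exact: law.
Qed.

Lemma centered_gaussian_mgf (Y : Omega -> R) (v a : R) : measurable_fun setT Y ->
  gaussian_law P Y -> (\int[P]_w (Y w)%:E = 0)%E -> (\int[P]_w (Y w ^+ 2)%:E = v%:E)%E ->
  (\int[P]_w (expR (a * Y w))%:E = (expR (a ^+ 2 * v / 2))%:E)%E.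
Proof.
move=> mY gY Y1 Y2; have [v0 law] := centered_gaussian_law mY gY Y1 Y2.
by rewrite (gaussian_mgf mY law) mulr0 add0r sqr_sqrtr.
Qed.

Lemma centered_gaussian_exp_abs (Y : Omega -> R) (v a : R) : measurable_fun setT Y ->
  gaussian_law P Y -> (\int[P]_w (Y w)%:E = 0)%E -> (\int[P]_w (Y w ^+ 2)%:E = v%:E)%E ->
  0 <= a -> (\int[P]_w (expR (a * `|Y w|))%:E <= (2 * expR (a ^+ 2 * v / 2))%:E)%E.
Proof.
move=> mY gY Y1 Y2 a0.
have -> : ((2 * expR (a ^+ 2 * v / 2))%:E =
   \int[P]_w ((expR (a * Y w))%:E + (expR (- a * Y w))%:E))%E.
  rewrite ge0_integralD//=; last 2 first.
  - exact: measurable_fun_expRM.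
  - exact: measurable_fun_expRM.
  rewrite !(centered_gaussian_mgf _ mY gY Y1 Y2) sqrrN -EFinD; congr (_%:E); lra.
apply: ge0_le_integral => //.
- by apply: measurable_fun_expRM; exact: measurableT_comp.
- by apply: emeasurable_funD; exact: measurable_fun_expRM.
- move=> w _; rewrite -EFinD lee_fin; have [y0|y0] := leP 0 (Y w).
    by rewrite ger0_norm// lerDl expR_ge0.
  by rewrite ltr0_norm// mulrN mulNr lerDr expR_ge0.
Qed.

End centered_gaussian.

Section expectation_tools.
Context {d : measure_display} {Omega : measurableType d} {R : realType}.
Variable P : probability Omega R.

Lemma ge0_le_expectation (f g : Omega -> \bar R) :
  measurable_fun setT f -> measurable_fun setT g ->
  (forall w, 0 <= f w)%E -> (forall w, f w <= g w)%E ->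
  (\int[P]_w f w <= \int[P]_w g w)%E.
Proof.
move=> mf mg f0 fg; apply: ge0_le_integral => //.
Qed.

Lemma markov_real (A : set Omega) (f : Omega -> R) (c : R) : 0 < c ->
  measurable A -> measurable_fun setT f -> (forall w, 0 <= f w) ->
  (forall w, A w -> c <= f w) ->
  (P A <= c^-1%:E * \int[P]_w (f w)%:E)%E.
Proof.
move=> c0 mA mf f0 Af.
have mEf : measurable_fun setT (EFin \o f) by exact/measurable_EFinP.
have -> : (P A = \int[P]_w (\1_A w)%:E)%E by rewrite integral_indic// setIT.
rewrite -ge0_integralZl//; last by rewrite lee_fin invr_ge0 ltW.
apply: ge0_le_expectation.
- by apply/measurable_EFinP; exact: measurable_indic.
- by apply: emeasurable_funM.
- by move=> w; rewrite lee_fin.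
- move=> w; rewrite -EFinM lee_fin indicE; have [/set_mem wA|] := boolP (w \in A).
    by rewrite ler_pdivlMl// mulr1; exact: Af.
  by rewrite mulr_ge0// invr_ge0 ltW.
by move=> x _; rewrite lee_fin.
Qed.

End expectation_tools.

Section fbm.
Context {d : measure_display} {Omega : measurableType d} {R : realType}.
Variables (P : probability Omega R) (T H : R) (B : R -> {RV P >-> R}).
Hypotheses (T0 : 0 < T) (H01 : 1 / 2 < H < 1).
Hypothesis hB : fractional_brownian_motion T H B.

Lemma fbm_covxx (s : R) : fbm_cov H s s = s `^ (2 * H).
Proof.
rewrite /fbm_cov subrr normr0 powR0 ?subr0; first by lra.
by case/andP : H01 => h1 h2; rewrite gt_eqF//; lra.
Qed.

Lemma fbm_prod_integrable (s t : R) : s \in `[0, T] -> t \in `[0, T] ->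
  P.-integrable setT (fun w => (B s w * B t w)%:E).
Proof.
move=> sT tT; case: hB => _ _ cov _.
have sq u : u \in `[0, T] -> P.-integrable setT (fun w => (B u w * B u w)%:E).
  move=> uT; apply/integrableP; split.
    by apply/measurable_EFinP; exact: measurable_funM.
  under eq_integral do rewrite gee0_abs ?lee_fin -?expr2 ?sqr_ge0//.
  have := cov u u uT uT; rewrite unlock => h.
  by under eq_integral do rewrite expr2; rewrite h ltry.
apply: (@le_integrable _ _ _ P _ measurableT _
    (fun w => ((B s w * B s w)%:E + (B t w * B t w)%:E)%E)).
- by apply/measurable_EFinP; exact: measurable_funM.
- move=> w _; rewrite -EFinD /= lee_fin [leRHS]ger0_norm; last first.
    by apply: addr_ge0; rewrite -expr2 sqr_ge0.
  rewrite normrM -[B s w * B s w]expr2 -[B t w * B t w]expr2.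
  rewrite -(real_normK (num_real (B s w))) -(real_normK (num_real (B t w))).
  set x := `|B s w|; set y := `|B t w|; have := sqr_ge0 (x - y).
  have : 0 <= x by exact: normr_ge0.
  have : 0 <= y by exact: normr_ge0.
  rewrite !expr2 => *; nra.
- by apply: integrableD => //; exact: sq.
Qed.

Lemma fbm_prod (s t : R) : s \in `[0, T] -> t \in `[0, T] ->
  (\int[P]_w (B s w * B t w)%:E = (fbm_cov H s t)%:E)%E.
Proof. by move=> sT tT; case: hB => _ _ cov _; have := cov s t sT tT; rewrite unlock. Qed.

Lemma fbm_integrable (s : R) : s \in `[0, T] -> P.-integrable setT (EFin \o B s).
Proof.
move=> sT; apply: integrable_sqr => //; under eq_integral do rewrite expr2.
by rewrite fbm_prod// ltry.
Qed.

Lemma fbm_mean (s : R) : s \in `[0, T] -> (\int[P]_w (B s w)%:E = 0)%E.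
Proof. by move=> sT; case: hB => _ m _ _; have := m s sT; rewrite unlock. Qed.

Definition fbm_comb (a c s t : R) (w : Omega) : R := a * B s w + c * B t w.

Lemma measurable_fbm_comb a c s t : measurable_fun setT (fbm_comb a c s t).
Proof. by apply: measurable_funD; exact: measurable_funM. Qed.

Lemma fbm_comb_gaussian a c s t : s \in `[0, T] -> t \in `[0, T] ->
  gaussian_law P (fbm_comb a c s t).
Proof.
move=> sT tT; case: hB => gB _ _ _.
have := gB 2%N (fun i : 'I_2 => if i == ord0 then s else t)
               (fun i : 'I_2 => if i == ord0 then a else c).
have -> : (fun w => \sum_(i < 2) (if i == ord0 then a else c) *
    B (if i == ord0 then s else t) w) = fbm_comb a c s t.
  by apply/funext => w; rewrite !big_ord_recl big_ord0 /= addr0.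
by apply => i; case: ifP.
Qed.

Lemma fbm_comb_mean a c s t : s \in `[0, T] -> t \in `[0, T] ->
  (\int[P]_w (fbm_comb a c s t w)%:E = 0)%E.
Proof.
move=> sT tT; rewrite /fbm_comb; under eq_integral do rewrite EFinD !EFinM.
rewrite integralD//=; last 2 first.
- by apply: integrableZl => //; exact: fbm_integrable.
- by apply: integrableZl => //; exact: fbm_integrable.
rewrite !integralZl//; try exact: fbm_integrable.
by rewrite !fbm_mean// !mule0 adde0.
Qed.

Lemma fbm_comb_sqr a c s t : s \in `[0, T] -> t \in `[0, T] ->
  (\int[P]_w (fbm_comb a c s t w ^+ 2)%:E =
   (a ^+ 2 * fbm_cov H s s + 2 * a * c * fbm_cov H s t + c ^+ 2 * fbm_cov H t t)%:E)%E.
Proof.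
move=> sT tT; rewrite /fbm_comb.
have E w : (((a * B s w + c * B t w) ^+ 2)%:E = (a ^+ 2)%:E * (B s w * B s w)%:E +
    (2 * a * c)%:E * (B s w * B t w)%:E + (c ^+ 2)%:E * (B t w * B t w)%:E)%E.
  by rewrite -!EFinM -!EFinD; congr (_%:E); rewrite !expr2; lra.
under eq_integral do rewrite E.
have i u v k : u \in `[0, T] -> v \in `[0, T] ->
    P.-integrable setT (fun w => (k%:E * (B u w * B v w)%:E)%E).
  by move=> *; apply: integrableZl => //; exact: fbm_prod_integrable.
rewrite integralD//=; [|by apply: integrableD => //; exact: i|exact: i].
rewrite integralD//=; [|exact: i|exact: i].
rewrite !integralZl//; try exact: fbm_prod_integrable.
by rewrite !fbm_prod// -!EFinM -!EFinD.
Qed.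

Lemma fbm_incr_sqr s t : s \in `[0, T] -> t \in `[0, T] ->
  (\int[P]_w (fbm_comb 1 (-1) s t w ^+ 2)%:E = (`|s - t| `^ (2 * H))%:E)%E.
Proof.
move=> sT tT; rewrite fbm_comb_sqr// !fbm_covxx /fbm_cov distrC; congr (_%:E); lra.
Qed.

Lemma fbm_exp_abs (s a : R) : s \in `[0, T] -> 0 <= a ->
  (\int[P]_w (expR (a * `|B s w|))%:E <= (2 * expR (a ^+ 2 * T `^ (2 * H) / 2))%:E)%E.
Proof.
move=> sT a0.
have E : fbm_comb 1 0 s s = B s.
  by apply/funext => w; rewrite /fbm_comb mul1r mul0r addr0.
have := centered_gaussian_exp_abs (measurable_fbm_comb 1 0 s s)
  (fbm_comb_gaussian 1 0 sT sT) (fbm_comb_mean 1 0 sT sT) (fbm_comb_sqr 1 0 sT sT) a0.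
rewrite E => /le_trans; apply; rewrite lee_fin ler_pM2l// ler_expR.
have sI : 0 <= s <= T by move: sT; rewrite in_itv.
have HH : 1 / 2 < H < 1 by [].
have : s `^ (2 * H) <= T `^ (2 * H) by apply: le_powRl; lra.
rewrite fbm_covxx expr1n expr0n/= !mulr0 !mul0r !addr0 mul1r => h.
by rewrite ler_pM2r ?invr_gt0//; apply: ler_wpM2l => //; exact: sqr_ge0.
Qed.

Lemma fbm_start : {ae P, forall w, B 0 w = 0}.
Proof.
have oT : 0 \in `[0, T] by rewrite in_itv/= lexx ltW.
have m2 : measurable_fun setT (fun w => (B 0 w * B 0 w)%:E).
  by apply/measurable_EFinP; exact: measurable_funM.
have := fbm_prod oT oT; rewrite fbm_covxx powR0; last first.
  by case/andP : H01 => h1 h2; rewrite gt_eqF//; lra.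
move=> h.
have : (\int[P]_w `|(B 0 w * B 0 w)%:E| = 0)%E.
  rewrite -[RHS]h; apply: eq_integral => w _.
  by rewrite gee0_abs// lee_fin -expr2 sqr_ge0.
move/(ae_eq_integral_abs P measurableT m2); apply: filterS => w /(_ I).
by move=> /= [] /eqP; rewrite mulf_eq0 orbb => /eqP.
Qed.

End fbm.

Section fbm_paths.
Context {d : measure_display} {Omega : measurableType d} {R : realType}.
Variables (P : probability Omega R) (T H : R) (B : R -> {RV P >-> R}).
Hypotheses (T0 : 0 < T) (H01 : 1 / 2 < H < 1).
Hypothesis hB : fractional_brownian_motion T H B.

Lemma fbm_incr_tail (s t sd l : R) (k : nat) : s \in `[0, T] -> t \in `[0, T] ->
  0 < sd -> 0 < l -> (0 < k)%N -> `|s - t| `^ (2 * H) <= sd ^+ 2 ->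
  (P [set w | (l <= `|B s w - B t w|)%R] <= (2 * expR 2^-1 * (k%:R * sd / l) ^+ k)%:E)%E.
Proof.
move=> sT tT sd0 l0 k0 st.
have k0' : 0 < k%:R :> R by rewrite ltr0n.
have E w : fbm_comb B 1 (-1) s t w = B s w - B t w.
  by rewrite /fbm_comb mul1r mulN1r.
have mD : measurable_fun setT (fun w => B s w - B t w) by exact: measurable_funB.
have mN : measurable_fun setT (fun w => `|B s w - B t w|) by exact: measurableT_comp.
have := @markov_real _ _ _ P [set w | l <= `|B s w - B t w|]
  (fun w => expR (sd^-1 * `|B s w - B t w|)) ((l / (k%:R * sd)) ^+ k).
move/(_ _ _ _ _ _)/le_trans; apply.
- by rewrite exprn_gt0// divr_gt0// mulr_gt0.
- by rewrite -[X in measurable X]setTI; apply: measurable_fun_le => //.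
- by apply: measurableT_comp => //; exact: measurable_funM.
- by move=> w; exact: expR_ge0.
- move=> w lw; have -> : sd^-1 * `|B s w - B t w| = k%:R * (`|B s w - B t w| / (k%:R * sd)).
    by field; rewrite !gt_eqF.
  rewrite expRM_natl; apply: lerXn2r; rewrite ?nnegrE ?expR_ge0//.
    by rewrite divr_ge0 ?mulr_ge0// ltW.
  apply: (@le_trans _ _ (`|B s w - B t w| / (k%:R * sd))).
    by rewrite ler_pM2r// invr_gt0 mulr_gt0.
  by apply: le_trans (expR_ge1Dx _); rewrite lerDr.
have := centered_gaussian_exp_abs (measurable_fbm_comb B 1 (-1) s t)
  (fbm_comb_gaussian hB 1 (-1) sT tT) (fbm_comb_mean hB 1 (-1) sT tT)
  (fbm_incr_sqr H01 hB sT tT) (a := sd^-1).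
rewrite invr_ge0 ltW// => /(_ isT).
under eq_integral do rewrite E.
move=> h; apply: le_trans (lee_wpmul2l _ h) _.
  by rewrite lee_fin invr_ge0 exprn_ge0// divr_ge0 ?mulr_ge0// ltW.
rewrite -EFinM lee_fin.
have -> : ((l / (k%:R * sd)) ^+ k)^-1 = (k%:R * sd / l) ^+ k by rewrite -exprVn invf_div.
rewrite mulrC; apply: ler_wpM2r.
  by rewrite exprn_ge0// divr_ge0 ?mulr_ge0// ltW.
rewrite ler_pM2l// ler_expR -[leRHS]mul1r; apply: ler_wpM2r; first by rewrite invr_ge0.
by rewrite exprVn ler_pdivrMl ?exprn_gt0// mulr1.
Qed.

Lemma fbm_dyadic_incr (beta : R) : 0 < beta -> beta < H ->
  {ae P, forall w, exists n0, forall n i, (n0 <= n)%N -> (i < 2 ^ n)%N ->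
    `|B (dyadic T n i.+1) w - B (dyadic T n i) w| <= (2^-1 `^ beta) ^+ n}.
Proof.
move=> b0 bH; have HH := H01.
have [k k0 kH] : exists2 k, (0 < k)%N & 2 <= (H - beta) * k%:R.
  have Hb : 0 < H - beta by rewrite subr_gt0.
  exists (Num.truncn (2 / (H - beta))).+1 => //.
  rewrite mulrC -ler_pdivrMr//; exact: ltW (truncnS_gt _).
pose E n i := [set w | (2^-1 `^ beta) ^+ n <= `|B (dyadic T n i.+1) w - B (dyadic T n i) w|].
pose F n := \big[setU/set0]_(i < 2 ^ n) E n i.
pose C := 2 * expR 2^-1 * (k%:R * T `^ H) ^+ k.
have C0 : 0 <= C.
  by rewrite /C; nonneg; apply: exprn_ge0; nonneg; rewrite ler0n.
have mE n i : measurable (E n i).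
  rewrite -[X in measurable X]setTI; apply: measurable_fun_le => //.
  by apply: measurableT_comp => //; exact: measurable_funB.
have mF n : measurable (F n) by apply: bigsetU_measurable => i _; exact: mE.
have i2 : 0 <= 2^-1 :> R by rewrite invr_ge0.
have dT n i : (i <= 2 ^ n)%N -> dyadic T n i \in `[0, T].
  move=> h; rewrite in_itv/= /dyadic; apply/andP; split.
    by rewrite !mulr_ge0// ?exprn_ge0// ltW.
  rewrite mulrA -[leRHS]mul1r; apply: ler_wpM2r; first exact: ltW.
  by rewrite exprVn ler_pdivrMr ?exprn_gt0// mul1r -natrX ler_nat.
have PE n i : (i < 2 ^ n)%N -> (P (E n i) <= (C * (4^-1) ^+ n)%:E)%E.
  move=> h; pose sd := (2^-1 ^+ n * T) `^ H.
  have m0 : 0 < 2^-1 ^+ n * T by rewrite mulr_gt0// exprn_gt0// invr_gt0.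
  have sd0 : 0 < sd by rewrite powR_gt0.
  have l0 : 0 < (2^-1 `^ beta) ^+ n :> R by rewrite exprn_gt0// powR_gt0// invr_gt0.
  have := fbm_incr_tail (dT n _ h) (dT n _ (ltnW h)) sd0 l0 k0.
  have -> : `|dyadic T n i.+1 - dyadic T n i| `^ (2 * H) = sd ^+ 2.
    have -> : dyadic T n i.+1 - dyadic T n i = 2^-1 ^+ n * T.
      by rewrite /dyadic -natr1; ring.
    rewrite gtr0_norm// /sd.
    by rewrite -powR_mulrn ?powR_ge0// -powRrM [2 * H]mulrC.
  rewrite lexx => /(_ isT)/le_trans; apply; rewrite lee_fin /C -[leRHS]mulrA.
  apply: ler_wpM2l; first by nonneg.
  have -> : k%:R * sd / (2^-1 `^ beta) ^+ n = k%:R * T `^ H * (2^-1 `^ (H - beta)) ^+ n.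
    rewrite /sd powRM ?exprn_ge0//; last exact: ltW.
    rewrite exprn_powR ?invr_ge0 ?ler0n//.
    rewrite powRB; last by apply/implyP => _; rewrite invr_eq0 pnatr_eq0.
    by rewrite expr_div_n; lra.
  rewrite exprMn; apply: ler_wpM2l; first by apply: exprn_ge0; nonneg; rewrite ler0n.
  rewrite exprAC; apply: lerXn2r; rewrite ?nnegrE ?exprn_ge0 ?powR_ge0//.
  rewrite -powR_mulrn ?powR_ge0// -powRrM.
  have -> : 4^-1 = 2^-1 `^ 2 :> R by rewrite powR_mulrn// expr2; lra.
  by apply: ger_powR => //; apply/andP; split; lra.
have PF n : (P (F n) <= (2 * C / (2 ^ (n + 1))%:R)%:E)%E.
  apply: (@le_trans _ _ (\sum_(i < 2 ^ n) P (E n i))%E).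
    by apply: Boole_inequality => i _; exact: mE.
  apply: (@le_trans _ _ (\sum_(i < 2 ^ n) (C * (4^-1) ^+ n)%:E)%E).
    by apply: lee_sum => i _; exact: PE.
  rewrite sumEFin lee_fin sumr_const card_ord -[leLHS]mulr_natr.
  rewrite le_eqVlt; apply/orP; left; apply/eqP.
  rewrite addn1 expnS natrM natrX.
  have -> : 4^-1 ^+ n = (2 ^+ n)^-1 * (2 ^+ n)^-1 :> R.
    by rewrite -invfM -expr2 -exprM mulnC exprM -exprVn; congr (_^-1 ^+ _); rewrite expr2; lra.
  by field; rewrite expf_neq0.
have lim0 : P (lim_sup_set F) = 0%E.
  apply: lim_sup_set_cvg0 => //.
  apply: (@le_lt_trans _ _ (\sum_(0 <= n <oo) (2 * C / (2 ^ (n + 1))%:R)%:E)%E).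
    apply: lee_nneseries => n _ *; [exact: measure_ge0|exact: PF].
  by rewrite (cvg_lim _ (@cvg_geometric_eseries_half R (2 * C) 0))// ltry.
have mL : measurable (lim_sup_set F).
  by apply: bigcap_measurable => // n _; exact: bigcup_measurable.
exists (lim_sup_set F); split => // w /= nw.
apply: contrapT => nL; apply: nw.
have [n0 hn0] : exists n0, forall n, (n0 <= n)%N -> ~ F n w.
  apply: contrapT => h; apply: nL => n _ /=.
  apply: contrapT => h2; apply: h; exists n => m nm Fm; apply: h2.
  by exists m.
exists n0 => n i n0n hi; rewrite leNgt; apply/negP => /ltW h.
by apply: (hn0 n n0n); rewrite /F -bigcup_mkord; exists i.
Qed.

Lemma fbm_hoelder (beta : R) : 0 < beta -> beta < H ->
  {ae P, forall w, exists C, forall s t, 0 <= s <= T -> 0 <= t <= T ->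
    `|B s w - B t w| <= C * `|s - t| `^ beta}.
Proof.
move=> b0 bH; case: (hB) => _ _ _ cB.
move: (fbm_dyadic_incr b0 bH) cB; apply: filterS2 => w [n0 h] cw.
apply: (@dyadic_chaining R T (2^-1 `^ beta) n0 (fun t => B t w) T0) => //.
exact: halfpow_lt1.
Qed.

End fbm_paths.

Section outer.
Context {d : measure_display} {Omega : measurableType d} {R : realType}.
Variable P : probability Omega R.

Lemma cvge0_lt (S : Type) (F : set_system S) (FF : Filter F) (f : S -> \bar R) (e : R) :
  (f x @[x --> F] --> 0)%E -> 0 < e -> \forall x \near F, (f x < e%:E)%E.
Proof.
move=> f0 e0; apply: (f0 [set y | (y < e%:E)%E]).
have : \forall r \near (0 : R), (r%:E < e%:E)%E.
  by near do rewrite lte_fin; exact: lt_nbhsl.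
by [].
Unshelve. all: by end_near. Qed.

Lemma mu_ext_negligible (A : set Omega) :
  (forall e : R, 0 < e -> (mu_ext P A < e%:E)%E) -> P.-negligible A.
Proof.
move=> Ae.
have cover n : exists U, [/\ measurable U, A `<=` U & (P U <= (n.+1%:R^-1)%:E)%E].
  have /ereal_inf_lt[_ [/= F [mF AF] <-] lt] := Ae n.+1%:R^-1 ltac:(by rewrite invr_gt0).
  exists (\bigcup_k F k); split => //; first exact: bigcup_measurable.
  apply: le_trans (ltW lt).
  by apply: measure_sigma_subadditive => //; exact: bigcup_measurable.
have [U hU] := choice cover.
exists (\bigcap_n U n); split.
- by apply: bigcap_measurable => // n _; by have [] := hU n.
- apply/eqP; rewrite eq_le measure_ge0 andbT; apply/lee_addgt0Pr => e e0.
  rewrite add0e; have [n hn] : exists n, n.+1%:R^-1 < e :> R.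
    have [n _ hn] := near_infty_natSinv_lt (PosNum e0).
    by exists n; exact: hn (leqnn n).
  apply: (@le_trans _ _ (P (U n))).
    apply: le_measure; rewrite ?inE.
    - by apply: bigcap_measurable => // m _; by have [] := hU m.
    - by have [] := hU n.
    - exact: bigcap_inf.
  by have [_ _ h] := hU n; apply: le_trans h _; rewrite lee_fin ltW.
- by move=> w Aw n _; by have [_ + _] := hU n; exact.
Qed.

(* Along which [eps] the approximation is good depends on the path; this suffices
   since the pathwise estimates are uniform in [eps]. *)
Lemma ucp_cvg_path (T : R) (Ze : R -> R -> Omega -> R) (Z : R -> Omega -> R) :
  ucp_cvg P T Ze Z ->
  {ae P, forall w, forall delta e : R, 0 < delta -> 0 < e ->
    exists2 eps, 0 < eps < e & forall t, 0 <= t <= T -> `|Ze eps t w - Z t w| < delta}.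
Proof.
move=> cvgZ.
pose bad (delta eps : R) :=
  [set w | exists2 t : R, t \in `[0, T] & delta <= `|Ze eps t w - Z t w|].
pose N (k n : nat) : set Omega :=
  [set w | forall eps, 0 < eps < n.+1%:R^-1 -> bad k.+1%:R^-1 eps w].
have negN k n : P.-negligible (N k n).
  apply: mu_ext_negligible => e e0.
  have k0 : 0 < k.+1%:R^-1 :> R by rewrite invr_gt0.
  have n0 : 0 < n.+1%:R^-1 :> R by rewrite invr_gt0.
  have /(_ _ k0) := cvgZ; rewrite -/(bad _) => h.
  have h1 : \forall eps \near (0 : R)^'+, (mu_ext P (bad (k.+1%:R^-1)%R eps) < e%:E)%E.
    exact: cvge0_lt h e0.
  have h2 : \forall eps \near (0 : R)^'+, 0 < eps < n.+1%:R^-1.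
    by near=> eps; apply/andP; split; near: eps; [exact: nbhs_right_gt|exact: nbhs_right_lt].
  have [eps [/= lt epsn]] := @filter_ex _ _ (at_right_proper_filter (0 : R)) _ (filterI h1 h2).
  apply: le_lt_trans lt; apply: le_mu_ext => w; exact.
have neg : P.-negligible (\bigcup_k \bigcup_n N k n).
  by apply: negligible_bigcup => k; exact: negligible_bigcup.
apply: negligibleS neg => w /= nw; apply: contrapT => notN; apply: nw => delta e d0 e0.
have [k hk] : exists k, k.+1%:R^-1 < delta :> R.
  have [n _ hn] := near_infty_natSinv_lt (PosNum d0).
  by exists n; exact: hn (leqnn n).
have [n hn] : exists n, n.+1%:R^-1 < e :> R.
  have [m _ hm] := near_infty_natSinv_lt (PosNum e0).
  by exists m; exact: hm (leqnn m).
have : ~ forall eps, 0 < eps < n.+1%:R^-1 -> bad k.+1%:R^-1 eps w.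
  by move=> h; apply: notN; exists k => //; exists n.
move=> /existsNP[eps /not_implyP[/andP[eps0 epsn] nb]].
exists eps; first by rewrite eps0 (lt_trans epsn).
move=> t tT; rewrite ltNge; apply/negP => h; apply: nb; exists t; first by rewrite in_itv.
exact: le_trans (ltW hk) h.
Unshelve. all: by end_near. Qed.

End outer.

Lemma Cb_lipschitz (R : realType) (n : nat) (f : R -> R) : Cb n.+1 f ->
  exists K, forall x y, `|f x - f y| <= K * `|x - y|.
Proof.
move=> [df _ /(_ 1%N isT)[K fK]]; exists K => x y.
have fd (z : R) : is_derive z 1 f (f^`()%classic z).
  by rewrite derive1E; apply/derivableP; exact: (df 0%N z isT).
have [c _ ->] := MVT_between (a := y) (b := x) (fun z _ => fd z).
by rewrite normrM; apply: ler_wpM2r => //; exact: fK.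
Qed.

Section solution_paths.
Context {d : measure_display} {Omega : measurableType d} {R : realType}.
Variables (P : probability Omega R) (T H x0 r K : R) (sigma b : R -> R).
Variables (B X : R -> {RV P >-> R}).
Hypotheses (T0 : 0 < T) (H01 : 1 / 2 < H < 1).
Hypothesis hB : fractional_brownian_motion T H B.
Hypothesis sigma_lip : forall x y, `|sigma x - sigma y| <= K * `|x - y|.
Hypothesis hX : sde_solution T H x0 sigma b B X.
Hypothesis b_sigma : forall x, b x = r * sigma x.

Lemma solution_path : {ae P, forall w,
  (sigma x0 != 0 -> forall t, 0 <= t <= T ->
    (forall z, between x0 (X t w) z -> sigma z != 0) /\
    signed_integral (fun z => (sigma z)^-1) x0 (X t w) = B t w + r * t) /\
  (sigma x0 = 0 -> forall t, 0 <= t <= T -> X t w = x0)}.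
Proof.
case: hX => [[alpha Ha hXa] [I [_ ucpI] solI]]; have HH := H01.
pose beta := (Num.max (1 - alpha) (1 / 2) + H) / 2.
have [b12 [b1 [bH ab]]] : 2^-1 < beta /\ beta < 1 /\ beta < H /\ 1 < alpha + beta.
  by rewrite /beta; case: (leP (1 - alpha) (1 / 2)) => h; split; try split; try split; lra.
have b0 : 0 < beta by lra.
have a0 : 0 < alpha by lra.
have pathI := ucp_cvg_path ucpI.
have pathB := fbm_hoelder T0 H01 hB b0 bH.
have B0 := fbm_start T0 H01 hB.
apply: (filterS _ (filterI (filterI hXa solI) (filterI (filterI pathI pathB) B0))) => w.
move=> [[[Cx hx] hs] [[hI [Cy hy]] hb]].
have hx' s t : 0 <= s <= T -> 0 <= t <= T -> `|X s w - X t w| <= Cx * `|s - t| `^ alpha.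
  by move=> sT tT; apply: hx; rewrite in_itv.
have hs' t : 0 <= t <= T -> X t w = x0 + I t w +
    \int[lebesgue_measure]_(s in `[0, t]) (r * sigma (X s w)).
  move=> tT; rewrite hs ?in_itv//; congr (_ + _).
  by apply: eq_Rintegral => s _; rewrite b_sigma.
have sc : continuous sigma := lipschitz_continuous sigma_lip.
split=> s0 t tT.
  have := sde_path_scale sigma_lip T0 a0 ab b12 b1 hx' hy hI hs' hb s0
    (@is_scale_signed_integral R sigma x0 sc) tT.
  have -> : signed_integral (fun z => (sigma z)^-1) x0 x0 = 0.
    by rewrite /signed_integral lexx set_itv1 Rintegral_set1.
  by rewrite subr0.
exact: (sde_path_constant sigma_lip T0 a0 ab b12 b1 hx' hy hI hs' s0 tT).
Qed.

End solution_paths.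

(** * Conditional expectation given the present *)

Section conditioning.
Context {d : measure_display} {Omega : measurableType d} {R : realType}.
Variable P : probability Omega R.
Variables (X Y : Omega -> R).
Hypotheses (mX : measurable_fun setT X) (iY : P.-integrable setT (EFin \o Y)).

Let mY : measurable_fun setT Y.
Proof. by apply/measurable_EFinP; exact: measurable_int iY. Qed.

Let mXpre (A : set R) : measurable A -> measurable (X @^-1` A).
Proof. by move=> mA; rewrite -[X in measurable X]setTI; exact: mX. Qed.

Lemma integral_preimage_indic (A : set R) :
  (\int[P]_(w in X @^-1` A) (Y w)%:E = \int[P]_w (\1_A (X w) * Y w)%:E)%E.
Proof.
rewrite integral_mkcond epatch_indic; apply: eq_integral => w _.
by rewrite /= muleC EFinM; congr (_%:E * _)%E; rewrite !indicE.
Qed.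

Lemma measurable_indic_comp (A : set R) : measurable A ->
  measurable_fun setT (fun w => \1_A (X w) : R).
Proof.
move=> mA; have h : measurable_fun setT (\1_A : R -> R) by exact: measurable_indic.
exact: (measurableT_comp h mX).
Qed.

Lemma integrable_indic_mul (A : set R) : measurable A ->
  P.-integrable setT (fun w => (\1_A (X w) * Y w)%:E).
Proof.
move=> mA; apply: (le_integrable measurableT _ _ iY).
  by apply/measurable_EFinP; apply: measurable_funM => //; exact: measurable_indic_comp.
move=> w _; rewrite /= lee_fin normrM; apply: ler_piMl => //.
by rewrite indicE; case: (_ \in _); rewrite ?normr1 ?normr0.
Qed.

Lemma rays_orthogonal : (\int[P]_w (Y w)%:E = 0)%E ->
  (forall c, \int[P]_w (\1_(`]c, +oo[%classic) (X w) * Y w)%:E = 0)%E ->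
  forall A : set R, measurable A -> (\int[P]_w (\1_A (X w) * Y w)%:E = 0)%E.
Proof.
move=> Y0 rays A mA.
have setform (B : set R) : (\int[P]_w (\1_B (X w) * Y w)%:E = 0)%E <->
    (\int[P]_(w in X @^-1` B) (Y w)%:E = 0)%E by rewrite integral_preimage_indic.
have iYS (B : set Omega) : measurable B -> P.-integrable B (EFin \o Y).
  by move=> mB; exact: integrableS iY.
have mG : (@measurable _ R) = <<s @RGenOInfty.G R >> by exact: RGenOInfty.measurableE.
have mA' : <<s @RGenOInfty.G R >> A by rewrite -mG.
move: A mA' {mA}; apply: (dynkin_induction (P := fun A => \int[P]_w (\1_A (X w) * Y w)%:E = 0)%E mG).
- move=> A B [x ->] [y ->]; exists (Num.max x y); apply/seteqP; split => z /=;
    rewrite !in_itv/= !andbT gt_max; [by move=> [-> ->]|by move=> /andP[]].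
- by under eq_integral do rewrite indicT mul1r.
- by move=> A [x ->]; exact: rays.
- move=> S mS S0; have -> : (\int[P]_w (\1_(~` S) (X w) * Y w)%:E =
      \int[P]_w ((Y w)%:E - (\1_S (X w) * Y w)%:E))%E.
    apply: eq_integral => w _; rewrite -EFinB; congr (_%:E).
    by rewrite indicC !indicE /=; case: (X w \in S); rewrite /=; lra.
  by rewrite integralB//= ?Y0 ?S0 ?sube0//; exact: integrable_indic_mul.
- move=> F mF tF F0; apply/setform; rewrite preimage_bigcup integral_bigcup//.
  + by apply: eseries0 => n _ _; apply/setform.
  + apply/trivIsetP => i j _ _ ij; rewrite -preimage_setI.
    by move/trivIsetP : tF => /(_ i j I I ij) ->; rewrite preimage_set0.
  + by move=> n; exact: mXpre.
  + by apply: iYS; apply: bigcup_measurable => n _; exact: mXpre.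
Qed.

Import HBNNSimple.

Lemma fun_orthogonal (g : R -> R) :
  (forall A : set R, measurable A -> (\int[P]_w (\1_A (X w) * Y w)%:E = 0)%E) ->
  measurable_fun setT g -> P.-integrable setT (fun w => (g (X w) * Y w)%:E) ->
  (\int[P]_w (g (X w) * Y w)%:E = 0)%E.
Proof.
move=> orth.
have pos (h : R -> R) : (forall x, 0 <= h x) -> measurable_fun setT h ->
    P.-integrable setT (fun w => (h (X w) * Y w)%:E) ->
    (\int[P]_w (h (X w) * Y w)%:E = 0)%E.
  move=> h0 mh ih; have mEh : measurable_fun setT (EFin \o h) by exact/measurable_EFinP.
  have h0' x : setT x -> (0 <= (EFin \o h) x)%E by move=> _; rewrite lee_fin.
  pose a := nnsfun_approx measurableT mEh.
  have an0 n : (\int[P]_w (a n (X w) * Y w)%:E = 0)%E.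
    have E w : ((a n (X w) * Y w)%:E = \sum_(y <- finmap.enum_fset (fset_set (range (a n))))
        (y%:E * (\1_(a n @^-1` [set y]) (X w) * Y w)%:E))%E.
      rewrite (fimfunE (a n) (X w)) fsbig_finite//= mulr_suml -sumEFin.
      by apply: eq_bigr => y _; rewrite -EFinM mulrA.
    under eq_integral do rewrite E.
    have mS y : measurable (a n @^-1` [set y]).
      by rewrite -[X in measurable X]setTI; exact: (measurable_funP (a n)).
    rewrite integral_sum//; last first.
      by move=> y; apply: integrableZl => //; exact: integrable_indic_mul.
    rewrite big1// => y _; rewrite integralZl//; last exact: integrable_indic_mul.
    by rewrite orth// mule0.
  have [||||| _ _] := @dominated_convergence _ _ _ P setT measurableT
    (fun n w => (a n (X w) * Y w)%:E) (fun w => (h (X w) * Y w)%:E)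
    (fun w => `|(h (X w) * Y w)%:E|%E).
  - move=> n; apply/measurable_EFinP; apply: measurable_funM => //.
    by apply: measurableT_comp.
  - exact: measurable_int ih.
  - apply: aeW => w _; have := cvg_nnsfun_approx measurableT mEh h0' (x := X w) I.
    rewrite EFinM => hc; under eq_fun do rewrite EFinM.
    by apply: cvgeM => //; exact: cvg_cst.
  - exact: integrable_abse.
  - apply: aeW => w n _; rewrite !EFinM !abseM; apply: lee_wpmul2r => //.
    rewrite !gee0_abs ?lee_fin//.
    have hc := cvg_nnsfun_approx measurableT mEh h0' (x := X w) I.
    apply: (cvge_to_ge (b := (a n (X w))%:E) hc); exists n => // k /= nk; rewrite lee_fin.
    by have /lefP := nd_nnsfun_approx measurableT mEh nk; exact.
  have -> : (fun n => \int[P]_w (a n (X w) * Y w)%:E)%E = cst 0%E.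
    by apply/funext => n; exact: an0.
  by move=> /(cvg_lim (@ereal_hausdorff R)) <-; rewrite lim_cst.
move=> mg ig.
have mp : measurable_fun setT (fun x => Num.max (g x) 0).
  by apply: measurable_maxr => //.
have mn : measurable_fun setT (fun x => Num.max (- g x) 0).
  by apply: measurable_maxr => //; exact: measurable_funN.
have bound (h : R -> R) : measurable_fun setT h -> (forall x, `|h x| <= `|g x|) ->
    P.-integrable setT (fun w => (h (X w) * Y w)%:E).
  move=> mh hg; apply: (le_integrable measurableT _ _ ig).
    apply/measurable_EFinP; apply: measurable_funM => //.
    by apply: measurableT_comp.
  by move=> w _; rewrite /= lee_fin !normrM; apply: ler_wpM2r.
have bp x : `|Num.max (g x) 0| <= `|g x|.
  by case: (leP (g x) 0) => h; rewrite ?normr0.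
have bn x : `|Num.max (- g x) 0| <= `|g x|.
  by case: (leP (- g x) 0) => h; rewrite ?normr0 ?normrN.
have E w : ((g (X w) * Y w)%:E = (Num.max (g (X w)) 0 * Y w)%:E -
    (Num.max (- g (X w)) 0 * Y w)%:E)%E.
  rewrite -EFinB -mulrBl; congr (_ * _)%:E.
  by case: (leP (g (X w)) 0) => h1; case: (leP (- g (X w)) 0) => h2; lra.
under eq_integral do rewrite E.
rewrite integralB//=; [|exact: (bound (fun x => Num.max (g x) 0))
                       |exact: (bound (fun x => Num.max (- g x) 0))].
rewrite (pos (fun x => Num.max (g x) 0))//; last 2 first.
- by move=> x; rewrite le_max lexx orbT.
- exact: (bound (fun x => Num.max (g x) 0)).
rewrite (pos (fun x => Num.max (- g x) 0))//; last 2 first.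
- by move=> x; rewrite le_max lexx orbT.
- exact: (bound (fun x => Num.max (- g x) 0)).
by rewrite sube0.
Qed.

End conditioning.

Section conditional_expectation.
Context {d : measure_display} {Omega : measurableType d} {R : realType}.
Variable P : probability Omega R.

Lemma cond_exp_exists (X : {RV P >-> R}) (Y : Omega -> R) :
  P.-integrable setT (EFin \o Y) ->
  exists v : R -> R, [/\ measurable_fun setT v,
    P.-integrable setT (fun w => (v (X w))%:E) &
    forall A : set R, measurable A ->
      (\int[P]_(w in X @^-1` A) (v (X w))%:E = \int[P]_(w in X @^-1` A) (Y w)%:E)%E].
Proof.
move=> iY; have mX : measurable_fun setT X by [].
have [nu nuE] : {nu : {charge set R -> \bar R} |
    forall A : set R, nu A = (\int[P]_(w in X @^-1` A) (Y w)%:E)%E}.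
  unshelve refine (exist _ (pushforward (induced_charge iY) X : {charge set R -> \bar R}) _).
    exact: mX.
  by [].
pose mu : {sigma_finite_measure set R -> \bar R} := distribution P X.
have dom : nu `<< mu.
  apply/null_content_dominatesP => A mA muA; rewrite nuE; apply: null_set_integral => //.
  - by rewrite -[X in measurable X]setTI; exact: mX.
  - by apply: measurable_funTS; exact: measurable_int iY.
have fRN x := Radon_Nikodym_fin_num x dom.
have iRN := Radon_Nikodym_integrable dom.
pose v x := fine (Radon_Nikodym nu mu x).
have vE x : (v x)%:E = Radon_Nikodym nu mu x by rewrite fineK.
have mv : measurable_fun setT v.
  apply/measurable_EFinP; rewrite (_ : EFin \o v = Radon_Nikodym nu mu).
    exact: measurable_int iRN.
  by apply/funext => x /=; exact: vE.
have ivX : P.-integrable setT (fun w => (v (X w))%:E).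
  apply/integrableP; split.
    by apply/measurable_EFinP; exact: measurableT_comp.
  have mabs : measurable_fun [set: R] (fun x => `|(v x)%:E|%E).
    by apply: measurableT_comp => //; exact/measurable_EFinP.
  rewrite -(ge0_integral_distribution X mabs)//.
  under eq_integral do rewrite vE.
  by have /integrableP[_] := iRN.
exists v; split => // A mA; rewrite -nuE (Radon_Nikodym_integral dom mA).
have mvA : measurable_fun A (fun x => (v x)%:E).
  by apply: measurable_funTS; exact/measurable_EFinP.
under [RHS]eq_integral do rewrite -vE.
rewrite (_ : (\int[mu]_(x in A) (v x)%:E = \int[pushforward P X]_(x in A) (v x)%:E)%E)//.
rewrite integral_pushforward//.
- by apply/measurable_EFinP.
- by apply: integrableS ivX => //; rewrite -[X in measurable X]setTI; exact: mX.
Qed.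

Lemma integrable_comp_indic (X : {RV P >-> R}) (Y : Omega -> R) (v : R -> R) :
  P.-integrable setT (EFin \o Y) -> measurable_fun setT v ->
  P.-integrable setT (fun w => (v (X w))%:E) ->
  (forall A : set R, measurable A ->
    (\int[P]_(w in X @^-1` A) (v (X w))%:E = \int[P]_(w in X @^-1` A) (Y w)%:E)%E) ->
  (\int[P]_w (`|v (X w)|)%:E <= \int[P]_w (`|Y w|)%:E)%E.
Proof.
move=> iY mv iv vY; have mX : measurable_fun setT X by [].
pose A := [set x | 0 <= v x].
have mA : measurable A.
  by rewrite -[A]setTI; apply: measurable_fun_le.
have mCA := measurableC mA.
have h1 := vY A mA; have h2 := vY _ mCA.
rewrite (integral_preimage_indic P X Y) (integral_preimage_indic P X (v \o X)) in h1.
rewrite (integral_preimage_indic P X Y) (integral_preimage_indic P X (v \o X)) in h2.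
have i1 := integrable_indic_mul mX iY mA; have i2 := integrable_indic_mul mX iY mCA.
have i3 := integrable_indic_mul (Y := v \o X) mX iv mA.
have i4 := integrable_indic_mul (Y := v \o X) mX iv mCA.
have -> : (\int[P]_w (`|v (X w)|)%:E =
    \int[P]_w ((\1_A (X w) * Y w)%:E - (\1_(~` A) (X w) * Y w)%:E))%E.
  rewrite integralB//= -h1 -h2 -integralB//=; apply: eq_integral => w _.
  rewrite -EFinB; congr (_%:E); rewrite indicC !indicE /=.
  have [/set_mem wA|/negP wA] := boolP (X w \in A); rewrite /=.
    by rewrite ger0_norm//; lra.
  have : ~ A (X w) by move=> h; apply: wA; rewrite inE.
  by rewrite /A/= => /negP; rewrite -ltNge => h; rewrite ltr0_norm//; lra.
apply: le_integral => //.
- exact: integrableB.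
- exact: (integrable_abse iY).
- move=> w _; rewrite -EFinB lee_fin indicC !indicE; case: (X w \in A) => /=.
    by rewrite mul1r mul0r subr0 ler_norm.
  by rewrite mul0r mul1r sub0r -normrN ler_norm.
Qed.

Lemma present_sub_sigma_field (Z : R -> Omega -> R) (t : R) :
  measurable_fun setT (Z t) -> sub_sigma_field (present Z t).
Proof.
move=> mZ; split; last by move=> A [B mB <-]; exact: mZ.
by apply: sigma_algebra_preimage; exact: sigma_algebra_measurable.
Qed.

Lemma present_cond_exp (X : R -> {RV P >-> R}) (t : R) (Y : Omega -> R) (v : R -> R) :
  P.-integrable setT (EFin \o Y) -> measurable_fun setT v ->
  P.-integrable setT (fun w => (v (X t w))%:E) ->
  (forall A : set R, measurable A ->
    (\int[P]_(w in X t @^-1` A) (v (X t w))%:E = \int[P]_(w in X t @^-1` A) (Y w)%:E)%E) ->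
  is_cond_exp P (present X t) Y (fun w => v (X t w)).
Proof.
move=> iY mv iv vY; split => //.
- move=> E mE; exists (v @^-1` E); last by rewrite setTI.
  by rewrite -[X in measurable X]setTI; exact: mv.
- by move=> E [B mB <-]; rewrite setTI; exact: vY.
Qed.

Lemma cond_exp_unique (A : set (set Omega)) (Y V V' : Omega -> R) :
  sub_sigma_field A -> is_cond_exp P A Y V -> is_cond_exp P A Y V' ->
  {ae P, forall w, V w = V' w}.
Proof.
move=> [sA Am].
have half (V1 V2 : Omega -> R) : is_cond_exp P A Y V1 -> is_cond_exp P A Y V2 ->
    {ae P, forall w, V1 w <= V2 w -> V1 w = V2 w}.
  move=> [iY iV1 mV1 eV1] [_ iV2 mV2 eV2].
  pose E := [set w | V1 w <= V2 w].
  have AE : A E.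
    have mA (V0 : Omega -> R) : (forall E : set R, measurable E -> A (V0 @^-1` E)) ->
        measurable_fun [set: g_sigma_algebraType A] (V0 : g_sigma_algebraType A -> R).
      by move=> h _ B mB; rewrite setTI; apply: sub_sigma_algebra; exact: h.
    have := measurable_fun_le (@measurableT _ (g_sigma_algebraType A)) (mA _ mV1) (mA _ mV2).
    by rewrite setTI /measurable/= sigma_algebra_id.
  have mE := Am _ AE.
  have iE (V0 : Omega -> R) : P.-integrable setT (EFin \o V0) -> P.-integrable E (EFin \o V0).
    by move=> h; exact: integrableS h.
  have mD : measurable_fun E (fun w => (V2 w)%:E - (V1 w)%:E)%E.
    by apply: emeasurable_funB; [exact: measurable_int (iE _ iV2)|exact: measurable_int (iE _ iV1)].
  have : (\int[P]_(w in E) `|(V2 w)%:E - (V1 w)%:E| = 0)%E.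
    transitivity (\int[P]_(w in E) ((V2 w)%:E - (V1 w)%:E))%E.
      apply: eq_integral => w /set_mem wE.
      by rewrite -EFinB gee0_abs// lee_fin subr_ge0.
    rewrite integralB//=; [|exact: iE|exact: iE].
    rewrite eV1// eV2// subee//; apply: integrable_fin_num => //.
    exact: (iE _ iY).
  move/(ae_eq_integral_abs P mE mD); apply: filterS => w h wE.
  by have /= [] := h wE; lra.
move=> h1 h2; apply: (filterS _ (filterI (half _ _ h1 h2) (half _ _ h2 h1))) => w [a b].
by have [/a|/ltW/b] := leP (V w) (V' w).
Qed.

Lemma cvg_in_prob_unique (V V' : R -> Omega -> R) (D D' : Omega -> R) :
  measurable_fun setT D -> measurable_fun setT D' ->
  (\forall h \near 0^'+, measurable_fun setT (V h) /\ measurable_fun setT (V' h) /\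
     {ae P, forall w, V h w = V' h w}) ->
  cvg_in_prob P V D -> cvg_in_prob P V' D' -> {ae P, forall w, D w = D' w}.
Proof.
move=> mD mD' VV cV cV'.
pose N (n : nat) := [set w | n.+1%:R^-1 + n.+1%:R^-1 <= `|D w - D' w|].
have mdist (f g : Omega -> R) (c : R) : measurable_fun setT f -> measurable_fun setT g ->
    measurable [set w | c <= `|f w - g w|].
  move=> mf mg; rewrite -[X in measurable X]setTI; apply: measurable_fun_le => //.
  by apply: measurableT_comp => //; exact: measurable_funB.
have N0 n : P (N n) = 0%E.
  apply/eqP; rewrite eq_le measure_ge0 andbT; apply/lee_addgt0Pr => e e0; rewrite add0e.
  have n0 : 0 < n.+1%:R^-1 :> R by rewrite invr_gt0.
  have e2 : 0 < e / 2 by rewrite divr_gt0.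
  have [h [[[mV [mV' [M [mM M0 hM]]]] h1] h2]] :=
    @filter_ex _ _ (at_right_proper_filter (0 : R)) _
      (filterI (filterI VV (cvge0_lt _ (cV _ n0) e2)) (cvge0_lt _ (cV' _ n0) e2)).
  apply: (@le_trans _ _ (P (([set w | (n.+1%:R^-1 <= `|V h w - D w|)%R] `|`
      [set w | (n.+1%:R^-1 <= `|V' h w - D' w|)%R]) `|` M))).
    apply: le_measure; rewrite ?inE; first exact: mdist.
      by apply: measurableU => //; apply: measurableU; exact: mdist.
    move=> w; rewrite /N/= => hw; have [wM|wM] := pselect (M w); first by right.
    have E : V h w = V' h w by apply: contrapT => h3; apply: wM; exact: hM.
    left; have [l1|g1] := leP n.+1%:R^-1 `|V h w - D w|; first by left.
    right => /=; rewrite leNgt; apply/negP => g2; move: hw; rewrite leNgt => /negP; apply.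
    have -> : D w - D' w = (V' h w - D' w) - (V h w - D w) by rewrite E; lra.
    by apply: le_lt_trans (ler_normB _ _) _; exact: ltrD.
  apply: le_trans (measureU2 P _ _) _ => //; first by apply: measurableU; exact: mdist.
  rewrite [X in (_ + X)%E](_ : _ = 0%E) ?adde0//.
  apply: le_trans (measureU2 P _ _) _; [exact: mdist|exact: mdist|].
  by rewrite (splitr e) EFinD; apply: leeD; exact: ltW.
have mN n : measurable (N n) by exact: mdist.
have negN : P.-negligible (\bigcup_n N n).
  by apply: negligible_bigcup => n; apply/(negligibleP P (mN n)); exact: N0.
apply: negligibleS negN => w /= /eqP nD.
have d0 : 0 < `|D w - D' w| / 2 by rewrite divr_gt0// normr_gt0 subr_eq0.
have [n _ hn] := near_infty_natSinv_lt (PosNum d0).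
exists n => //; have /ltW h := hn n (leqnn n); rewrite /N/= [leRHS]splitr; exact: lerD.
Qed.

End conditional_expectation.

Section scale_domain.
Variables (R : realType) (sigma G : R -> R) (x0 K : R).
Hypothesis G_scale : is_scale sigma G x0.

Definition scale_domain : set R := [set z | forall w, between x0 z w -> sigma w != 0].

Lemma between_split (z1 z2 z w : R) : z1 <= z -> z <= z2 -> between x0 z w ->
  between x0 z1 w \/ between x0 z2 w.
Proof.
move=> h1 h2 /andP[h3 h4]; have [wx|xw] := leP w x0.
  left; rewrite /between/=; move: h3 h4; case: (leP x0 z) => h5 h3 h4;
    case: (leP x0 z1) => h6; apply/andP; split; lra.
right; rewrite /between/=; move: h3 h4; case: (leP x0 z) => h5 h3 h4;
    case: (leP x0 z2) => h6; apply/andP; split; lra.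
Qed.

Lemma scale_domain_convex (z1 z2 z : R) :
  scale_domain z1 -> scale_domain z2 -> z1 <= z -> z <= z2 -> scale_domain z.
Proof. by move=> d1 d2 h1 h2 w /(between_split h1 h2)[/d1|/d2]. Qed.

Lemma scale_domain_derive (z : R) : scale_domain z -> is_derive z 1 G (sigma z)^-1.
Proof. exact: G_scale. Qed.

Lemma scale_domain_continuous (A : set R) : A `<=` scale_domain -> {within A, continuous G}.
Proof.
move=> AD; apply: continuous_in_subspaceT => z; rewrite inE => /AD.
by move=> /scale_domain_derive; exact: is_derive_continuous.
Qed.

Lemma measurable_scale_domain : measurable scale_domain.
Proof.
by apply: is_interval_measurable => z1 z2 d1 d2 z /andP[h1 h2]; exact: scale_domain_convex h1 h2.
Qed.

Lemma measurable_scale : measurable_fun setT (G \_ scale_domain).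
Proof.
apply/(measurable_restrictT _ measurable_scale_domain).
apply: subspace_continuous_measurable_fun; first exact: measurable_scale_domain.
exact: scale_domain_continuous.
Qed.

Lemma scale_inj (z1 z2 : R) : scale_domain z1 -> scale_domain z2 -> G z1 = G z2 -> z1 = z2.
Proof.
wlog z12 : z1 z2 / z1 <= z2 => [wl d1 d2 E|d1 d2 E].
  by have [/wl|/ltW/wl h] := leP z1 z2; [exact|apply/esym; exact: h].
have [|c cz] := @MVT_between R G (fun z => (sigma z)^-1) z1 z2.
  by rewrite between_itv// => z /andP[h1 h2]; apply: scale_domain_derive; exact: scale_domain_convex h1 h2.
rewrite E subrr => /esym/eqP; rewrite mulf_eq0 invr_eq0 subr_eq0 => /orP[|/eqP//].
move: cz; rewrite between_itv// => /andP[h1 h2].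
have sc : sigma c != 0 by exact: (scale_domain_convex d1 d2 h1 h2 (between_r x0 c)).
by rewrite (negbTE sc).
Qed.

Lemma scale_rays (c : R) : exists2 E : set R, measurable E &
  forall z, scale_domain z -> (c < z) <-> E (G z).
Proof.
exists (G @` (scale_domain `&` [set z | c < z])).
  apply: is_interval_measurable => _ _ [z1 [d1 c1] <-] [z2 [d2 c2] <-] u /andP[u1 u2].
  have sub a b : scale_domain a -> scale_domain b -> c < a ->
      [set` `[a, b]] `<=` scale_domain `&` [set z | c < z].
    move=> da db ca z; rewrite /= in_itv/= => /andP[az zb]; split.
      exact: scale_domain_convex az zb.
    exact: lt_le_trans az.
  have [z12|/ltW z21] := leP z1 z2.
    have [||z zI <-] := @IVT R G z1 z2 u z12.
    - by apply: scale_domain_continuous => z /(sub _ _ d1 d2 c1)[].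
    - by rewrite min_l ?max_r ?u1// (le_trans u1).
    by exists z => //; exact: (sub _ _ d1 d2 c1).
  have [||z zI <-] := @IVT R G z2 z1 u z21.
  - by apply: scale_domain_continuous => z /(sub _ _ d2 d1 c2)[].
  - by rewrite min_r ?max_l ?u1// (le_trans u1).
  by exists z => //; exact: (sub _ _ d2 d1 c2).
move=> z dz; split => [cz|[z' [dz' cz'] E]]; first by exists z.
by rewrite (scale_inj dz dz' (esym E)).
Qed.

End scale_domain.

Section gaussian_orthogonality.
Context {d : measure_display} {Omega : measurableType d} {R : realType}.
Variables (P : probability Omega R) (T H : R) (B : R -> {RV P >-> R}).
Hypotheses (T0 : 0 < T) (H01 : 1 / 2 < H < 1).
Hypothesis hB : fractional_brownian_motion T H B.
Variables (t u : R).
Hypotheses (t0 : 0 < t) (tT : t \in `[0, T]) (uT : u \in `[0, T]).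

Definition fbm_coef : R := fbm_cov H t u / t `^ (2 * H).

Definition fbm_innov : Omega -> R := fbm_comb B (- fbm_coef) 1 t u.

Let mxi : measurable_fun setT fbm_innov.
Proof. exact: measurable_fbm_comb. Qed.

Lemma fbm_comb_sqr_integrable a c :
  P.-integrable setT (fun w => (fbm_comb B a c t u w ^+ 2)%:E).
Proof.
apply/integrableP; split.
  by apply/measurable_EFinP; apply: measurable_funX; exact: measurable_fbm_comb.
under eq_integral do rewrite gee0_abs ?lee_fin ?sqr_ge0//.
by rewrite (fbm_comb_sqr hB)// ltry.
Qed.

Lemma fbm_innov_integrable : P.-integrable setT (EFin \o fbm_innov).
Proof.
apply: integrable_sqr; first exact: mxi.
by rewrite (fbm_comb_sqr hB)// ltry.
Qed.

Let q (c x : R) := Num.max (x - c) 0.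

Let q_ge0 c x : 0 <= q c x.
Proof. by rewrite /q le_max lexx orbT. Qed.

Let mq c : measurable_fun setT (q c).
Proof. by apply: measurable_maxr => //; exact: measurable_funB. Qed.

Let q_taylor c x y : q c (x + y) ^+ 2 <= q c x ^+ 2 + 2 * q c x * y + y ^+ 2 /\
  q c x ^+ 2 + 2 * q c x * y <= q c (x + y) ^+ 2.
Proof.
rewrite /q; case: (leP (x + y - c) 0) => h1; case: (leP (x - c) 0) => h2;
  rewrite ?expr0n/= ?expr2; split; nra.
Qed.

Let q_sqr c x : q c x ^+ 2 <= 2 * x ^+ 2 + 2 * c ^+ 2.
Proof.
have := sqr_ge0 x; have := sqr_ge0 c; have := sqr_ge0 (x + c).
rewrite /q; case: (leP (x - c) 0) => h1; rewrite ?expr0n/= ?expr2 => *; lra.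
Qed.

Let q_integrable c a e : P.-integrable setT (fun w => (q c (fbm_comb B a e t u w) ^+ 2)%:E).
Proof.
have i1 : P.-integrable setT (fun w => ((2%:E * (fbm_comb B a e t u w ^+ 2)%:E) + (2 * c ^+ 2)%:E)%E).
  apply: integrableD => //; last exact: finite_measure_integrable_cst.
  by apply: integrableZl => //; exact: fbm_comb_sqr_integrable.
apply: (le_integrable measurableT _ _ i1).
  apply/measurable_EFinP; apply: measurable_funX.
  by apply: measurableT_comp; [exact: mq|exact: measurable_fbm_comb].
move=> w _; rewrite -EFinM -EFinD /= lee_fin ger0_norm ?sqr_ge0//.
rewrite ger0_norm; first exact: q_sqr.
by rewrite addr_ge0// mulr_ge0// sqr_ge0.
Qed.

Let innov_law (a : R) (E : set R) : measurable E ->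
  P (fbm_comb B (1 - a * fbm_coef) a t u @^-1` E) =
  P (fbm_comb B (1 + a * fbm_coef) (- a) t u @^-1` E).
Proof.
move=> mE.
have [_ l1] := centered_gaussian_law (measurable_fbm_comb B _ _ t u)
  (fbm_comb_gaussian hB (1 - a * fbm_coef) a tT uT) (fbm_comb_mean hB _ _ tT uT)
  (fbm_comb_sqr hB _ _ tT uT).
have [_ l2] := centered_gaussian_law (measurable_fbm_comb B _ _ t u)
  (fbm_comb_gaussian hB (1 + a * fbm_coef) (- a) tT uT) (fbm_comb_mean hB _ _ tT uT)
  (fbm_comb_sqr hB _ _ tT uT).
have {}l1 := l1 E mE; have {}l2 := l2 E mE.
suff vE : (1 - a * fbm_coef) ^+ 2 * fbm_cov H t t + 2 * (1 - a * fbm_coef) * a * fbm_cov H t u +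
   a ^+ 2 * fbm_cov H u u = (1 + a * fbm_coef) ^+ 2 * fbm_cov H t t +
   2 * (1 + a * fbm_coef) * - a * fbm_cov H t u + (- a) ^+ 2 * fbm_cov H u u.
  by rewrite vE in l1; exact: etrans l1 (esym l2).
clear l1 l2.
have E1 : fbm_coef * fbm_cov H t t = fbm_cov H t u.
  by rewrite /fbm_coef fbm_covxx// divfK// gt_eqF// powR_gt0.
have -> : (1 - a * fbm_coef) ^+ 2 * fbm_cov H t t = fbm_cov H t t -
   2 * a * (fbm_coef * fbm_cov H t t) + a ^+ 2 * fbm_coef * (fbm_coef * fbm_cov H t t).
  by rewrite !expr2; ring.
have -> : (1 + a * fbm_coef) ^+ 2 * fbm_cov H t t = fbm_cov H t t +
   2 * a * (fbm_coef * fbm_cov H t t) + a ^+ 2 * fbm_coef * (fbm_coef * fbm_cov H t t).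
  by rewrite !expr2; ring.
by rewrite E1 !expr2; ring.
Qed.

Let hinge_integrable c : P.-integrable setT (fun w => (q c (B t w) * fbm_innov w)%:E).
Proof.
have i1 : P.-integrable setT (fun w => ((q c (fbm_comb B 1 0 t u w) ^+ 2)%:E +
    (fbm_innov w ^+ 2)%:E)%E).
  by apply: integrableD => //; exact: fbm_comb_sqr_integrable.
apply: (le_integrable measurableT _ _ i1).
  apply/measurable_EFinP; apply: measurable_funM => //.
  by apply: measurableT_comp; [exact: mq|].
move=> w _; rewrite -EFinD /= lee_fin.
rewrite [leRHS]ger0_norm; last by rewrite addr_ge0// sqr_ge0.
have -> : fbm_comb B 1 0 t u w = B t w by rewrite /fbm_comb mul1r mul0r addr0.
rewrite normrM (ger0_norm (q_ge0 _ _)) -(real_normK (num_real (fbm_innov w))).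
have := q_ge0 c (B t w); have := normr_ge0 (fbm_innov w).
set x := q c (B t w); set y := `|fbm_innov w| => *.
have := sqr_ge0 (x - y); rewrite !expr2; nra.
Qed.

(* Uncorrelatedness makes [B_t + a xi] and [B_t - a xi] equal in law; comparing the
   expectations of [(x - c)_+ ^ 2] under both to first order in [a] kills the term
   [E[(B_t - c)_+ xi]]. *)
Lemma hinge_orthogonal c : (\int[P]_w (q c (B t w) * fbm_innov w)%:E = 0)%E.
Proof.
have fin := integrable_fin_num measurableT (hinge_integrable c).
rewrite -(fineK fin); set p := fine _; congr (_%:E).
have pE : (\int[P]_w (q c (B t w) * fbm_innov w)%:E = p%:E)%E by rewrite fineK.
pose v := fine (\int[P]_w (fbm_innov w ^+ 2)%:E)%E.
have vE : (\int[P]_w (fbm_innov w ^+ 2)%:E = v%:E)%E.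
  by rewrite fineK//; apply: integrable_fin_num => //; exact: fbm_comb_sqr_integrable.
have ixi2 : P.-integrable setT (fun w => (fbm_innov w ^+ 2)%:E).
  exact: fbm_comb_sqr_integrable.
pose Yp a := fbm_comb B (1 - a * fbm_coef) a t u.
pose Ym a := fbm_comb B (1 + a * fbm_coef) (- a) t u.
have YpE a w : Yp a w = B t w + a * fbm_innov w.
  by rewrite /Yp /fbm_innov /fbm_comb; ring.
have YmE a w : Ym a w = B t w - a * fbm_innov w.
  by rewrite /Ym /fbm_innov /fbm_comb; ring.
have law a : (\int[P]_w (q c (Yp a w) ^+ 2)%:E = \int[P]_w (q c (Ym a w) ^+ 2)%:E)%E.
  have mf : measurable_fun setT (fun x => (q c x ^+ 2)%:E).
    by apply/measurable_EFinP; apply: measurable_funX; exact: mq.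
  have f0 x : (0 <= (q c x ^+ 2)%:E)%E by rewrite lee_fin sqr_ge0.
  have [_ l1] := centered_gaussian_law (measurable_fbm_comb B _ _ t u)
    (fbm_comb_gaussian hB (1 + a * fbm_coef) (- a) tT uT) (fbm_comb_mean hB _ _ tT uT)
    (fbm_comb_sqr hB _ _ tT uT).
  rewrite [RHS](ge0_integral_gaussian (measurable_fbm_comb B _ _ t u) l1 mf f0).
  apply: (ge0_integral_gaussian (measurable_fbm_comb B _ _ t u) _ mf f0).
  by move=> E mE; rewrite innov_law// l1.
have iYp a : P.-integrable setT (fun w => (q c (Yp a w) ^+ 2)%:E) by exact: q_integrable.
have iYm a : P.-integrable setT (fun w => (q c (Ym a w) ^+ 2)%:E) by exact: q_integrable.
have iB a : P.-integrable setT (fun w => ((q c (Yp a w) ^+ 2)%:E - (q c (Ym a w) ^+ 2)%:E)%E).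
  exact: integrableB (iYp a) (iYm a).
have bound a : 4 * a * p <= a ^+ 2 * v.
  rewrite -lee_fin !EFinM -pE -vE -EFinM -integralZl// -integralZl//.
  have -> : (\int[P]_w ((a ^+ 2)%:E * (fbm_innov w ^+ 2)%:E) =
      \int[P]_w ((q c (Yp a w) ^+ 2)%:E - (q c (Ym a w) ^+ 2)%:E +
                 (a ^+ 2)%:E * (fbm_innov w ^+ 2)%:E))%E.
    rewrite [RHS]integralD//; last exact: integrableZl.
    rewrite integralB// law subee ?add0e//.
    exact: integrable_fin_num (iYm a).
  apply: le_integral => //.
  - by apply: integrableZl.
  - by apply: integrableD => //; exact: integrableZl.
  - move=> w _; rewrite -EFinM -EFinB -EFinM -EFinD lee_fin YpE YmE.
    have [h1 h2] := q_taylor c (B t w) (a * fbm_innov w).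
    have [h3 h4] := q_taylor c (B t w) (- (a * fbm_innov w)).
    have e1 : (a * fbm_innov w) ^+ 2 = a ^+ 2 * fbm_innov w ^+ 2 by rewrite exprMn.
    by rewrite sqrrN e1 in h3; rewrite e1 in h1; lra.
have v0 : 0 <= v.
  by rewrite -lee_fin -vE; apply: integral_ge0 => w _; rewrite lee_fin sqr_ge0.
have p2 a : 0 < a -> 4 * `|p| <= a * v.
  move=> a0; have := bound a; have := bound (- a); rewrite sqrrN => h1 h2.
  rewrite -(ler_pM2l a0) [leRHS]mulrA -expr2; case: (leP 0 p) => hp.
    by rewrite ger0_norm//; lra.
  by rewrite ltr0_norm//; lra.
apply/eqP; rewrite -normr_le0; apply/ler_addgt0Pr => e e0; rewrite add0r.
have a0 : 0 < e / (v + 1) by rewrite divr_gt0// ltr_wpDl.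
have h := p2 _ a0.
have : e / (v + 1) * v <= e.
  by rewrite mulrAC ler_pdivrMr ?ltr_wpDl// mulrDr mulr1 lerDl ltW.
have := normr_ge0 p; lra.
Qed.

Lemma innov_orthogonal (A : set R) : measurable A ->
  (\int[P]_w (\1_A (B t w) * fbm_innov w)%:E = 0)%E.
Proof.
move: A; apply: rays_orthogonal => //; first exact: fbm_innov_integrable.
  exact: (fbm_comb_mean hB).
move=> c.
pose phi (n : nat) x := n.+1%:R * (q c x - q (c + n.+1%:R^-1) x).
have n1 n : 0 < n.+1%:R :> R by rewrite ltr0n.
have n0 n : 0 < n.+1%:R^-1 :> R by rewrite invr_gt0.
have phi01 n x : 0 <= phi n x <= 1.
  rewrite /phi /q; have := n0 n; have := n1 n.
  have := mulfV (lt0r_neq0 (n1 n)); set k := n.+1%:R; set l := k^-1 => kl k0 l0.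
  by case: (leP (x - c) 0) => h1; case: (leP (x - (c + l)) 0) => h2;
    apply/andP; split; nra.
have mphi n : measurable_fun setT (phi n).
  by apply: measurable_funM => //; apply: measurable_funB; exact: mq.
have phi_int n : (\int[P]_w (phi n (B t w) * fbm_innov w)%:E = 0)%E.
  have E w : ((phi n (B t w) * fbm_innov w)%:E = (n.+1%:R)%:E *
     ((q c (B t w) * fbm_innov w)%:E - (q (c + n.+1%:R^-1) (B t w) * fbm_innov w)%:E))%E.
    by rewrite -EFinB -EFinM; congr (_%:E); rewrite /phi; ring.
  under eq_integral do rewrite E.
  rewrite integralZl//; last by apply: integrableB.
  by rewrite integralB//= !hinge_orthogonal sube0 mule0.
have mI : measurable_fun setT (fun w => (\1_(`]c, +oo[%classic) (B t w) : R)).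
  exact: measurable_indic_comp.
have [||||| _ _] := @dominated_convergence _ _ _ P setT measurableT
    (fun n w => (phi n (B t w) * fbm_innov w)%:E)
    (fun w => (\1_(`]c, +oo[%classic) (B t w) * fbm_innov w)%:E)
    (fun w => `|(fbm_innov w)%:E|%E).
- move=> n; apply/measurable_EFinP; apply: measurable_funM => //.
  by apply: measurableT_comp; [exact: mphi|].
- by apply/measurable_EFinP; apply: measurable_funM.
- apply: aeW => w _; apply: cvg_EFin; first exact: nearW.
  apply: cvgM; last exact: cvg_cst.
  apply: cvg_near_cst; rewrite indicE.
  have [/set_mem/=|] := boolP (B t w \in `]c, +oo[%classic).
    rewrite in_itv/= andbT => cB.
    have d0 : 0 < B t w - c by rewrite subr_gt0.
    have [m _ hm] := near_infty_natSinv_lt (PosNum d0).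
    exists m => // n /hm /= hn; rewrite /phi /q.
    have := mulfV (lt0r_neq0 (n1 n)); move: (n0 n) hn; set k := n.+1%:R; set l := k^-1.
    move=> l0 hl kl; rewrite max_l; last lra.
    rewrite max_l; last lra.
    by rewrite -kl; congr (_ * _); ring.
  rewrite notin_setE/= in_itv/= andbT => /negP; rewrite -leNgt => Bc.
  apply: nearW => n; rewrite /phi /q; move: (n0 n); set k := n.+1%:R; set l := k^-1.
  move=> l0; rewrite max_r; last lra.
  by rewrite max_r ?subrr ?mulr0//; lra.
- exact: (integrable_abse fbm_innov_integrable).
- apply: aeW => w n _; rewrite EFinM abseM -[leRHS]mul1e; apply: lee_wpmul2r => //.
  by have /andP[h1 h2] := phi01 n (B t w); rewrite /= lee_fin ger0_norm.
have -> : (fun n => \int[P]_w (phi n (B t w) * fbm_innov w)%:E)%E = cst 0%E.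
  by apply/funext => n; exact: phi_int.
by move=> /(cvg_lim (@ereal_hausdorff R)) <-; rewrite lim_cst.
Qed.

End gaussian_orthogonality.

Lemma Lfun2_of_sqr {d : measure_display} {Omega : measurableType d} {R : realType}
    (P : probability Omega R) (f : Omega -> R) : measurable_fun setT f ->
  P.-integrable setT (fun w => (f w ^+ 2)%:E) -> f \in Lfun P 2%:E.
Proof.
move=> mf /integrableP[_ f2]; rewrite inE; apply/andP; split; rewrite inE//=.
rewrite /finite_norm unlock; apply: poweR_lty.
apply: le_lt_trans f2; rewrite le_eqVlt; apply/orP; left; apply/eqP.
apply: eq_integral => w _ /=.
by rewrite powR_mulrn// real_normK ?num_real// ger0_norm ?sqr_ge0.
Qed.

Section pointwise_bounds.
Variables (R : realType) (sigma G : R -> R) (x0 K r T : R).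
Hypothesis sigma_lip : forall x y, `|sigma x - sigma y| <= K * `|x - y|.
Hypotheses (G_scale : is_scale sigma G x0) (G0 : G x0 = 0) (T0 : 0 <= T).

Lemma solution_pointwise : exists c C, [/\ 0 <= c, 0 <= C,
  (forall p bp s, scale_domain sigma x0 p -> G p = bp + r * s -> 0 <= s <= T ->
    [/\ `|p| <= C * expR (c * `|bp|), p ^+ 2 <= C * expR (c * `|bp|) &
        `|sigma p| <= C * expR (c * `|bp|)]) &
  (forall p bp s q bq s', scale_domain sigma x0 p -> G p = bp + r * s -> 0 <= s <= T ->
    scale_domain sigma x0 q -> G q = bq + r * s' -> 0 <= s' <= T ->
    `|q - p - sigma p * (G q - G p)| <=
      C * (expR (c * `|bp|) + expR (c * `|bq|)) * (G q - G p) ^+ 2)].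
Proof.
have K0 : 0 <= K.
  by have := sigma_lip 0 1; rewrite sub0r normrN1 mulr1; exact: le_trans.
pose c := `|sigma x0| + 2 * K; pose E := expR (c * (`|r| * T)).
have c0 : 0 <= c by rewrite /c addr_ge0// mulr_ge0.
have E0 : 0 <= E by exact: expR_ge0.
pose C1 := `|x0| + 1 + E; pose C2 := `|sigma 0| + K * C1; pose C3 := 2 * x0 ^+ 2 + 2 * E.
have C10 : 0 <= C1 by rewrite /C1 !addr_ge0.
have C20 : 0 <= C2 by rewrite /C2 addr_ge0// mulr_ge0.
have C30 : 0 <= C3 by rewrite /C3 addr_ge0// mulr_ge0// sqr_ge0.
have KC20 : 0 <= K * C2 by rewrite mulr_ge0.
have e1 (b : R) : 1 <= expR (c * `|b|) by rewrite -expR0 ler_expR mulr_ge0.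
have sqb (p bp s : R) : scale_domain sigma x0 p -> G p = bp + r * s -> 0 <= s <= T ->
    (p - x0) ^+ 2 <= E * expR (c * `|bp|).
  move=> dp Gp /andP[s0 sT]; apply: le_trans (scale_growth sigma_lip dp _) _.
    exact: (is_scale_between G_scale dp).
  rewrite G0 subr0 -/c /E -expRD ler_expR -mulrDr; apply: ler_wpM2l => //.
  rewrite Gp addrC; apply: le_trans (ler_normD _ _) _.
  by rewrite lerD2r normrM (ger0_norm s0); apply: ler_wpM2l.
have p1 (p bp s : R) : scale_domain sigma x0 p -> G p = bp + r * s -> 0 <= s <= T ->
    `|p| <= C1 * expR (c * `|bp|).
  move=> dp Gp sT; have h := sqb _ _ _ dp Gp sT.
  have h1 : `|p - x0| <= 1 + (p - x0) ^+ 2.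
    rewrite -(real_normK (num_real (p - x0))); have := sqr_ge0 (`|p - x0| - 1).
    by have := normr_ge0 (p - x0); rewrite !expr2 => *; nra.
  have h2 : `|p| <= `|x0| + `|p - x0|.
    by rewrite -{1}(subrK x0 p) addrC; exact: ler_normD.
  have := e1 bp; move: h; set e := expR _ => h he.
  have h3 : `|x0| + 1 <= (`|x0| + 1) * e by rewrite ler_peMr// addr_ge0.
  by rewrite /C1 mulrDl; lra.
have s1 (p bp s : R) : scale_domain sigma x0 p -> G p = bp + r * s -> 0 <= s <= T ->
    `|sigma p| <= C2 * expR (c * `|bp|).
  move=> dp Gp sT; have h := p1 _ _ _ dp Gp sT.
  have h1 : `|sigma p| <= `|sigma 0| + K * `|p|.
    rewrite -[sigma p](subrK (sigma 0)) addrC; apply: le_trans (ler_normD _ _) _.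
    by rewrite lerD2l; apply: le_trans (sigma_lip _ _) _; rewrite subr0.
  apply: le_trans h1 _; rewrite /C2 mulrDl; apply: lerD; first by rewrite ler_peMr.
  by rewrite -mulrA; apply: ler_wpM2l.
exists c, (C1 + C2 + C3 + K * C2); split => //.
- by nonneg.
- move=> p bp s dp Gp sT; have e0 : 0 <= expR (c * `|bp|) by exact: expR_ge0.
  split.
  + by apply: le_trans (p1 _ _ _ dp Gp sT) _; apply: ler_wpM2r => //; lra.
  + apply: (@le_trans _ _ (C3 * expR (c * `|bp|))); last by apply: ler_wpM2r => //; lra.
    have := sqb _ _ _ dp Gp sT; have := e1 bp; set e := expR _ => he h.
    have h1 : p ^+ 2 <= 2 * x0 ^+ 2 + 2 * (p - x0) ^+ 2.
      by have := sqr_ge0 (2 * x0 - p); rewrite !expr2; lra.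
    have h2 : 2 * x0 ^+ 2 <= 2 * x0 ^+ 2 * e by rewrite ler_peMr// mulr_ge0// sqr_ge0.
    by rewrite /C3 mulrDl; lra.
  + by apply: le_trans (s1 _ _ _ dp Gp sT) _; apply: ler_wpM2r => //; lra.
- move=> p bp s q bq s' dp Gp sT dq Gq s'T.
  have dz z : between p q z -> scale_domain sigma x0 z.
    rewrite /between/=; case: (leP p q) => pq /andP[h1 h2].
      exact: scale_domain_convex h1 h2.
    exact: scale_domain_convex h1 h2.
  have := @scale_taylor R sigma G K sigma_lip p q.
  move=> /(_ (fun z h => dz z h z (between_r x0 z)) (fun z h => G_scale (dz z h))).
  move=> /le_trans; apply; apply: ler_wpM2r; first exact: sqr_ge0.
  have h1 := p1 _ _ _ dp Gp sT; have h2 := p1 _ _ _ dq Gq s'T.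
  have := e1 bp; have := e1 bq; move: h1 h2.
  set e := expR _; set e' := expR _ => h1 h2 he' he.
  apply: (@le_trans _ _ (K * C2 * (e + e'))); last by apply: ler_wpM2r; lra.
  rewrite -mulrA; apply: ler_wpM2l => //; rewrite /C2 [leRHS]mulrDl; apply: lerD.
    by rewrite ler_peMr//; lra.
  by rewrite -mulrA; apply: ler_wpM2l => //; rewrite mulrDr; exact: lerD.
Qed.

End pointwise_bounds.

Section moments.
Context {d : measure_display} {Omega : measurableType d} {R : realType}.
Variables (P : probability Omega R) (T H : R) (B : R -> {RV P >-> R}).
Hypotheses (T0 : 0 < T) (H01 : 1 / 2 < H < 1).
Hypothesis hB : fractional_brownian_motion T H B.

Let mexp (a s : R) : measurable_fun setT (fun w => (expR (a * `|B s w|))%:E).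
Proof. by apply: measurable_fun_expRM; exact: measurableT_comp. Qed.

Let bound (a : R) := 2 * expR (a ^+ 2 * T `^ (2 * H) / 2).

Lemma integrable_exp_bound (f : Omega -> R) (a C s u : R) :
  measurable_fun setT f -> s \in `[0, T] -> u \in `[0, T] -> 0 <= a -> 0 <= C ->
  {ae P, forall w, `|f w| <= C * (expR (a * `|B s w|) + expR (a * `|B u w|))} ->
  P.-integrable setT (EFin \o f).
Proof.
move=> mf sT uT a0 C0 fC; apply/integrableP; split; first exact/measurable_EFinP.
apply: (@le_lt_trans _ _ (C%:E * ((bound a)%:E + (bound a)%:E))%E); last first.
  by rewrite -EFinD -EFinM ltry.
apply: (@le_trans _ _ (\int[P]_w
    (C%:E * ((expR (a * `|B s w|))%:E + (expR (a * `|B u w|))%:E)))%E).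
  apply: ae_ge0_le_integral => //.
  - by apply: measurableT_comp => //; exact/measurable_EFinP.
  - by move=> w _; rewrite -EFinD -EFinM lee_fin mulr_ge0// addr_ge0 ?expR_ge0.
  - by apply: emeasurable_funM => //; apply: emeasurable_funD; exact: mexp.
  - apply: filterS fC => w h _; rewrite -EFinD -EFinM /= lee_fin; exact: h.
rewrite ge0_integralZl//; last 2 first.
- by apply: emeasurable_funD; exact: mexp.
- by move=> w _; rewrite -EFinD lee_fin addr_ge0 ?expR_ge0.
apply: lee_wpmul2l; first by rewrite lee_fin.
rewrite ge0_integralD//.
- by apply: leeD; exact: (fbm_exp_abs H01 hB).
Qed.

Lemma fbm_remainder_bound (t r c C : R) : t \in `[0, T] -> 0 <= c -> 0 <= C ->
  exists2 M, 0 <= M & forall u (f : Omega -> R), u \in `[0, T] -> u != t ->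
    measurable_fun setT f ->
    {ae P, forall w, `|f w| <= C * (expR (c * `|B t w|) + expR (c * `|B u w|)) *
       (B u w + r * u - (B t w + r * t)) ^+ 2} ->
    (\int[P]_w (`|f w|)%:E <= (M * (`|u - t| `^ (2 * H) + (u - t) ^+ 2))%:E)%E.
Proof.
move=> tT c0 C0.
pose M0 := bound (2 * c) + bound (2 * c) + 128 * (2 * expR 2^-1).
have M00 : 0 <= M0 by rewrite /M0 /bound !addr_ge0// !mulr_ge0// expR_ge0.
exists (2 * C * (1 + r ^+ 2) * M0).
  by rewrite !mulr_ge0// addr_ge0// sqr_ge0.
move=> u f uT ut mf fb.
have h0 : 0 < `|u - t| by rewrite normr_gt0 subr_eq0.
pose s := `|u - t| `^ H.
have s0 : 0 < s by rewrite powR_gt0.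
have s2 : s ^+ 2 = `|u - t| `^ (2 * H).
  by rewrite /s -powR_mulrn ?powR_ge0// -powRrM [2 * H]mulrC.
pose D w := B u w - B t w.
have DE : D = fbm_comb B 1 (-1) u t.
  by apply/funext => w; rewrite /D /fbm_comb mul1r mulN1r.
have mD : measurable_fun setT D by exact: measurable_funB.
pose W w := expR (2 * c * `|B t w|) + expR (2 * c * `|B u w|) + 128 * expR (s^-1 * `|D w|).
have W0 w : 0 <= W w by rewrite /W !addr_ge0 ?mulr_ge0 ?expR_ge0.
pose L := 2 * C * (1 + r ^+ 2) * (s ^+ 2 + (u - t) ^+ 2).
have L0 : 0 <= L by rewrite /L !mulr_ge0// addr_ge0// sqr_ge0.
have mexpD : measurable_fun setT (fun w => (expR (s^-1 * `|D w|))%:E).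
  by apply: measurable_fun_expRM; exact: measurableT_comp.
have mW : measurable_fun setT (EFin \o W).
  rewrite (_ : EFin \o W = fun w => ((expR (2 * c * `|B t w|))%:E +
    (expR (2 * c * `|B u w|))%:E + 128%:E * (expR (s^-1 * `|D w|))%:E)%E)//.
  by apply: emeasurable_funD; [apply: emeasurable_funD; exact: mexp|exact: emeasurable_funM].
have main w : C * (expR (c * `|B t w|) + expR (c * `|B u w|)) *
    (B u w + r * u - (B t w + r * t)) ^+ 2 <= L * W w.
  set et := expR (c * `|B t w|); set eu := expR (c * `|B u w|).
  have et2 : expR (2 * c * `|B t w|) = et ^+ 2 by rewrite -mulrA -expRM_natl.
  have eu2 : expR (2 * c * `|B u w|) = eu ^+ 2 by rewrite -mulrA -expRM_natl.
  have t1 : 1 <= et by rewrite -expR0 ler_expR mulr_ge0.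
  have u1 : 1 <= eu by rewrite -expR0 ler_expR mulr_ge0.
  pose y := s^-1 * `|D w|; pose ey := expR y.
  have y0 : 0 <= y by rewrite mulr_ge0// invr_ge0 ltW.
  have y4 : y ^+ 4 <= 256 * ey.
    have -> : ey = expR (y / 4) ^+ 4 by rewrite -expRM_natl; congr expR; field.
    have -> : y ^+ 4 = 256 * (y / 4) ^+ 4 by field.
    apply: ler_wpM2l; first exact: ler0n.
    apply: lerXn2r; [by rewrite nnegrE; apply: divr_ge0; last exact: ler0n|by rewrite nnegrE expR_ge0|].
    by apply: le_trans (expR_ge1Dx _); rewrite lerDr.
  have D2 : D w ^+ 2 = s ^+ 2 * y ^+ 2.
    by rewrite -(real_normK (num_real (D w))) /y exprMn mulrA -exprMn divff ?expr1n ?mul1r// gt_eqF.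
  have -> : B u w + r * u - (B t w + r * t) = D w + r * (u - t) by rewrite /D; ring.
  rewrite /W et2 eu2 -/y -/ey.
  have q1 : (D w + r * (u - t)) ^+ 2 <= 2 * (s ^+ 2 * y ^+ 2 + r ^+ 2 * (u - t) ^+ 2).
    by rewrite -D2; have := sqr_ge0 (D w - r * (u - t)); rewrite !expr2; lra.
  have q2 : (et + eu) * y ^+ 2 <= et ^+ 2 + eu ^+ 2 + 128 * ey.
    have h1 := sqr_ge0 (et + eu - y ^+ 2); have h2 := sqr_ge0 (et - eu).
    have y44 : y ^+ 4 = y ^+ 2 * y ^+ 2 by rewrite -exprD.
    by rewrite y44 in y4; move: h1 h2 y4; rewrite !expr2; lra.
  have q3 : et + eu <= et ^+ 2 + eu ^+ 2 + 128 * ey.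
    have : 0 <= ey by exact: expR_ge0.
    by rewrite !expr2; nra.
  move: q2 q3; set Q := et ^+ 2 + eu ^+ 2 + 128 * ey => q2 q3.
  have s20 : 0 <= s ^+ 2 by exact: sqr_ge0.
  have k20 : 0 <= (u - t) ^+ 2 by exact: sqr_ge0.
  have r20 : 0 <= r ^+ 2 by exact: sqr_ge0.
  have Q0 : 0 <= Q by apply: le_trans q3; lra.
  apply: (@le_trans _ _ (C * (et + eu) * (2 * (s ^+ 2 * y ^+ 2 + r ^+ 2 * (u - t) ^+ 2)))).
    by apply: ler_wpM2l => //; rewrite mulr_ge0//; lra.
  have -> : C * (et + eu) * (2 * (s ^+ 2 * y ^+ 2 + r ^+ 2 * (u - t) ^+ 2)) =
     2 * C * (s ^+ 2 * ((et + eu) * y ^+ 2) + r ^+ 2 * (u - t) ^+ 2 * (et + eu)) by ring.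
  have -> : L * Q = 2 * C * ((1 + r ^+ 2) * (s ^+ 2 + (u - t) ^+ 2) * Q) by rewrite /L; ring.
  apply: ler_wpM2l; first exact: mulr_ge0.
  apply: (@le_trans _ _ (s ^+ 2 * Q + r ^+ 2 * (u - t) ^+ 2 * Q)).
    apply: lerD; first exact: ler_wpM2l.
    by apply: ler_wpM2l; [exact: mulr_ge0|].
  rewrite -mulrDl; apply: ler_wpM2r => //.
  have : 0 <= r ^+ 2 * s ^+ 2 by exact: mulr_ge0.
  lra.
apply: (@le_trans _ _ (\int[P]_w (L%:E * (W w)%:E))%E).
  apply: ae_ge0_le_integral => //.
  - by apply/measurable_EFinP; exact: measurableT_comp.
  - by move=> w _; rewrite -EFinM lee_fin mulr_ge0.
  - exact: emeasurable_funM.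
  - by apply: filterS fb => w h _; rewrite -EFinM lee_fin; exact: le_trans h (main w).
rewrite ge0_integralZl//; last by move=> w _; rewrite lee_fin.
apply: (@le_trans _ _ (L%:E * M0%:E)%E); last first.
  by rewrite -EFinM lee_fin /L s2 le_eqVlt; apply/orP; left; apply/eqP; ring.
apply: lee_wpmul2l; first by rewrite lee_fin.
rewrite /W /M0; under eq_integral do rewrite !EFinD EFinM.
rewrite ge0_integralD//=; last 3 first.
- by move=> w _; rewrite -EFinD lee_fin addr_ge0 ?expR_ge0.
- by apply: emeasurable_funD; exact: mexp.
- exact: emeasurable_funM.
rewrite ge0_integralD//= ge0_integralZl//=.
have c20 : 0 <= 2 * c by rewrite mulr_ge0.
rewrite [leRHS]EFinD; apply: leeD.
  by rewrite [leRHS]EFinD; apply: leeD; exact: (fbm_exp_abs H01 hB).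
rewrite EFinM; apply: lee_wpmul2l; first by rewrite lee_fin.
have := centered_gaussian_exp_abs (measurable_fbm_comb B 1 (-1) u t)
  (fbm_comb_gaussian hB 1 (-1) uT tT) (fbm_comb_mean hB 1 (-1) uT tT)
  (fbm_incr_sqr H01 hB uT tT) (a := s^-1).
rewrite invr_ge0 ltW// => /(_ isT); rewrite -s2 -DE.
by rewrite exprVn mulVf ?expf_neq0 ?gt_eqF// mul1r.
Qed.

End moments.

(** * Stochastic derivatives of the solution *)

Section quotient.
Context {d : measure_display} {Omega : measurableType d} {R : realType}.
Variables (P : probability Omega R) (T H x0 r K : R) (sigma G : R -> R).
Variables (B X : R -> {RV P >-> R}).
Hypotheses (T0 : 0 < T) (H01 : 1 / 2 < H < 1).
Hypothesis hB : fractional_brownian_motion T H B.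
Hypothesis sigma_lip : forall x y, `|sigma x - sigma y| <= K * `|x - y|.
Hypotheses (G_scale : is_scale sigma G x0) (G0 : G x0 = 0).
Hypothesis hX : {ae P, forall w, forall s, 0 <= s <= T ->
  scale_domain sigma x0 (X s w) /\ G (X s w) = B s w + r * s}.

Let msX (s : R) : measurable_fun setT (fun w => sigma (X s w)).
Proof.
apply: measurableT_comp => //; apply: continuous_measurable_fun.
exact: lipschitz_continuous sigma_lip.
Qed.

Lemma solution_L2 : L2_process P T X.
Proof.
have [c [C [c0 C0 hp _]]] := solution_pointwise r T sigma_lip G_scale G0.
move=> s sT; apply: Lfun2_of_sqr => //.
apply: (integrable_exp_bound H01 hB (f := fun w => X s w ^+ 2) _ sT sT c0 C0).
  exact: measurable_funX.
apply: filterS hX => w hw; have sI : 0 <= s <= T by move: sT; rewrite in_itv.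
have [ds Gs] := hw s sI; have [_ h _] := hp _ _ _ ds Gs sI.
rewrite ger0_norm ?sqr_ge0//; apply: le_trans h _.
by apply: ler_wpM2l => //; rewrite lerDl expR_ge0.
Qed.

Variable t : R.
Hypothesis t0T : 0 < t < T.

Let tI : 0 <= t <= T. Proof. by case/andP : t0T => h1 h2; rewrite !ltW. Qed.
Let tT : t \in `[0, T]. Proof. by rewrite in_itv. Qed.
Let t0 : 0 < t. Proof. by case/andP : t0T. Qed.

Let integrable_sigma (u : R) (f : Omega -> R) (L : R) : u \in `[0, T] -> 0 <= L ->
  measurable_fun setT f -> (forall w, `|f w| <= L * (1 + `|B t w| + `|B u w|)) ->
  P.-integrable setT (fun w => (sigma (X t w) * f w)%:E).
Proof.
move=> uT L0 mf fL; have [c [C [c0 C0 hp _]]] := solution_pointwise r T sigma_lip G_scale G0.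
have a0 : 0 <= 2 * (c + 1) by rewrite mulr_ge0// addr_ge0.
have CL0 : 0 <= C * L by exact: mulr_ge0.
apply: (integrable_exp_bound H01 hB (f := fun w => sigma (X t w) * f w) _ tT uT a0 CL0).
  exact: measurable_funM.
apply: filterS hX => w hw; have [ds Gs] := hw t tI; have [_ _ h] := hp _ _ _ ds Gs tI.
rewrite normrM; apply: le_trans (ler_pM _ _ h (fL w)) _ => //.
set bt := `|B t w|; set bu := `|B u w|.
rewrite mulrACA; apply: ler_wpM2l => //.
have bt0 : 0 <= bt by exact: normr_ge0.
have bu0 : 0 <= bu by exact: normr_ge0.
have h1 : 1 + bt + bu <= expR bt * expR bu.
  have := expR_ge1Dx bt; have := expR_ge1Dx bu; set x := expR bt; set y := expR bu => *.
  by nra.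
apply: le_trans (ler_wpM2l (expR_ge0 _) h1) _.
rewrite -!expRD.
have [btu|/ltW but] := leP bt bu.
  apply: (@le_trans _ _ (expR (2 * (c + 1) * bu))); last by rewrite lerDr expR_ge0.
  rewrite ler_expR; have : c * bt <= c * bu by exact: ler_wpM2l.
  have : 0 <= c * bu by exact: mulr_ge0.
  by lra.
apply: (@le_trans _ _ (expR (2 * (c + 1) * bt))); last by rewrite lerDl expR_ge0.
rewrite ler_expR; have : 0 <= c * bt by exact: mulr_ge0.
by lra.
Qed.

Let integrable_X (s : R) : s \in `[0, T] -> P.-integrable setT (fun w => (X s w)%:E).
Proof.
move=> sT; have [c [C [c0 C0 hp _]]] := solution_pointwise r T sigma_lip G_scale G0.
apply: (integrable_exp_bound H01 hB (f := X s) _ sT sT c0 C0) => //.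
apply: filterS hX => w hw; have sI : 0 <= s <= T by move: sT; rewrite in_itv.
have [ds Gs] := hw s sI; have [h _ _] := hp _ _ _ ds Gs sI.
apply: le_trans h _.
by apply: ler_wpM2l => //; rewrite lerDl expR_ge0.
Qed.

Let D w := H * t^-1 * sigma (X t w) * B t w + r * sigma (X t w).

Let S := (fine (\int[P]_w (`|sigma (X t w) * B t w|)%:E))%E.

Let integrable_sB : P.-integrable setT (fun w => (sigma (X t w) * B t w)%:E).
Proof.
apply: (@integrable_sigma t _ 1) => // w.
by have := normr_ge0 (B t w); rewrite mul1r; lra.
Qed.

Lemma innov_sigma_orthogonal (u : R) (A : set R) : u \in `[0, T] -> measurable A ->
  (\int[P]_(w in X t @^-1` A) (sigma (X t w) * fbm_innov H B t u w)%:E = 0)%E.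
Proof.
move=> uT mA.
have iX : P.-integrable setT (EFin \o fbm_innov H B t u) := fbm_innov_integrable hB tT uT.
have mXt : measurable_fun setT (X t) by [].
have isx : P.-integrable setT (fun w => (sigma (X t w) * fbm_innov H B t u w)%:E).
  apply: (@integrable_sigma u _ (`|fbm_coef H t u| + 1)) => //.
    exact: measurable_fbm_comb.
  move=> w; rewrite /fbm_innov /fbm_comb mul1r mulNr addrC.
  apply: le_trans (ler_normB _ _) _; rewrite normrM.
  have := normr_ge0 (B t w); have := normr_ge0 (B u w); have := normr_ge0 (fbm_coef H t u).
  set x := `|B t w|; set y := `|B u w|; set z := `|fbm_coef H t u| => z0 y0 x0'.
  by nra.
have rays : forall A : set R, measurable A ->
    (\int[P]_w (\1_A (X t w) * fbm_innov H B t u w)%:E = 0)%E.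
  apply: rays_orthogonal => //; first exact: (fbm_comb_mean hB).
  move=> c; have [E mE hE] := scale_rays G_scale c.
  pose E' := [set x | E (x + r * t)].
  have mE' : measurable E'.
    rewrite -[E']setTI; apply: (_ : measurable_fun setT (fun x : R => x + r * t)) => //.
    exact: measurable_funD.
  rewrite -(innov_orthogonal H01 hB t0 tT uT mE').
  apply: ae_eq_integral => //.
  - exact: measurable_int (integrable_indic_mul mXt iX _).
  - have mBt : measurable_fun setT (B t) by [].
    exact: measurable_int (integrable_indic_mul mBt iX mE').
  - apply: filterS hX => w hw _; have [ds Gs] := hw t tI.
    congr (_ * _)%:E; rewrite !indicE; congr (_%:R); congr nat_of_bool.
    apply/idP/idP; rewrite !inE/= in_itv/= andbT /E'/= => h.
      by rewrite -Gs; apply/hE.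
    by apply/(hE _ ds); rewrite Gs.
rewrite (integral_preimage_indic P (X t) (fun w => sigma (X t w) * fbm_innov H B t u w)).
under eq_integral do rewrite mulrA.
have m1A : measurable_fun setT (fun x => \1_A x * sigma x : R).
  apply: measurable_funM; first exact: measurable_indic.
  by apply: continuous_measurable_fun; exact: lipschitz_continuous sigma_lip.
apply: (fun_orthogonal mXt iX rays m1A).
have := integrable_indic_mul mXt isx mA.
by apply: eq_integrable => // w _; rewrite mulrA.
Qed.

Lemma quotient_cond_exp : exists2 M, 0 <= M & forall k : R, t + k \in `[0, T] -> k != 0 ->
  exists2 V, is_cond_exp P (present X t) (diff_quot k X t) V &
    forall delta, 0 < delta -> (P [set w | (delta <= `|V w - D w|)%R] <=
      (delta^-1 * (`|k|^-1 * (M * (`|k| `^ (2 * H) + k ^+ 2)) +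
        `|(fbm_coef H t (t + k) - 1) / k - H / t| * S))%:E)%E.
Proof.
have [c [C [c0 C0 hp htaylor]]] := solution_pointwise r T sigma_lip G_scale G0.
have [M M0 hM] := fbm_remainder_bound H01 hB r tT c0 C0.
exists M => // k; set u := t + k => uT k0.
have uI : 0 <= u <= T by move: uT; rewrite in_itv.
have uk : u - t = k by rewrite /u addrC addKr.
have ut : u != t by rewrite -subr_eq0 uk.
have ak0 : 0 < `|k| by rewrite normr_gt0.
pose rem w := X u w - X t w - sigma (X t w) * (B u w + r * u - (B t w + r * t)).
have mrem : measurable_fun setT rem.
  apply: measurable_funB; first exact: measurable_funB.
  apply: measurable_funM => //.
  by apply: measurable_funB; apply: measurable_funD.
have remB : (\int[P]_w (`|rem w|)%:E <= (M * (`|k| `^ (2 * H) + k ^+ 2))%:E)%E.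
  rewrite -uk; apply: hM => //; apply: filterS hX => w hw.
  have [dt Gt] := hw t tI; have [du Gu] := hw u uI.
  have := htaylor _ _ _ _ _ _ dt Gt tI du Gu uI.
  by rewrite Gt Gu.
have irem : P.-integrable setT (EFin \o rem).
  apply/integrableP; split; first exact/measurable_EFinP.
  by apply: le_lt_trans remB _; rewrite ltry.
pose remk w := k^-1 * rem w.
have iremk : P.-integrable setT (EFin \o remk).
  rewrite (_ : EFin \o remk = fun w => (k^-1%:E * (rem w)%:E)%E)//.
  exact: integrableZl.
have [v [mv iv vrem]] := cond_exp_exists (X t) iremk.
have vB : (\int[P]_w (`|v (X t w)|)%:E <= (`|k|^-1 * (M * (`|k| `^ (2 * H) + k ^+ 2)))%:E)%E.
  apply: le_trans (integrable_comp_indic iremk mv iv vrem) _.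
  under eq_integral do rewrite normrM normfV EFinM.
  rewrite ge0_integralZl//.
  - by rewrite [leRHS]EFinM; apply: lee_wpmul2l => //; rewrite lee_fin invr_ge0.
  - by apply/measurable_EFinP; exact: measurableT_comp.
pose rho := fbm_coef H t u.
pose g x := sigma x * (r + (rho - 1) / k * ((G \_ (scale_domain sigma x0)) x - r * t)).
have mg : measurable_fun setT g.
  apply: measurable_funM.
    by apply: continuous_measurable_fun; exact: lipschitz_continuous sigma_lip.
  apply: measurable_funD => //; apply: measurable_funM => //; apply: measurable_funB => //.
  exact: measurable_scale.
have GX : {ae P, forall w, (G \_ (scale_domain sigma x0)) (X t w) = B t w + r * t}.
  apply: filterS hX => w hw; have [dt Gt] := hw t tI.
  by rewrite patchE mem_set.
pose g' w := sigma (X t w) * (r + (rho - 1) / k * B t w).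
have mg' : measurable_fun setT g'.
  by apply: measurable_funM => //; apply: measurable_funD => //; exact: measurable_funM.
have gg' : {ae P, forall w, g (X t w) = g' w}.
  by apply: filterS GX => w h; rewrite /g /g' h addrK.
have ig' : P.-integrable setT (EFin \o g').
  apply: (@integrable_sigma t _ (`|r| + `|(rho - 1) / k|)) => //.
  - by apply: measurable_funD => //; exact: measurable_funM.
  - move=> w; apply: le_trans (ler_normD _ _) _; rewrite normrM.
    have := normr_ge0 (B t w); have := normr_ge0 r; have := normr_ge0 ((rho - 1) / k).
    by set x := `|B t w|; set y := `|r|; set z := `|_ / k| => *; nra.
have mgX : measurable_fun setT (fun w => g (X t w)) by exact: measurableT_comp.
have igX : P.-integrable setT (fun w => (g (X t w))%:E).
  have [_ ig'2] := integrableP _ _ _ ig'.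
  apply/integrableP; split; first exact/measurable_EFinP.
  rewrite (ae_eq_integral (fun w => `|(g' w)%:E|%E))//.
  - by apply: measurableT_comp => //; exact/measurable_EFinP.
  - by apply: measurableT_comp => //; exact/measurable_EFinP.
  - by apply: filterS gg' => w h _; rewrite h.
pose Y := diff_quot k X t.
have iY : P.-integrable setT (EFin \o Y).
  rewrite (_ : EFin \o Y = fun w => (k^-1%:E * ((X u w)%:E - (X t w)%:E))%E); last first.
    by apply/funext => w; rewrite /= -EFinB -EFinM mulrC.
  by apply: integrableZl => //; apply: integrableB => //; exact: integrable_X.
have mY : measurable_fun setT (EFin \o Y) by exact: measurable_int iY.
pose Z w := sigma (X t w) * fbm_innov H B t u w.
have YE w : Y w = g' w + k^-1 * Z w + remk w.
  rewrite /Y /diff_quot -/u /g' /Z /remk /rem /fbm_innov /fbm_comb -/rho -uk.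
  by field; rewrite uk.
have iZ : P.-integrable setT (fun w => (k^-1 * Z w)%:E).
  have := integrableB measurableT (integrableB measurableT iY ig') iremk.
  apply: eq_integrable => // w _ /=; rewrite -!EFinB YE; congr (_%:E); ring.
exists (fun w => g (X t w) + v (X t w)).
  apply: (present_cond_exp (v := fun x => g x + v x)) => //.
  - exact: measurable_funD.
  - rewrite (_ : (fun w => _) = fun w => ((g (X t w))%:E + (v (X t w))%:E)%E)//.
    exact: integrableD.
  - move=> A mA; have mXA : measurable (X t @^-1` A).
      by rewrite -[X in measurable X]setTI; exact: (_ : measurable_fun setT (X t)).
    have iS (f : Omega -> R) : P.-integrable setT (fun w => (f w)%:E) ->
        P.-integrable (X t @^-1` A) (fun w => (f w)%:E) by move=> h; exact: integrableS h.
    under eq_integral do rewrite EFinD.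
    rewrite integralD//=; [|exact: (iS (g \o X t))|exact: (iS (v \o X t))].
    rewrite vrem//.
    have -> : (\int[P]_(w in X t @^-1` A) (diff_quot k X t w)%:E =
       \int[P]_(w in X t @^-1` A) (((g' w)%:E + (k^-1 * Z w)%:E) + (remk w)%:E))%E.
      by apply: eq_integral => w _; rewrite -/(Y w) YE !EFinD.
    rewrite integralD//=; [|by apply: integrableD => //; exact: iS|exact: iS].
    rewrite integralD//=; [|exact: iS|exact: iS].
    have -> : (\int[P]_(w in X t @^-1` A) (k^-1 * Z w)%:E = 0)%E.
      have iZ' : P.-integrable setT (EFin \o Z).
        have := integrableZl measurableT k iZ; apply: eq_integrable => // w _ /=.
        by rewrite -EFinM mulrA divff ?mul1r.
      under eq_integral do rewrite EFinM.
      rewrite integralZl//; last exact: iS.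
      by rewrite innov_sigma_orthogonal// mule0.
    rewrite adde0; congr (_ + _)%E; apply: ae_eq_integral => //.
    + by apply: measurable_funTS; exact/measurable_EFinP.
    + by apply: measurable_funTS; exact/measurable_EFinP.
    + by apply: filterS gg' => w h _; rewrite h.
move=> delta d0.
have mD : measurable_fun setT D.
  by apply: measurable_funD; [apply: measurable_funM => //|]; exact: measurable_funM.
have mV : measurable_fun setT (fun w => g (X t w) + v (X t w)).
  by apply: measurable_funD => //; exact: measurableT_comp.
have mVD : measurable_fun setT (fun w => `|g (X t w) + v (X t w) - D w|).
  by apply: measurableT_comp => //; exact: measurable_funB.
have mset : measurable [set w | delta <= `|g (X t w) + v (X t w) - D w|].
  by rewrite -[X in measurable X]setTI; exact: measurable_fun_le.
apply: le_trans (markov_real P d0 mset mVD _ _) _ => //.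
rewrite [leRHS]EFinM; apply: lee_wpmul2l; first by rewrite lee_fin invr_ge0 ltW.
pose ck := (rho - 1) / k - H / t.
have msB : measurable_fun setT (fun w => (`|sigma (X t w) * B t w|)%:E).
  by apply/measurable_EFinP; apply: measurableT_comp => //; exact: measurable_funM.
have mvX : measurable_fun setT (fun w => (`|v (X t w)|)%:E).
  apply/measurable_EFinP; apply: measurableT_comp => //.
  exact: measurableT_comp.
apply: (@le_trans _ _ (\int[P]_w ((`|v (X t w)|)%:E + `|ck|%:E * (`|sigma (X t w) * B t w|)%:E))%E).
  apply: ae_ge0_le_integral => //.
  - exact/measurable_EFinP.
  - by move=> w _; rewrite adde_ge0.
  - by apply: emeasurable_funD => //; exact: emeasurable_funM.
  - apply: filterS gg' => w h _; rewrite -EFinM -EFinD lee_fin h.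
    have -> : g' w + v (X t w) - D w = v (X t w) + ck * (sigma (X t w) * B t w).
      by rewrite /g' /D /ck; ring.
    by rewrite -normrM; exact: ler_normD.
rewrite ge0_integralD//; last exact: emeasurable_funM.
rewrite EFinD; apply: leeD => //.
rewrite ge0_integralZl// [leRHS]EFinM -/rho -/ck; apply: lee_wpmul2l => //.
rewrite /S fineK//; apply: integrable_fin_num => //.
exact: (integrable_abse integrable_sB).
Qed.

End quotient.

Lemma powR_norm_cvg0 (R : realType) (p : R) : 0 < p -> `|k| `^ p @[k --> (0 : R)^'] --> 0.
Proof.
move=> p0; apply: cvg_comp (powR_cvg0 p0) => A [e /= e0 hA].
near=> k; apply: hA => /=.
  by rewrite sub0r normrN normr_id; near: k; exact: dnbhs0_lt.
by rewrite normr_gt0; near: k; exact: nbhs_dnbhs_neq.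
Unshelve. all: by end_near. Qed.

Lemma fbm_coef_quotient (R : realType) (H t : R) : 1 / 2 < H < 1 -> 0 < t ->
  (fbm_coef H t (t + k) - 1) / k @[k --> 0^'] --> H / t.
Proof.
move=> H01 t0; have HH := H01.
pose a := 2 * H; have a1 : 0 < a - 1 by rewrite /a; lra.
pose c := (2 * t `^ a)^-1.
have ta0 : t `^ a != 0 by rewrite gt_eqF ?powR_gt0.
have dpow : (fun k => k^-1 *: ((t + k) `^ a - t `^ a)) @ 0^' --> a * t `^ (a - 1).
  have [hl <-] := is_derive1_powR a t0.
  apply: cvg_trans hl; apply: near_eq_cvg; apply: nearW => k.
  by rewrite /= [k *: 1]mulr1 [k + t]addrC.
have dnorm : (fun k : R => `|k| `^ a / k) @ 0^' --> 0.
  apply/cvgr0Pnorm_lt => e e0.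
  have := powR_norm_cvg0 a1; move=> /cvgr0Pnorm_lt/(_ _ e0) h.
  have hn : \forall k \near (0 : R)^', k != 0 by exact: nbhs_dnbhs_neq.
  apply: filterS (filterI h hn) => k [hk k0].
  rewrite normrM normfV ger0_norm ?powR_ge0//.
  have -> : `|k| `^ a = `|k| `^ (a - 1) * `|k|.
    by rewrite -{3}(powRr1 (normr_ge0 k)) -powRD ?subrK// normr_eq0 k0 implybT.
  by rewrite mulfK ?normr_eq0//; move: hk; rewrite ger0_norm ?powR_ge0.
have -> : H / t = c * (a * t `^ (a - 1) - 0).
  have : t `^ a = t `^ (a - 1) * t.
    by rewrite -{3}(powRr1 (ltW t0)) -powRD ?subrK// (gt_eqF t0) implybT.
  rewrite /c => E; rewrite E /a; field.
  by rewrite !gt_eqF ?powR_gt0.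
have : (fun k => c * (k^-1 *: ((t + k) `^ a - t `^ a) - `|k| `^ a / k)) @ 0^' -->
    c * (a * t `^ (a - 1) - 0).
  by apply: cvgM; [exact: cvg_cst|exact: cvgB].
apply: cvg_trans; apply: near_eq_cvg.
have hn : \forall k \near (0 : R)^', k != 0 by exact: nbhs_dnbhs_neq.
apply: filterS hn => k k0.
rewrite /fbm_coef /fbm_cov -/a [k^-1 *: _]mulrC /c.
have -> : t + k - t = k by ring.
field.
by rewrite ta0 k0.
Qed.

Lemma at_right0_dnbhs (R : realType) (A : set R) :
  (\forall k \near 0^', A k) -> \forall h \near 0^'+, A h.
Proof.
move=> [e /= e0 hA]; near=> k; apply: hA => /=; have k0 : 0 < k by near: k; exact: nbhs_right_gt.
  by rewrite sub0r normrN gtr0_norm//; near: k; exact: nbhs_right_lt.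
by rewrite gt_eqF.
Unshelve. all: by end_near. Qed.

Lemma at_right0_opp_dnbhs (R : realType) (A : set R) :
  (\forall k \near 0^', A k) -> \forall h \near 0^'+, A (- h).
Proof.
move=> [e /= e0 hA]; near=> k; apply: hA => /=; have k0 : 0 < k by near: k; exact: nbhs_right_gt.
  by rewrite sub0r opprK gtr0_norm//; near: k; exact: nbhs_right_lt.
by rewrite oppr_eq0 gt_eqF.
Unshelve. all: by end_near. Qed.

Section derivative.
Context {d : measure_display} {Omega : measurableType d} {R : realType}.
Variables (P : probability Omega R) (T H x0 r K : R) (sigma G : R -> R).
Variables (B X : R -> {RV P >-> R}).
Hypotheses (T0 : 0 < T) (H01 : 1 / 2 < H < 1).
Hypothesis hB : fractional_brownian_motion T H B.
Hypothesis sigma_lip : forall x y, `|sigma x - sigma y| <= K * `|x - y|.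
Hypotheses (G_scale : is_scale sigma G x0) (G0 : G x0 = 0).
Hypothesis hX : {ae P, forall w, forall s, 0 <= s <= T ->
  scale_domain sigma x0 (X s w) /\ G (X s w) = B s w + r * s}.
Variable t : R.
Hypothesis t0T : 0 < t < T.

Let D w := H * t^-1 * sigma (X t w) * B t w + r * sigma (X t w).

Lemma present_derivative : exists V : R -> Omega -> R,
  (\forall k \near 0^', is_cond_exp P (present X t) (diff_quot k X t) (V k)) /\
  forall delta, 0 < delta ->
    P [set w | (delta <= `|V k w - D w|)%R] @[k --> 0^'] --> 0%E.
Proof.
have [M M0 hM] := quotient_cond_exp H01 hB sigma_lip G_scale G0 hX t0T.
case/andP: t0T => t0 tT; have HH := H01.
move: hM; set S := fine _ => hM.
pose bnd (k : R) : R := `|k|^-1 * (M * (`|k| `^ (2 * H) + k ^+ 2)) +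
        `|(fbm_coef H t (t + k) - 1) / k - H / t| * S.
pose good (k : R) (V : Omega -> R) := t + k \in `[0, T] -> k != 0 ->
  is_cond_exp P (present X t) (diff_quot k X t) V /\
  forall delta, 0 < delta -> (P [set w | (delta <= `|V w - D w|)%R] <=
      (delta^-1 * bnd k)%:E)%E.
have /choice[V hV] : forall k, exists V, good k V.
  move=> k; have [kT|kT] := boolP (t + k \in `[0, T]); last first.
    by exists (fun=> 0) => h; exfalso; move/negP: kT; apply.
  have [k0|k0] := eqVneq k 0; first by exists (fun=> 0) => _; rewrite k0 eqxx.
  by have [V h1 h2] := hM k kT k0; exists V.
have nT : \forall k \near (0 : R)^', t + k \in `[0, T].
  have m0 : 0 < Num.min t (T - t) by rewrite lt_min t0 subr_gt0.
  apply: filterS (dnbhs0_lt m0) => k; rewrite lt_min !ltr_norml => /andP[/andP[h1 h2] /andP[h3 h4]].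
  by rewrite in_itv/=; apply/andP; split; lra.
have n0 : \forall k \near (0 : R)^', k != 0 by exact: nbhs_dnbhs_neq.
exists V; split.
  by apply: filterS (filterI nT n0) => k [h1 h2]; exact: (hV k h1 h2).1.
move=> delta delta0.
have bnd0 : bnd @ 0^' --> 0.
  suff : bnd @ 0^' --> M * (0 + 0) + 0 * S by rewrite addr0 mulr0 add0r mul0r.
  have c1 : (fun k : R => M * (`|k| `^ (2 * H - 1) + `|k|)) @ 0^' --> M * (0 + 0).
    apply: cvgM; first exact: cvg_cst.
    apply: cvgD; first by apply: powR_norm_cvg0; lra.
    by apply/cvgr0Pnorm_lt => e e0; apply: filterS (dnbhs0_lt e0) => k; rewrite normr_id.
  have c2 : (fun k : R => `|(fbm_coef H t (t + k) - 1) / k - H / t| * S) @ 0^' --> 0 * S.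
    apply: cvgM; last exact: cvg_cst.
    have := cvg_norm (cvgB (fbm_coef_quotient H01 t0) (cvg_cst (H / t))).
    by rewrite subrr normr0; exact.
  apply: cvg_trans (cvgD c1 c2); apply: near_eq_cvg.
  apply: filterS n0 => k k0 /=; rewrite /bnd; congr (_ + _).
  have -> : `|k| `^ (2 * H) = `|k| * `|k| `^ (2 * H - 1).
    rewrite -{2}(powRr1 (normr_ge0 k)) -powRD; first by congr (_ `^ _); ring.
    by rewrite normr_eq0 k0 implybT.
  rewrite -(real_normK (num_real k)); field.
  by rewrite normr_eq0.
apply: (@squeeze_cvge _ _ _ _ (cst 0%E) _ (fun k => (delta^-1 * bnd k)%:E)).
- apply: filterS (filterI nT n0) => k [h1 h2]; rewrite measure_ge0/=.
  exact: (hV k h1 h2).2.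
- exact: cvg_cst.
- apply: cvg_EFin; first exact: nearW.
  by have := cvgM (cvg_cst delta^-1) bnd0; rewrite mulr0; exact.
Qed.

Let mD : measurable_fun setT D.
Proof.
have ms : measurable_fun setT (fun w => sigma (X t w)).
  apply: measurableT_comp => //; apply: continuous_measurable_fun.
  exact: lipschitz_continuous sigma_lip.
by apply: measurable_funD; [apply: measurable_funM => //|]; exact: measurable_funM.
Qed.

Lemma present_fwd_deriv : is_fwd_deriv P T X t (present X t) D.
Proof.
have [V [cV dV]] := present_derivative.
split => //.
- exact: (solution_L2 H01 hB sigma_lip G_scale G0 hX).
- exact: present_sub_sigma_field.
- exists V; first exact: at_right0_dnbhs cV.
  by move=> delta d0 A /(dV _ d0) /at_right0_dnbhs.
Qed.

Lemma present_bwd_deriv : is_bwd_deriv P T X t (present X t) D.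
Proof.
have [V [cV dV]] := present_derivative.
split => //.
- exact: (solution_L2 H01 hB sigma_lip G_scale G0 hX).
- exact: present_sub_sigma_field.
- exists (fun h => V (- h)); first exact: at_right0_opp_dnbhs cV.
  by move=> delta d0 A /(dV _ d0) /at_right0_opp_dnbhs.
Qed.

End derivative.

Section uniqueness.
Context {d : measure_display} {Omega : measurableType d} {R : realType}.
Variable P : probability Omega R.

Lemma cond_exp_limit_unique (A : set (set Omega)) (Y V V' : R -> Omega -> R) (D D' : Omega -> R) :
  sub_sigma_field A -> measurable_fun setT D -> measurable_fun setT D' ->
  (\forall h \near 0^'+, is_cond_exp P A (Y h) (V h)) ->
  (\forall h \near 0^'+, is_cond_exp P A (Y h) (V' h)) ->
  cvg_in_prob P V D -> cvg_in_prob P V' D' -> {ae P, forall w, D w = D' w}.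
Proof.
move=> sA mD mD' hV hV'; apply: cvg_in_prob_unique => //.
have mV (Y0 V0 : Omega -> R) : is_cond_exp P A Y0 V0 -> measurable_fun setT V0.
  by move=> [_ iV _ _]; apply/measurable_EFinP; exact: measurable_int iV.
apply: filterS (filterI hV hV') => h [h1 h2]; split; first exact: mV h1.
by split; [exact: mV h2|exact: cond_exp_unique sA h1 h2].
Qed.

Lemma fwd_deriv_unique T (Z : R -> Omega -> R) t A D D' :
  is_fwd_deriv P T Z t A D -> is_fwd_deriv P T Z t A D' -> {ae P, forall w, D w = D' w}.
Proof.
move=> [_ sA mD [V hV cV]] [_ _ mD' [V' hV' cV']].
exact: cond_exp_limit_unique sA mD mD' hV hV' cV cV'.
Qed.

Lemma bwd_deriv_unique T (Z : R -> Omega -> R) t A D D' :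
  is_bwd_deriv P T Z t A D -> is_bwd_deriv P T Z t A D' -> {ae P, forall w, D w = D' w}.
Proof.
move=> [_ sA mD [V hV cV]] [_ _ mD' [V' hV' cV']].
exact: cond_exp_limit_unique sA mD mD' hV hV' cV cV'.
Qed.

Lemma prob_eq_lt1 (D : Omega -> R) (c : R) : measurable_fun setT D ->
  (P [set w | D w = c] < 1)%E <-> ~ {ae P, forall w, D w = c}.
Proof.
move=> mD; pose E := [set w | D w = c].
have mE : measurable E by rewrite -[E]setTI; exact: (mD measurableT [set c]).
have ae_iff : {ae P, forall w, D w = c} <-> P (~` E) = 0%E.
  split=> [|h].
    by move=> /negligibleP -> //; exact: measurableC.
  by exists (~` E); split => //; exact: measurableC.
have PE : (P (~` E) = 1 - P E)%E by rewrite probability_setC.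
rewrite -/E; split=> [|h1].
  move=> + /ae_iff; rewrite PE -(fineK (fin_num_measure P _ mE)) -EFinB lte_fin => h1 [h].
  by move/eqP: h; rewrite subr_eq0 (gt_eqF h1).
rewrite ltNge; apply/negP => h2; apply: h1; apply/ae_iff.
have -> : P (~` E) = (1 - 1)%E; last by rewrite subee.
by rewrite PE; congr (_ - _)%E; apply/eqP; rewrite eq_le probability_le1.
Qed.

End uniqueness.

Lemma normal_prob_itv_gt0 (R : realType) (s a b : R) : s != 0 -> a < b ->
  (0 < normal_prob 0 s `[a, b])%E.
Proof.
move=> s0 ab; pose e := normal_peak s * expR (- ((`|a| + `|b|) ^+ 2 / (s ^+ 2 *+ 2))).
have e0 : 0 < e by rewrite mulr_gt0 ?expR_gt0 ?normal_peak_gt0.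
apply: (@lt_le_trans _ _ (e * (b - a))%:E); first by rewrite lte_fin mulr_gt0 ?subr_gt0.
rewrite /normal_prob.
apply: (@le_trans _ _ (\int[lebesgue_measure]_(x in `[a, b]) e%:E)%E).
  rewrite integral_cst//= lebesgue_measure_itv/= lte_fin ab -EFinB -EFinM.
  by [].
apply: ge0_le_integral => //=.
- by move=> x _; rewrite lee_fin ltW.
- by apply/measurable_EFinP; apply: measurable_funTS; exact: measurable_normal_pdf.
move=> x; rewrite in_itv/= => /andP[ax xb]; rewrite lee_fin normal_pdfE// /e.
apply: ler_wpM2l; first exact: normal_peak_ge0.
rewrite /normal_fun ler_expR subr0 mulNr lerN2; apply: ler_wpM2r.
  by rewrite invr_ge0 mulrn_wge0// sqr_ge0.
rewrite -(real_normK (num_real x)); apply: lerXn2r; rewrite ?nnegrE ?addr_ge0//.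
by rewrite ler_norml; have := ler_norm a; have := ler_norm (- a); have := ler_norm b;
  have := ler_norm (- b); rewrite !normrN => *; apply/andP; split; lra.
Qed.

Section nondegeneracy.
Context {d : measure_display} {Omega : measurableType d} {R : realType}.
Variables (P : probability Omega R) (T H : R).
Variable B : R -> {RV P >-> R}.
Hypotheses (T0 : 0 < T) (H01 : 1 / 2 < H < 1).
Hypothesis hB : fractional_brownian_motion T H B.

Lemma fbm_full_support (t a b : R) : 0 < t <= T -> a < b ->
  ~ {ae P, forall w, ~ (a <= B t w <= b)}.
Proof.
move=> /andP[t0 tT] ab [N [mN PN hN]].
have tI : t \in `[0, T] by rewrite in_itv/= tT ltW.
have mE : measurable (B t @^-1` `[a, b]).
  by rewrite -[X in measurable X]setTI; exact: (_ : measurable_fun setT (B t)).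
have : P (B t @^-1` `[a, b]) = 0%E.
  apply/eqP; rewrite -measure_le0 -PN; apply: le_measure; rewrite ?inE//.
  by move=> w; rewrite /= in_itv/= => h; apply: hN => /=; apply.
have BE : fbm_comb B 1 0 t t = B t.
  by apply/funext => w; rewrite /fbm_comb mul1r mul0r addr0.
have [_ law] := centered_gaussian_law (measurable_fbm_comb B _ _ t t)
  (fbm_comb_gaussian hB 1 0 tI tI) (fbm_comb_mean hB _ _ tI tI)
  (fbm_comb_sqr hB _ _ tI tI).
have := law `[a, b]%classic (measurable_itv _); rewrite BE => -> .
rewrite mulr0 mul0r expr0n/= mul0r !addr0 expr1n mul1r fbm_covxx//.
have s0 : Num.sqrt (t `^ (2 * H)) != 0.
  by rewrite gt_eqF// sqrtr_gt0 powR_gt0.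
rewrite (negbTE s0) => h.
by have := normal_prob_itv_gt0 s0 ab; rewrite h ltxx.
Qed.

Variables (x0 r K : R) (sigma G : R -> R) (X : R -> {RV P >-> R}).
Hypothesis sigma_lip : forall x y, `|sigma x - sigma y| <= K * `|x - y|.
Hypotheses (G_scale : is_scale sigma G x0) (G0 : G x0 = 0).
Hypothesis hX : {ae P, forall w, forall s, 0 <= s <= T ->
  scale_domain sigma x0 (X s w) /\ G (X s w) = B s w + r * s}.
Variable t : R.
Hypothesis t0T : 0 < t < T.

Lemma derivative_not_constant (c : R) :
  ~ {ae P, forall w, H * t^-1 * sigma (X t w) * B t w + r * sigma (X t w) = c}.
Proof.
case/andP: (t0T) => t0 tT; have HH := H01.
have tI : 0 <= t <= T by rewrite !ltW.
have tI' : 0 < t <= T by rewrite t0 ltW.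
pose l := H / t; pose z := - (r / l).
have l0 : 0 < l by rewrite divr_gt0//; lra.
have DE w : H * t^-1 * sigma (X t w) * B t w + r * sigma (X t w) =
    sigma (X t w) * (l * (B t w - z)).
  by rewrite /z -/l; field; rewrite gt_eqF.
move=> Dc; have [c0|c0] := eqVneq c 0.
  apply: (@fbm_full_support t (z + 1) (z + 2) tI'); first lra.
  apply: filterS (filterI Dc hX) => w [h1 hw]; move: h1; rewrite DE c0.
  have [ds _] := hw t tI; move=> /eqP; rewrite mulf_eq0.
  rewrite (negbTE (ds _ (between_r _ _))) mulf_eq0 (gt_eqF l0)/= subr_eq0 => /eqP ->.
  by move=> /andP[? ?]; lra.
have [a [C [a0 C0 hp _]]] := solution_pointwise r T sigma_lip G_scale G0.
pose L := C * expR (a * (`|z| + 1)) * l.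
have L0 : 0 <= L.
  by apply: mulr_ge0; [apply: mulr_ge0 => //; exact: expR_ge0|exact: ltW].
pose eta := Num.min 1 (`|c| / (2 * (L + 1))).
have c0' : 0 < `|c| by rewrite normr_gt0.
have eta0 : 0 < eta by rewrite lt_min ltr01 divr_gt0// mulr_gt0//; lra.
have eta1 : eta <= 1 by rewrite ge_min lexx.
have etac : L * eta < `|c|.
  apply: (@le_lt_trans _ _ (L * (`|c| / (2 * (L + 1))))).
    by apply: ler_wpM2l => //; rewrite ge_min lexx orbT.
  by rewrite mulrA ltr_pdivrMr; [nra|lra].
apply: (@fbm_full_support t (z - eta) (z + eta) tI'); first lra.
apply: filterS (filterI Dc hX) => w [h1 hw]; move: h1; rewrite DE => h1 /andP[h2 h3].
have [ds Gs] := hw t tI; have [_ _ hs] := hp _ _ _ ds Gs tI.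
have hz : `|B t w - z| <= eta by rewrite ler_norml; apply/andP; split; lra.
have hBz : `|B t w| <= `|z| + 1.
  rewrite -[B t w](subrK z) addrC; apply: le_trans (ler_normD _ _) _.
  by rewrite lerD2l; exact: le_trans hz eta1.
move: etac; apply/negP; rewrite -leNgt -h1 mulrA normrM normrM (gtr0_norm l0) /L.
apply: ler_pM => //; first by rewrite mulr_ge0// ltW.
apply: ler_wpM2r; first exact: ltW.
apply: le_trans hs _; apply: ler_wpM2l => //.
by rewrite ler_expR; exact: ler_wpM2l.
Qed.

End nondegeneracy.

Section constant_solution.
Context {d : measure_display} {Omega : measurableType d} {R : realType}.
Variables (P : probability Omega R) (T x0 : R) (X : R -> {RV P >-> R}).
Hypothesis X_cst : {ae P, forall w, forall s, 0 <= s <= T -> X s w = x0}.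

Lemma integrable_ae_cst (f : Omega -> R) (c : R) : measurable_fun setT f ->
  {ae P, forall w, f w = c} -> P.-integrable setT (fun w => (f w)%:E).
Proof.
move=> mf fc; apply/integrableP; split; first exact/measurable_EFinP.
rewrite (ae_eq_integral (cst `|c%:E|%E))//.
- by rewrite integral_cst//= probability_setT mule1 ltry.
- by apply: measurableT_comp => //; exact/measurable_EFinP.
- by apply: filterS fc => w h _; rewrite h.
Qed.

Lemma constant_L2 : L2_process P T X.
Proof.
move=> s; rewrite in_itv/= => sT; apply: Lfun2_of_sqr => //.
apply: (@integrable_ae_cst (fun w => X s w ^+ 2) (x0 ^+ 2)).
  exact: measurable_funX.
by apply: filterS X_cst => w h; rewrite h.
Qed.

Variables (t : R) (D : Omega -> R).
Hypothesis t0T : 0 < t < T.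
Hypotheses (mD : measurable_fun setT D) (D0 : {ae P, forall w, D w = 0}).

Let cond_exp0 (k : R) : `|k| < Num.min t (T - t) ->
  is_cond_exp P (present X t) (diff_quot k X t) (fun=> 0).
Proof.
move=> km; have [t0 tT] := andP t0T.
have quot0 : {ae P, forall w, diff_quot k X t w = 0}.
  apply: filterS X_cst => w h; rewrite /diff_quot !h ?subrr ?mul0r//.
    by rewrite !ltW.
  move: km; rewrite lt_min !ltr_norml => /andP[/andP[h1 h2] /andP[h3 h4]].
  by apply/andP; split; lra.
have mq : measurable_fun setT (diff_quot k X t).
  by apply: measurable_funM => //; exact: measurable_funB.
apply: (@present_cond_exp _ _ _ P X t _ (fun=> 0)) => //.
- exact: (integrable_ae_cst mq quot0).
- exact: integrable0.
- move=> A mA; apply: ae_eq_integral => //.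
  + by rewrite -[X in measurable X]setTI; exact: (_ : measurable_fun setT (X t)).
  + by apply: measurable_funTS; exact/measurable_EFinP.
  + by apply: filterS quot0 => w -> _.
Qed.

Let cvg0 : cvg_in_prob P (fun _ _ => 0) D.
Proof.
move=> delta d0; apply: cvg_near_cst; apply: nearW => h.
apply/eqP; rewrite -measure_le0; have [N [mN PN hN]] := D0.
rewrite -PN; apply: le_measure; rewrite ?inE//.
  rewrite -[X in measurable X]setTI; apply: measurable_fun_le => //.
  by apply: measurableT_comp => //; exact: measurable_funB.
move=> w /= hw; apply: hN => /= Dw; move: hw; rewrite Dw subrr normr0.
by rewrite leNgt d0.
Qed.

Let m0 : 0 < Num.min t (T - t).
Proof. by have [t0 tT] := andP t0T; rewrite lt_min t0 subr_gt0. Qed.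

Lemma constant_fwd_deriv : is_fwd_deriv P T X t (present X t) D.
Proof.
split => //; [exact: constant_L2|exact: present_sub_sigma_field|].
exists (fun _ _ => 0) => //; apply: at_right0_dnbhs.
by apply: filterS (dnbhs0_lt m0) => k; exact: cond_exp0.
Qed.

Lemma constant_bwd_deriv : is_bwd_deriv P T X t (present X t) D.
Proof.
split => //; [exact: constant_L2|exact: present_sub_sigma_field|].
exists (fun _ _ => 0) => //.
apply: (@at_right0_opp_dnbhs _ (fun k => is_cond_exp P (present X t) (diff_quot k X t) (fun=> 0))).
by apply: filterS (dnbhs0_lt m0) => k; exact: cond_exp0.
Qed.

End constant_solution.

Lemma solution_derivatives (R : realType) (d : measure_display)
    (Omega : measurableType d) (P : probability Omega R)
    (T H x0 : R) (sigma b : R -> R) (B X : R -> {RV P >-> R}) :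
  0 < T -> 1 / 2 < H < 1 -> fractional_brownian_motion T H B ->
  Cb 2 sigma -> sde_solution T H x0 sigma b B X ->
  (exists r : R, forall x, b x = r * sigma x) ->
  let D t w := H * t^-1 * sigma (X t w) * B t w + b (X t w) in
  (forall t, 0 < t < T -> is_fwd_deriv P T X t (present X t) (D t) /\
                          is_bwd_deriv P T X t (present X t) (D t)) /\
  (if sigma x0 == 0 then
     as_constant P T X /\ (forall t, 0 < t < T -> {ae P, forall w, D t w = 0})
   else forall t c, 0 < t < T -> ~ {ae P, forall w, D t w = c}).
Proof.
move=> T0 H01 hB /Cb_lipschitz[K sK] hX [r br] D.
have cs : continuous sigma := lipschitz_continuous sK.
have DE t w : D t w = H * t^-1 * sigma (X t w) * B t w + r * sigma (X t w).
  by rewrite /D br.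
have path := solution_path T0 H01 hB sK hX br.
case: eqVneq => [s0|s0].
  have Xc : {ae P, forall w, forall s, 0 <= s <= T -> X s w = x0}.
    by apply: filterS path => w [_ h]; exact: h.
  have D0 t : 0 < t < T -> {ae P, forall w, D t w = 0}.
    move=> /andP[t0 tT]; apply: filterS Xc => w h.
    by rewrite DE h ?s0 ?mulr0 ?mul0r ?addr0//; apply/andP; split; exact: ltW.
  have mD t : measurable_fun setT (D t).
    have ms : measurable_fun setT (fun w => sigma (X t w)).
      by apply: measurableT_comp => //; exact: continuous_measurable_fun.
    rewrite (_ : D t = fun w => H * t^-1 * sigma (X t w) * B t w + r * sigma (X t w)).
      by apply: measurable_funD; [apply: measurable_funM => //|]; exact: measurable_funM.
    exact/funext.
  split; last split => //.
    move=> t tT; split; first exact: (constant_fwd_deriv Xc tT (mD t) (D0 t tT)).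
    exact: (constant_bwd_deriv Xc tT (mD t) (D0 t tT)).
  by apply: filterS Xc => w h s u; rewrite !in_itv => sT uT; rewrite !h.
pose G := signed_integral (fun z => (sigma z)^-1) x0.
have Gs : is_scale sigma G x0 := is_scale_signed_integral (x0 := x0) cs.
have G0 : G x0 = 0 by rewrite /G /signed_integral lexx set_itv1 Rintegral_set1.
have hXG : {ae P, forall w, forall s, 0 <= s <= T ->
    scale_domain sigma x0 (X s w) /\ G (X s w) = B s w + r * s}.
  by apply: filterS path => w [h _] s sT; exact: h.
have DE' t : D t = fun w => H * t^-1 * sigma (X t w) * B t w + r * sigma (X t w).
  exact/funext.
split=> [t tT|t c tT]; rewrite DE'.
  split; first exact: (present_fwd_deriv H01 hB sK Gs G0 hXG).
  exact: (present_bwd_deriv H01 hB sK Gs G0 hXG).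
exact: (derivative_not_constant H01 hB sK Gs G0 hXG tT).
Qed.

Unset Implicit Arguments.
Set Strict Implicit.
Set Printing Implicit Defensive.

Theorem proposition19 (R : realType) (d : measure_display)
    (Omega : measurableType d) (P : probability Omega R)
    (T H x0 : R) (sigma b : R -> R) (B X : R -> {RV P >-> R}) (t : R)
    (hT : 0 < T) (hP : measure_is_complete P)
    (hH : 1 / 2 < H < 1)
    (hB : fractional_brownian_motion T H B)
    (hsigma : Cb 2 sigma) (hb : Cb 1 b)
    (hX : sde_solution T H x0 sigma b B X)
    (hprop : exists r : R, forall x, b x = r * sigma x)
    (ht : t \in `]0, T[) :
  let D := fun w => H * t^-1 * sigma (X t w) * B t w + b (X t w) in
  [/\ is_fwd_deriv P T X t (present X t) D,
      is_bwd_deriv P T X t (present X t) D,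
      fwd_nondegenerate P T X t (present X t) <-> sigma x0 <> 0,
      bwd_nondegenerate P T X t (present X t) <-> sigma x0 <> 0 &
      discriminating P T X (present X)].
Proof.
have [deriv dich] := solution_derivatives hT hH hB hsigma hX hprop; move=> D.
have tT : 0 < t < T by move: ht; rewrite in_itv.
have [fw bw] := deriv t tT.
have mD : measurable_fun setT D by case: fw.
have disc : discriminating P T X (present X).
  split=> [u|zero].
    rewrite in_itv => /deriv[h1 h2].
    by split; eexists; [exact: h1|exact: h2].
  move: dich; case: eqVneq => [_ []//|_ /(_ t 0 tT)]; case.
  by have [z _] := zero t ht; have := fwd_deriv_unique fw z.
split => //; split.
- move=> [D' hD' D'c] s0; move: dich; rewrite s0 eqxx => -[_ /(_ _ tT) h].
  have [_ _ mD' _] := hD'; have /(prob_eq_lt1 _ _ mD') := D'c 0; apply.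
  by apply: filterS2 h (fwd_deriv_unique fw hD') => w -> ->.
- move=> /eqP s0; move: dich; rewrite (negbTE s0) => h; exists D => // c.
  by apply/prob_eq_lt1 => //; exact: h.
- move=> [D' hD' D'c] s0; move: dich; rewrite s0 eqxx => -[_ /(_ _ tT) h].
  have [_ _ mD' _] := hD'; have /(prob_eq_lt1 _ _ mD') := D'c 0; apply.
  by apply: filterS2 h (bwd_deriv_unique bw hD') => w -> ->.
- move=> /eqP s0; move: dich; rewrite (negbTE s0) => h; exists D => // c.
  by apply/prob_eq_lt1 => //; exact: h.
Qed.
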